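(* Let $X=\mathbb{P}^1$ be the projective line over a finite field, with function field $K$. Then the following statements are equivalent for any effective divisor $D$ on $X$: (1) every Eichler order of level $D$ in $\mathbb{M}_2(K)$ is split; (2) $D$ is the sum of at most two different closed points of degree $1$.
   Context: Let $X=\mathbb{P}^1$ be the projective line over a finite field, $\mathcal{O}_X$ its structure sheaf, $K$ its function field, and $|X|$ its set of closed points. For $P\in|X|$ let $K_P$ be the completion of $K$ at $P$, $\mathcal{O}_P$ its ring of integers and $\pi_P$ a uniformizer. An $X$-lattice in a finite dimensional $K$-vector space $V$ is a locally free sheaf $\Lambda$ of $\mathcal{O}_X$-modules of finite rank with generic fiber identified with a $K$-subspace of $V$, so that every $\Lambda(U)$ is regarded as a subset of $V$. An $X$-order $\mathfrak{D}$ in a $K$-algebra $\mathfrak{A}$ is an $X$-lattice in $\mathfrak{A}$ such that $\mathfrak{D}(U)$ is a (unital) ring for every open $U\subseteq X$. All orders here lie in $\mathbb{M}_2(K)$ and have maximal rank (generic fiber all of $\mathbb{M}_2(K)$). The completion $\mathfrak{D}_P\subseteq\mathbb{M}_2(K_P)$ is the closure of $\mathfrak{D}(U)$ for any affine open $U$ containing $P$. An order is maximal if it is not properly contained in another order. An Eichler order is an intersection $\mathfrak{E}=\mathfrak{D}\cap\mathfrak{D}'$ of two maximal $X$-orders in $\mathbb{M}_2(K)$. For $P\in|X|$, the local distance $d_P(\mathfrak{D}_P,\mathfrak{D}'_P)$ is the integer $d\ge 0$ such that in some basis of $K_P^2$ one has $\mathfrak{D}_P=\begin{pmatrix}\mathcal{O}_P&\mathcal{O}_P\\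 \mathcal{O}_P&\mathcal{O}_P\end{pmatrix}$ and $\mathfrak{D}'_P=\begin{pmatrix}\mathcal{O}_P&\pi_P^{d}\mathcal{O}_P\\ \pi_P^{-d}\mathcal{O}_P&\mathcal{O}_P\end{pmatrix}$. The level of $\mathfrak{E}$ is the effective divisor $\sum_{P\in|X|}d_P(\mathfrak{D}_P,\mathfrak{D}'_P)P$ (it depends only on $\mathfrak{E}$). For a divisor $B$ on $X$, $\mathfrak{L}^B$ is the invertible bundle in $K$ given by $\mathfrak{L}^B(U)=\{f\in K : \mathrm{div}(f)|_U+B|_U\ge 0\}$; every invertible bundle in $K$ has this form. An order $\mathfrak{E}$ is split if it is $\mathrm{GL}_2(K)$-conjugate to $\begin{pmatrix}\mathcal{O}_X&\mathfrak{L}_1\\ \mathfrak{L}_2&\mathcal{O}_X\end{pmatrix}$ for some invertible bundles $\mathfrak{L}_1,\mathfrak{L}_2$ in $K$; equivalently, its ring of global sections $\mathfrak{E}(X)$ contains an idempotent different from $0$ and $1$. In (2), the empty sum $D=0$ and a single point of degree $1$ are allowed. *)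

(* Defs.v *)
From HB Require Import structures.
From mathcomp Require Import all_boot all_algebra.
From mathcomp Require Import qpoly fraction generic_quotient ring_quotient.
From mathcomp Require Import boolp classical_sets functions cardinality.
From mathcomp Require Import ring.

Set Implicit Arguments.
Unset Strict Implicit.
Unset Printing Implicit Defensive.

Import GRing.Theory.

Local Open Scope classical_set_scope.
Local Open Scope ring_scope.

Notation "''K_' F" := {fraction {poly F}}
  (at level 8, F at level 2, format "''K_' F").
Local Notation "x %:F" := (@tofrac _ x).

(* A closed point of the projective line is a monic irreducible polynomial,
   i.e. a maximal ideal of F[t], or the point at infinity [None]. *)
Definition closed_point (F : finFieldType) : Type :=
  option {p : {poly F} | (p \is monic) && irreducibleb p}.

Section LocalRings.
Variable F : finFieldType.
Implicit Types (P : closed_point F) (f g : 'K_F).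

Definition point_degree P : nat :=
  if P is Some p then (size (val p)).-1 else 1%N.

(* The stalk of the structure sheaf at P: the fractions a/b with b not
   vanishing at P; at infinity, deg a <= deg b. *)
Definition local_ring P : set 'K_F :=
  [set f | exists a b : {poly F}, f = a%:F / b%:F /\
     if P is Some p then ~~ (val p %| b)%R else (b != 0) && (size a <= size b)%N].

Definition unif P : 'K_F := if P is Some p then (val p)%:F else ('X%:F)^-1.

Lemma point_irr (p : {p : {poly F} | (p \is monic) && irreducibleb p}) :
  irreducible_poly (val p).
Proof. by case: p => p /= /andP[_ /irreducibleP]. Qed.

Lemma point_prime (p : {p : {poly F} | (p \is monic) && irreducibleb p})
    (a b : {poly F}) : ((val p %| a * b) = (val p %| a) || (val p %| b))%R.
Proof.
apply/idP/orP => [hab|[h|h]]; [|exact: dvdp_mulr|exact: dvdp_mull].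
have [sp hp] := point_irr p.
have [h|/negPf h] := boolP (val p %| a)%R; [by left|right].
have cop : coprimep (val p) a.
  rewrite /coprimep; apply/negPn/negP => hs.
  have := hp _ hs (dvdp_gcdl _ _) => /eqp_dvdl e.
  by move: (dvdp_gcdr (val p) a); rewrite e h.
by rewrite -(Gauss_dvdpr _ cop).
Qed.

Lemma unif_neq0 P : unif P != 0.
Proof.
case: P => [p|] /=; last by rewrite invr_eq0 tofrac_eq0 polyX_eq0.
rewrite tofrac_eq0; apply: contraTneq (valP p) => /= ->.
by rewrite monicE lead_coef0 eq_sym oner_eq0.
Qed.

Lemma local_ring1 P : local_ring P 1.
Proof.
exists 1, 1; rewrite divr1 tofrac1; split=> //.
case: P => [p|]; last by rewrite oner_eq0 leqnn.
have [sp _] := point_irr p.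
by rewrite dvdp1; case: eqP sp => // ->.
Qed.

Lemma local_ringM P f g : local_ring P f -> local_ring P g -> local_ring P (f * g).
Proof.
move=> [a [b [-> hb]]] [c [d [-> hd]]]; exists (a * c), (b * d).
split; first by rewrite !tofracM invfM mulrACA.
case: P hb hd => [p hb hd|/andP[b0 ab] /andP[d0 cd]].
  by rewrite point_prime negb_or hb.
rewrite mulf_neq0 //= (leq_trans (size_polyMleq _ _)) // size_mul //.
by rewrite -!subn1 leq_sub2r // leq_add.
Qed.

Lemma local_ringB P f g : local_ring P f -> local_ring P g -> local_ring P (f - g).
Proof.
move=> [a [b [-> hb]]] [c [d [-> hd]]]; exists (a * d - c * b), (b * d).
have nz (e h : {poly F}) :
    (if P is Some p then ~~ (val p %| e)%R : Prop
     else (e != 0) && (size h <= size e)%N) -> e != 0.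
  by case: (P) => [p|/andP[]//]; apply: contraNneq => ->; rewrite dvdp0.
have b0 := nz _ _ hb; have d0 := nz _ _ hd; move: nz => _.
split.
  by rewrite tofracB !tofracM -mulNr addf_div ?tofrac_eq0 // mulNr.
case: P hb hd => [p hb hd|/andP[_ ab] /andP[_ cd]].
  by rewrite point_prime negb_or hb.
rewrite mulf_neq0 //= (leq_trans (size_polyD _ _)) // size_polyN geq_max.
rewrite !(leq_trans (size_polyMleq _ _)) // size_mul //.
  by rewrite addnC -!subn1 leq_sub2r // leq_add2l.
by rewrite -!subn1 leq_sub2r // leq_add2r.
Qed.

Lemma local_ring0 P : local_ring P 0.
Proof. by rewrite -(subrr 1); apply: local_ringB; apply: local_ring1. Qed.

Lemma local_ringN P f : local_ring P f -> local_ring P (- f).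
Proof. by rewrite -sub0r; apply: local_ringB; apply: local_ring0. Qed.

Lemma local_ringD P f g : local_ring P f -> local_ring P g -> local_ring P (f + g).
Proof. by move=> hf hg; rewrite -(opprK g); apply/local_ringB/local_ringN. Qed.

Lemma local_ring_unif P : local_ring P (unif P).
Proof.
case: P => [p|].
  have [sp _] := point_irr p.
  exists (val p), 1; rewrite tofrac1 divr1; split=> //.
  by rewrite dvdp1; case: eqP sp => // ->.
exists 1, 'X; rewrite tofrac1 div1r; split=> //.
by rewrite polyX_eq0 size_poly1 size_polyX.
Qed.

Lemma local_ring_unifX P n : local_ring P (unif P ^+ n).
Proof.
elim: n => [|n ih]; rewrite ?expr0 ?exprS; first exact: local_ring1.
by apply: local_ringM => //; apply: local_ring_unif.
Qed.

Lemma fracP f :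
  exists a b : {poly F}, [/\ b != 0, coprimep a b & f = a%:F / b%:F].
Proof.
suff [a [b [b0 ->]]] : exists a b : {poly F}, b != 0 /\ f = a%:F / b%:F.
  have g0 : gcdp a b != 0 by rewrite gcdp_eq0 negb_and b0 orbT.
  have cop : coprimep (a %/ gcdp a b)%R (b %/ gcdp a b)%R.
    by apply: coprimep_div_gcd; rewrite b0 orbT.
  have ea := divpK (dvdp_gcdl a b); have eb := divpK (dvdp_gcdr a b).
  move: (gcdp a b) (a %/ _)%R (b %/ _)%R g0 cop ea eb => g a' b' g0 cop ea eb.
  have b'0 : b' != 0 by apply: contra_neq b0 => h; rewrite -eb h mul0r.
  exists a', b'; split=> //.
  by rewrite -ea -eb !tofracM -mulf_div divff ?mulr1 // tofrac_eq0.
elim/quotW: f => -[[a b] /= b0]; exists a, b; split=> //.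
apply: (@mulIf _ b%:F); first by rewrite tofrac_eq0.
rewrite divfK ?tofrac_eq0 //; unlock tofrac.
rewrite -[LHS]FracField.pi_mul; apply/eqmodP; rewrite /= FracField.equivfE.
by rewrite !numden_Ratio ?(oner_eq0, mulf_neq0, mulr1, mul1r) // mulrC.
Qed.

Lemma local_ring_val P f : ~ local_ring P f -> local_ring P f^-1.
Proof.
have [a [b [b0 cab ->]]] := fracP f => h.
have [a0|a0] := eqVneq a 0.
  by case: h; rewrite a0 tofrac0 mul0r; apply: local_ring0.
exists b, a; split; first by rewrite invf_div.
case: P h => [p|] h; last first.
  rewrite a0 /= leqNgt; apply/negP => hs; apply: h; exists a, b.
  by rewrite b0 (ltnW hs).
apply/negP => pa; apply: h; exists a, b; split=> //; apply/negP => pb.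
have [sp _] := point_irr p.
move: cab; rewrite -gcdp_eqp1 => cab.
have := dvdp_gcd (val p) a b; rewrite pa pb (eqp_dvdr _ cab) dvdp1.
by case: eqP sp => // ->.
Qed.

Lemma local_ring_bounded P f : exists n : nat, local_ring P (unif P ^+ n * f).
Proof.
have [a [b [b0 _ ->]]] := fracP f.
case: P => [p|]; last first.
  exists (size a), a, ('X^(size a) * b); split.
    by rewrite /= exprVn tofracM tofracXn invfM mulrCA.
  have xn : 'X^(size a) != 0 :> {poly F} by rewrite expf_neq0 // polyX_eq0.
  rewrite mulf_neq0 //= size_mul // size_polyXn addSn /= leq_addr //.
have [sp _] := point_irr p.
have p0 : val p != 0 by case: eqP sp => // ->; rewrite size_poly0.
have [n] := ubnP (size b); elim: n => // n ih in b b0 *.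
rewrite ltnS => sb.
have [|pb] := boolP (val p %| b)%R; last first.
  by exists 0%N; rewrite expr0 mul1r; exists a, b.
case/dvdpP => c def; have c0 : c != 0 by apply: contra_neq b0 => c0; rewrite def c0 mul0r.
have [|m hm] := ih c c0.
  apply: leq_trans sb; rewrite def size_mul //.
  by case: (size (val p)) sp => [//|[//|k]] _; rewrite addnS /= addnS ltnS leq_addr.
exists m.+1; rewrite def tofracM invfM exprSr -mulrA.
suff -> : unif (Some p) * (a%:F * (c%:F^-1 * (val p)%:F^-1)) = a%:F / c%:F by [].
by rewrite /= mulrCA [_^-1 / _]mulrC mulVKf // tofrac_eq0.
Qed.

Lemma local_ring_unifV P : ~ local_ring P (unif P)^-1.
Proof.
move=> [a [b [e h]]].
have b0 : b != 0.
  by case: P h {e} => [p|/andP[]//]; apply: contraNneq => ->; rewrite dvdp0.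
case: P e h => [p|] e h.
  case/negP: h; apply/dvdpP; exists a; apply/eqP.
  rewrite -tofrac_eq tofracM.
  have : b%:F = (unif (Some p))^-1 * (unif (Some p)) * b%:F.
    by rewrite mulVf ?unif_neq0 // mul1r.
  by rewrite e mulrAC divfK ?tofrac_eq0 // => ->.
have /eqP : ('X * b)%:F = a%:F :> 'K_F.
  by rewrite tofracM -['X%:F]invrK e divfK // tofrac_eq0.
rewrite tofrac_eq => /eqP ea; move: h; rewrite -ea size_mul ?polyX_eq0 //.
by rewrite size_polyX b0 /= ltnn.
Qed.

End LocalRings.

Lemma divf_sub_expand (L : fieldType) (x y a b : L) : x != 0 -> y != 0 -> a != 0 ->
  (y - x) / (b * a * a) * (a / x) * (a / y) = (x^-1 - y^-1) / b.
Proof.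
move=> x0 y0 a0; rewrite !invfM; move: b^-1 => B; field.
by rewrite x0 y0.
Qed.

(* The completion K_P: Cauchy sequences of K for the P-adic topology, modulo
   null sequences. *)
Section Completion.
Variables (F : finFieldType) (P : closed_point F).
Local Notation K := ('K_F).
Local Notation O := (local_ring P).
Local Notation pi := (unif P).

Definition cauchy_seq (s : nat -> K) : Prop :=
  forall n, exists N, forall i j, (N <= i)%N -> (N <= j)%N ->
    O ((s i - s j) / pi ^+ n).

Definition null_seq (s : nat -> K) : Prop :=
  forall n, exists N, forall i, (N <= i)%N -> O (s i / pi ^+ n).

Definition cauchyb : {pred nat -> K} := [pred s | `[< cauchy_seq s >]].

Lemma unifX_neq0 n : pi ^+ n != 0.
Proof. by rewrite expf_neq0 // unif_neq0. Qed.

Lemma unifX_cancel n k x y : x / pi ^+ (n + k) * (pi ^+ k * y) = x * y / pi ^+ n.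
Proof. by rewrite exprD invfM !mulrA divfK ?unifX_neq0 // mulrAC. Qed.

Lemma local_ring_le n m f : (n <= m)%N -> O (f / pi ^+ m) -> O (f / pi ^+ n).
Proof.
move=> nm; rewrite -{1}(subnKC nm) exprD => h.
have := local_ringM h (local_ring_unifX P (m - n)).
by rewrite invfM mulrA divfK ?unifX_neq0.
Qed.

Lemma cauchy_bounded s : cauchy_seq s -> exists n, exists N,
  forall i, (N <= i)%N -> O (pi ^+ n * s i).
Proof.
move=> /(_ 0%N) [N hN]; have [n hn] := local_ring_bounded P (s N).
exists n, N => i Ni; rewrite -(subrK (s N) (s i)) mulrDr.
apply: local_ringD => //; apply: local_ringM; first exact: local_ring_unifX.
by have := hN _ _ Ni (leqnn N); rewrite expr0 divr1.
Qed.

Lemma cauchyb_subring : subring_closed cauchyb.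
Proof.
split=> [|s u /asboolP cs /asboolP cu|s u /asboolP cs /asboolP cu]; apply/asboolP => n.
- by exists 0%N => i j _ _; rewrite subrr mul0r; apply: local_ring0.
- have [N hN] := cs n; have [M hM] := cu n; exists (maxn N M) => i j.
  rewrite !geq_max => /andP[Ni Mi] /andP[Nj Mj].
  rewrite (_ : _ / _ = (s i - s j) / pi ^+ n - (u i - u j) / pi ^+ n).
    by apply: local_ringB; [apply: hN|apply: hM].
  by rewrite -mulrBl /= !opprB [u j - s j]addrC addrACA [- u i + u j]addrC.
have [ns [Ns hs]] := cauchy_bounded cs; have [nu [Nu hu]] := cauchy_bounded cu.
have [N hN] := cs (n + nu)%N; have [M hM] := cu (n + ns)%N.
exists (maxn (maxn Ns Nu) (maxn N M)) => i j.
rewrite !geq_max => /andP[/andP[Nsi Nui] /andP[Ni Mi]].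
move=> /andP[/andP[Nsj Nuj] /andP[Nj Mj]].
rewrite (_ : _ / _ = (s i - s j) / pi ^+ (n + nu) * (pi ^+ nu * u i) +
                     (u i - u j) / pi ^+ (n + ns) * (pi ^+ ns * s j)).
  by apply: local_ringD; apply: local_ringM; auto.
rewrite !unifX_cancel -mulrDl; congr (_ / _); rewrite !mulrBl /=.
by rewrite [u i * _]mulrC [u j * _]mulrC addrA subrK.
Qed.

HB.instance Definition _ := GRing.isSubringClosed.Build (nat -> K) cauchyb
  cauchyb_subring.

Definition cauchyT := {s : nat -> K | s \in cauchyb}.
HB.instance Definition _ := SubChoice.on cauchyT.
HB.instance Definition _ := [SubChoice_isSubComNzRing of cauchyT by <:].

Definition nullb : {pred cauchyT} := [pred s | `[< null_seq (val s) >]].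

Lemma nullb_ideal : idealr_closed nullb.
Proof.
split.
- apply/asboolP => n; exists 0%N => i _; rewrite mul0r; exact: local_ring0.
- apply/asboolP => /(_ 1%N) [N /(_ N (leqnn N))].
  by rewrite expr1 div1r; apply: local_ring_unifV.
move=> a u v /asboolP nu /asboolP nv; apply/asboolP => n.
have /asboolP ca := valP a; have [k [N hN]] := cauchy_bounded ca.
have [M hM] := nu (n + k)%N; have [L hL] := nv n.
exists (maxn N (maxn M L)) => i; rewrite !geq_max => /and3P[Ni Mi Li].
rewrite /= mulrDl; apply: local_ringD; last exact: hL.
have := local_ringM (hM _ Mi) (hN _ Ni).
by rewrite unifX_cancel [u' in O (u' / _)]mulrC.
Qed.

HB.instance Definition _ := isIdealr.Build cauchyT nullb nullb_ideal.

Definition completion := {ideal_quot nullb}.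
HB.instance Definition _ := GRing.ComNzRing.on completion.

Lemma cauchy_inv s : cauchy_seq s -> ~ null_seq s ->
  cauchy_seq (fun i => (s i)^-1) /\ exists N, forall i, (N <= i)%N -> s i != 0.
Proof.
move=> cs ns.
have [n [N hN]] : exists n, exists N, forall i, (N <= i)%N ->
    s i != 0 /\ O (pi ^+ n / s i).
  apply: contrapT => h; apply: ns => n; have [N hN] := cs n.
  exists N => i Ni; apply: contrapT => hi; apply: h; exists n, N => j Nj.
  have hj : ~ O (s j / pi ^+ n).
    move=> hj; apply: hi; rewrite -(subrK (s j) (s i)) mulrDl.
    by apply: local_ringD => //; apply: hN.
  split; last by rewrite -invf_div; apply: local_ring_val.
  by apply: contra_notN hj => /eqP ->; rewrite mul0r; apply: local_ring0.
split; last by exists N => i /hN[].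
move=> m; have [M hM] := cs (m + n + n)%N; exists (maxn N M) => i j.
rewrite !geq_max => /andP[/hN[si hi] Mi] /andP[/hN[sj hj] Mj].
have := local_ringM (local_ringM (hM _ _ Mj Mi) hi) hj.
have E := divf_sub_expand (pi ^+ m) si sj (unifX_neq0 n).
by rewrite !exprD E.
Qed.

Lemma completion_field (x : completion) : x != 0 -> exists y, y * x = 1.
Proof.
elim/quotW: x => s; have /asboolP cs := valP s.
rewrite -[0](rmorph0 (\pi_completion)%qT) -Quotient.idealrBE subr0.
move=> /asboolP ns; have [cu [N hN]] := cauchy_inv cs ns.
pose u : cauchyT := exist (fun s => s \in cauchyb) _ (asboolT cu).
exists (\pi_completion u)%qT; rewrite -rmorphM -[RHS](rmorph1 (\pi_completion)%qT).
apply/eqP; rewrite -Quotient.idealrBE; apply/asboolP => n.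
exists N => i /hN si; have -> : val (u * s - 1) i = 0.
  by apply/eqP; rewrite subr_eq0; apply/eqP; exact: mulVf.
by rewrite mul0r; apply: local_ring0.
Qed.

Definition completion_inv (x : completion) : completion :=
  xget 0 [set y | y * x = 1].

Lemma completion_mulVf x : x != 0 -> completion_inv x * x = 1.
Proof. by move=> /completion_field yx; exact: (@xgetPex _ 0 [set y | y * x = 1] yx). Qed.

Lemma completion_inv0 : completion_inv 0 = 0.
Proof.
rewrite /completion_inv; case: xgetP => //= y _ /eqP.
by rewrite mulr0 eq_sym oner_eq0.
Qed.

HB.instance Definition _ :=
  GRing.ComNzRing_isField.Build completion completion_mulVf completion_inv0.

Lemma cauchy_cst (f : K) : (fun=> f) \in cauchyb.
Proof.
by apply/asboolP => n; exists 0%N => i j _ _; rewrite subrr mul0r; exact: local_ring0.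
Qed.

Definition cauchy_class (s : cauchyT) : completion := (\pi_completion s)%qT.

Definition completion_of (f : K) : completion :=
  cauchy_class (exist (fun s => s \in cauchyb) _ (cauchy_cst f)).

Definition completed_ring : set completion :=
  [set x | exists2 s : cauchyT, x = cauchy_class s & forall i, O (val s i)].

Definition completed_unif : completion := completion_of pi.

End Completion.

Arguments completed_ring {F} P.
Arguments completed_unif {F} P.
Arguments completion_of {F} P.

Section Matrices.
Variable L : fieldType.

Definition mx2_set (a b c d : set L) : set 'M[L]_2 :=
  [set A | [/\ a (A 0 0), b (A 0 1), c (A 1 0) & d (A 1 1)]].

Definition conj_set (g : 'M[L]_2) (S : set 'M[L]_2) : set 'M[L]_2 :=
  [set g *m A *m invmx g | A in S].

Definition scale_set (a : L) (S : set L) : set L := [set a * x | x in S].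

End Matrices.

Section Lattices.
Variable F : finFieldType.
Local Notation K := ('K_F).
Local Notation pt := (closed_point F).

(* Open subsets of the scheme X correspond to their sets of closed points.
   Only nonempty opens matter: a sheaf takes the value 0 on the empty one. *)
Definition open_set (U : set pt) : Prop := U !=set0 /\ finite_set (~` U).

(* A nonempty open subset of the projective line is affine iff it is proper. *)
Definition affine_open (U : set pt) : Prop := open_set U /\ U <> setT.

Definition structure_sheaf (U : set pt) : set K :=
  [set f | forall P, U P -> local_ring P f].

Section InSpace.
Variable V : lmodType K.
(* A subsheaf of the constant sheaf V is given by its sections over the
   nonempty opens; its values at other sets of points are irrelevant, and all
   notions below ignore them. *)
Implicit Type L : set pt -> set V.

Record is_sheaf_of_modules L : Prop := {
  sections_restrict : forall U W, open_set U -> open_set W -> U `<=` W ->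
    L W `<=` L U;
  (* Compatibility of the local sections is automatic inside V. *)
  sections_glue : forall (C : set (set pt)) W, open_set W ->
    C `<=` open_set -> W = \bigcup_(U in C) U ->
    \bigcap_(U in C) L U `<=` L W;
  sections_0 : forall U, open_set U -> L U 0;
  sections_D : forall U v w, open_set U -> L U v -> L U w -> L U (v + w);
  sections_Z : forall U f v, open_set U -> structure_sheaf U f -> L U v ->
    L U (f *: v)
}.

Definition locally_free_of_rank (r : nat) L : Prop :=
  forall P, exists U, [/\ open_set U, U P &
    exists b : 'I_r -> V, forall W, open_set W -> W `<=` U ->
      (forall i, L W (b i)) /\
      forall v, L W v -> exists! a : {ffun 'I_r -> K},
        (forall i, structure_sheaf W (a i)) /\ v = \sum_i a i *: b i].

Definition is_lattice L : Prop :=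
  is_sheaf_of_modules L /\ exists r, locally_free_of_rank r L.

(* The stalk at the generic point. *)
Definition generic_fiber L : set V :=
  [set v | exists2 U, open_set U & L U v].

End InSpace.

Definition is_invertible_bundle (L : set pt -> set K) : Prop :=
  @is_sheaf_of_modules K^o L /\ @locally_free_of_rank K^o 1 L.

Implicit Types D E : set pt -> set 'M[K]_2.

Record is_order D : Prop := {
  order_lattice : is_lattice D;
  order_full : generic_fiber D = setT;
  order_1 : forall U, open_set U -> D U 1%:M;
  order_M : forall U A B, open_set U -> D U A -> D U B -> D U (A *m B)
}.

Definition subsheaf D E : Prop := forall U, open_set U -> D U `<=` E U.

Definition eq_sheaf D E : Prop := forall U, open_set U -> D U = E U.

Definition is_maximal_order D : Prop :=
  is_order D /\ forall E, is_order E -> subsheaf D E -> eq_sheaf D E.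

Definition closure_at (P : pt) (S : set 'M[K]_2) : set 'M[completion P]_2 :=
  [set A | forall n, exists2 B, S B & forall i j,
     scale_set (completed_unif P ^+ n) (completed_ring P)
       (A i j - completion_of P (B i j))].

(* The closure of D(U) does not depend on the affine open U containing P. *)
Definition order_completion (P : pt) D : set 'M[completion P]_2 :=
  [set A | exists U, [/\ affine_open U, U P & @closure_at P (D U) A]].
Arguments order_completion P D : clear implicits.

Definition local_distance (P : pt) D E (d : nat) : Prop :=
  let O := completed_ring P in
  let pi := completed_unif P in
  exists2 g : 'M[completion P]_2, g \in unitmx &
    order_completion P D = conj_set g (mx2_set O O O O) /\
    order_completion P E =
      conj_set g (mx2_set O (scale_set (pi ^+ d) O) (scale_set (pi ^- d) O) O).

Definition is_effective_divisor (B : pt -> nat) : Prop :=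
  finite_set [set P | B P != 0%N].

(* The divisor of the local distances depends only on E. *)
Definition is_Eichler_order_of_level (B : pt -> nat) E : Prop :=
  exists D1 D2, [/\ is_maximal_order D1, is_maximal_order D2,
    eq_sheaf E (fun U => D1 U `&` D2 U) &
    forall P, local_distance P D1 D2 (B P)].

Definition is_split E : Prop :=
  exists g : 'M[K]_2, exists L1 L2 : set pt -> set K,
    [/\ g \in unitmx, is_invertible_bundle L1, is_invertible_bundle L2 &
      eq_sheaf E (fun U => conj_set g
        (mx2_set (structure_sheaf U) (L1 U) (L2 U) (structure_sheaf U)))].

Definition is_sum_of_at_most_two_rational_points (B : pt -> nat) : Prop :=
  exists s : seq pt, [/\ uniq s, (size s <= 2)%N,
    all (fun P => point_degree P == 1%N) s &
    forall P, B P = (\sum_(Q <- s) (P == Q))%N].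

End Lattices.

(* Main.v *)
From HB Require Import structures.
Require Import Defs.
From mathcomp Require Import all_boot all_algebra.
From mathcomp Require Import qpoly fraction ring_quotient.
From mathcomp Require Import boolp classical_sets functions cardinality.
From mathcomp Require Import ring.

(** A maximal order is the sheaf of endomorphisms of a vector bundle of rank two,
    so that an Eichler order of level D is the ring of endomorphisms of a bundle
    that preserve a line modulo P^D(P) at every point P. It is split when the
    bundle is a sum of two line bundles such that each of these lines is the fibre
    of one of them.

    Let D be a sum of at most two rational points. By Grothendieck
    the bundle is O + O(n), up to a twist (global_frame). When n > 0, an
    automorphism given by a section of O(n) moves the lines at both points to the
    coordinate axes, because sections of O(n) take arbitrary values at two rational
    points (interpolation); when n = 0, the lines lie in a plane over F, and two
    distinct ones form a basis of it (adjust_lines). The order is then split by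
    split_of_two_points.

    Otherwise D has a point where degree times multiplicity is at least two, or at
    least three rational points. Lines in the trivial bundle O + O then define
    an Eichler order that is not split (Eichler_of_lines). Indeed a splitting yields
    a global idempotent of rank one. Its entries are rational functions without
    poles, thus constants, and the only lines that it preserves are its image and
    its kernel. In the first case the line (t : 1) is not constant modulo
    P^D(P) (nonsplit_nonconstant_line); in the second case one of three distinct
    constant lines is neither the image nor the kernel (nonsplit_three_points).

    All the sheaves involved are given by their stalks inside a constant sheaf
    (stalkwise). An order M_2(O_P) in the frame g_P is the set of the A with
    g_P^-1 A g_P integral (twist), and a maximal order corresponds to a family of
    frames, trivial at almost all points (maximal_order_end, end_order_maximal).
    The local distance is defined over the completion; since the
    completion of such an order is the same set over the completed ring
    (order_completion_end), and since frames over the completion are approximated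
    by frames over K (frame_dense), a frame over K is adapted to both
    maximal orders (Eichler_frame). *)

Set Implicit Arguments.
Unset Strict Implicit.
Unset Printing Implicit Defensive.

Import GRing.Theory.

Local Open Scope classical_set_scope.
Local Open Scope ring_scope.
Local Notation "x %:F" := (@tofrac _ x).

(** * Points of the projective line and their local rings *)

Lemma mulf_divA (L : fieldType) (f x y : L) : f / (x / y) = y * f / x.
Proof. by rewrite invf_div mulrA [f * _]mulrC. Qed.

Lemma mulf_divAC (L : fieldType) (f x y : L) : x / y / f = x / (y * f).
Proof. by rewrite -mulrA -invfM. Qed.

Lemma mulf_approx (L : fieldType) (f r g x y : L) : x != 0 -> y != 0 ->
  ((f - r) / y - g) / x = (f - (r + y * g)) / (x * y).
Proof. by move=> x0 y0; field; rewrite x0 y0. Qed.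

Lemma mulf_rescale (L : fieldType) (f g z x y : L) : x != 0 -> y != 0 ->
  (x * f - g) / (x * y) * (y / z) = (f - g / x) / z.
Proof.
move=> x0 y0; rewrite [y / z]mulrC mulrA mulrAC; congr (_ / _).
by field; rewrite x0 y0.
Qed.

Lemma mulf_div_cancel (L : fieldType) (x y z : L) : y != 0 -> x * y / z / y = x / z.
Proof. by move=> y0; rewrite mulrAC mulfK. Qed.

Section Points.
Variable F : finFieldType.
Local Notation K := 'K_F.
Local Notation pt := (closed_point F).
Local Notation fpt := {p : {poly F} | (p \is monic) && irreducibleb p}.
Implicit Types (P Q : pt) (f g : K) (a b s : {poly F}).

Lemma point_neq0 (p : fpt) : val p != 0.
Proof. exact: irredp_neq0 (point_irr p). Qed.

Lemma dvdp_points (p q : fpt) :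
  (val p %| val q)%R -> p = q.
Proof.
move=> pq; apply: val_inj; apply/eqP; rewrite -eqp_monic.
- by apply: (point_irr q).2 => //; have [sp _] := point_irr p; case: eqP sp => // ->.
- by case/andP: (valP p).
- by case/andP: (valP q).
Qed.

(** A nonconstant polynomial that is not irreducible has a nonconstant divisor of
    smaller degree, and the descent ends at an irreducible one. *)
Lemma exists_point_dvd a : (1 < size a)%N ->
  exists p : fpt, (val p %| a)%R.
Proof.
have [n] := ubnP (size a); elim: n a => // n ih a; rewrite ltnS => san sa.
have a0 : a != 0 by apply: contraTneq sa => ->; rewrite size_poly0.
have la0 : lead_coef a != 0 by rewrite lead_coef_eq0.
have [irr|nirr] := pselect (irreducible_poly a).
  have e : (lead_coef a)^-1 *: a %= a by rewrite eqp_scale // invr_eq0.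
  have h : ((lead_coef a)^-1 *: a \is monic) && irreducibleb ((lead_coef a)^-1 *: a).
    apply/andP; split; first by rewrite monicE lead_coefZ mulVf.
    apply/irreducibleP; split; first by rewrite (eqp_size e).
    move=> q sq; rewrite (eqp_dvdr _ e) => /(irr.2 _ sq) qa.
    by rewrite (eqp_trans qa) // eqp_sym.
  exists (exist (fun p : {poly F} => is_true ((p \is monic) && irreducibleb p)) _ h).
  by rewrite /= (eqp_dvdl _ e).
have [d [sd da nda]] : exists d : {poly F}, [/\ size d != 1%N, (d %| a)%R & ~~ (d %= a)].
  apply: contrapT => h; apply: nirr; split=> // d sd da.
  by apply: contrapT => nda; apply: h; exists d; split=> //; apply/negP.
have d0 : d != 0 by apply: contraNneq a0 => d0; move: da; rewrite d0 dvd0p.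
have sd1 : (1 < size d)%N.
  by case: (size d) (size_poly_eq0 d) sd => [|[|]] //; rewrite (negPf d0).
have sda : (size d < size a)%N.
  rewrite ltn_neqAle dvdp_leq // andbT.
  by apply: contra nda => /eqP e; rewrite -dvdp_size_eqp // e.
have [p pd] := ih d (leq_trans sda san) sd1.
by exists p; exact: dvdp_trans da.
Qed.

Lemma local_ring_poly p a : local_ring (Some p : pt) a%:F.
Proof.
exists a, 1; rewrite tofrac1 divr1; split=> //.
by have [sp _] := point_irr p; rewrite dvdp1; case: eqP sp => // ->.
Qed.

Lemma local_ring_const P (c : F) : local_ring P c%:P%:F.
Proof.
case: P => [p|]; first exact: local_ring_poly.
exists c%:P, 1; rewrite tofrac1 divr1 oner_eq0 size_poly1 /=; split=> //.
by rewrite size_polyC; case: (_ == _).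
Qed.

Lemma local_ring_infty a n : (size a <= n.+1)%N ->
  local_ring (None : pt) (a%:F / 'X%:F ^+ n).
Proof.
move=> sa; exists a, 'X^n; rewrite tofracXn; split=> //.
by rewrite monic_neq0 ?monicXn //= size_polyXn.
Qed.

Lemma local_ring_infty_const a : local_ring (None : pt) a%:F -> (size a <= 1)%N.
Proof.
move=> [c [b [e /andP[b0 scb]]]].
have {e} : (a * b)%:F = c%:F by rewrite tofracM e divfK // tofrac_eq0.
move/eqP; rewrite tofrac_eq => /eqP e; move: scb; rewrite -e.
have [->|a0] := eqVneq a 0; first by rewrite size_poly0.
rewrite size_mul //; case: (size b) (size_poly_eq0 b) => [|n _].
  by rewrite eqxx (negPf b0).
by rewrite addnS /= -addn1 addnC leq_add2l.
Qed.

Lemma local_ring_dvdX p a n :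
  local_ring (Some p : pt) (a%:F / (val p)%:F ^+ n) -> (val p ^+ n %| a)%R.
Proof.
move=> [c [b [e pb]]].
have p0 : (val p)%:F != 0 :> K by rewrite tofrac_eq0 point_neq0.
have b0 : b%:F != 0 :> K.
  by rewrite tofrac_eq0; apply: contraNneq pb => ->; rewrite dvdp0.
have {e} : (a * b)%:F = (c * val p ^+ n)%:F.
  have pn0 := expf_neq0 n p0.
  by apply/eqP; rewrite tofracM tofracM tofracXn -eqr_div; [apply/eqP|exact: pn0|exact: b0].
move/eqP; rewrite tofrac_eq => /eqP e.
have : coprimep (val p ^+ n) b.
  by apply: coprimep_expl; rewrite coprimep_sym; apply/negPn/negP => h;
     move: pb; rewrite -(irreducible_poly_coprime _ (point_irr p)) coprimep_sym (negPf h).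
by move/Gauss_dvdpl <-; rewrite e dvdp_mull.
Qed.

(** In a reduced fraction at most one of the numerator and the denominator vanishes
    at P. Together with local_ring_bounded this makes the local ring at P a discrete
    valuation ring. *)
Lemma local_ring_pole P f : ~ local_ring P f -> local_ring P (f^-1 / unif P).
Proof.
have [a [b [b0 cab ->]]] := fracP f => h.
have a0 : a != 0.
  by apply: contra_not_neq h => ->; rewrite tofrac0 mul0r; apply: local_ring0.
case: P h => [p|] h.
  have pb : (val p %| b)%R.
    by apply: contra_notT h => pb; exists a, b.
  case/dvdpP: (pb) => c ec.
  exists c, a; split.
    by rewrite invf_div ec tofracM; apply: mulf_div_cancel; exact: unif_neq0 (Some p).
  apply/negP => pa; have [sp _] := point_irr p.
  move: cab; rewrite -gcdp_eqp1 => cab.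
  have := dvdp_gcd (val p) a b; rewrite pa pb (eqp_dvdr _ cab) dvdp1.
  by case: eqP sp => // ->.
exists (b * 'X), a; split; first by rewrite invf_div /= invrK tofracM mulrAC.
rewrite a0 /= size_mulX // ltnNge; apply/negP => hs; apply: h.
by exists a, b; rewrite b0 hs.
Qed.

Lemma local_ring_unit_or P f : local_ring P f ->
  local_ring P f^-1 \/ local_ring P (f / unif P).
Proof.
have [h|/local_ring_pole] := pselect (local_ring P f^-1); first by left.
by rewrite invrK; right.
Qed.

Lemma local_ring_1D P f : local_ring P f -> local_ring P (1 + unif P * f)^-1.
Proof.
move=> hf; apply: contrapT => /local_ring_pole; rewrite invrK mulrDl div1r.
rewrite mulrAC divff ?unif_neq0 // mul1r => h.
apply: (@local_ring_unifV _ P); rewrite -[_^-1](addrK f).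
exact: local_ringB.
Qed.

Lemma local_ring_sum P (I : Type) (r : seq I) (T : pred I) (G : I -> K) :
  (forall i, T i -> local_ring P (G i)) -> local_ring P (\sum_(i <- r | T i) G i).
Proof. by apply: big_ind; [exact: local_ring0|exact: local_ringD]. Qed.

(** The residue field at a finite point p is F[t]/(p), with representatives given by
    Euclidean division; at infinity it is F, with the quotient of the leading
    coefficients as representative. *)
Lemma residue_poly P f : local_ring P f ->
  exists r : {poly F}, (size r <= point_degree P)%N /\ local_ring P ((f - r%:F) / unif P).
Proof.
move=> [a [b [-> hb]]].
have b0 : b%:F != 0 :> K.
  rewrite tofrac_eq0; case: P hb => [p|/andP[]//].
  by apply: contraNneq => ->; rewrite dvdp0.
have sub_r r : a%:F / b%:F - r%:F = (a - r * b)%:F / b%:F.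
  by rewrite tofracB tofracM mulrBl mulfK.
case: P hb => [p pb|/andP[_ sab]].
  have /Bezout_eq1_coprimepP [[u v] /= uv] : coprimep (val p) b.
    by rewrite (irreducible_poly_coprime _ (point_irr p)).
  exists ((a * v) %% val p)%R; split.
    have := ltn_modp (a * v) (val p); rewrite point_neq0 /=.
    by case: (size (val p)).
  have /dvdpP [c ec] : (val p %| a - (a * v) %% val p * b)%R.
    have := divp_eq (a * v) (val p).
    move: (_ %/ _)%R (_ %% _)%R => q r e.
    suff -> : a - r * b = (a * u + q * b) * val p by exact: dvdp_mulIr.
    have -> : a - r * b = a * (u * val p + v * b) - r * b by rewrite uv mulr1.
    have -> : a * (u * val p + v * b) = a * u * val p + a * v * b by ring.
    by rewrite e; ring.
  exists c, b; split=> //; rewrite sub_r ec tofracM; apply: mulf_div_cancel.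
  exact: unif_neq0 (Some p).
have {}b0 : b != 0 by rewrite -tofrac_eq0.
exists (a`_(size b).-1 / lead_coef b)%:P; split.
  by rewrite size_polyC; case: (_ == _).
exists ((a - (a`_(size b).-1 / lead_coef b)%:P * b) * 'X), b; split.
  by rewrite sub_r /= invrK tofracM mulrAC.
rewrite b0 /=; set r := (X in X * 'X).
have [->|r0] := eqVneq r 0; first by rewrite mul0r size_poly0.
rewrite size_mulX //.
have sb : (0 < size b)%N by rewrite lt0n size_poly_eq0.
apply: (@leq_trans (size b).-1.+1); last by rewrite prednK.
rewrite ltnS; apply/leq_sizeP => j; rewrite leq_eqVlt => /predU1P[<-|bj].
  by rewrite /r coefB coefCM -/(lead_coef b) divfK ?subrr // lead_coef_eq0.
have bj' : (size b <= j)%N by rewrite -(prednK sb).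
by rewrite /r coefB coefCM (nth_default _ bj') (nth_default _ (leq_trans sab bj')) mulr0 subr0.
Qed.

Fact point_at_subproof (c : F) : (('X - c%:P) \is monic) && irreducibleb ('X - c%:P).
Proof. by rewrite monicXsubC; apply/irreducibleP/irredp_XsubC. Qed.

Definition point_at (c : F) : pt :=
  Some (exist (fun p : {poly F} => is_true ((p \is monic) && irreducibleb p)) _
    (point_at_subproof c)).

(** Removing this point leaves an affine line that contains P. *)
Definition antipode P : pt := if P is Some _ then None else point_at 0.

Lemma antipode_neq P : antipode P != P.
Proof. by case: P. Qed.

Lemma unif_away P Q : Q != P -> Q != antipode P ->
  local_ring Q (unif P) /\ local_ring Q (unif P)^-1.
Proof.
have key (p q : fpt) : q != p ->
    local_ring (Some q : pt) (val p)%:F^-1.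
  move=> qp; exists 1, (val p); rewrite tofrac1 div1r; split=> //.
  by apply: contra qp => /dvdp_points ->.
case: P => [p|]; case: Q => [q|] //= qp qo.
  split; first exact: local_ring_poly.
  by apply: key; apply: contra qp => /eqP ->.
rewrite invrK; split; last exact: local_ring_poly.
have [p0 ep0 eX] : exists2 p0 : fpt, point_at 0 = Some p0 & val p0 = 'X :> {poly F}.
    by eexists; [reflexivity|rewrite /= subr0].
  rewrite -eX; move: qo; rewrite ep0 => qo.
by apply: key; apply: contra qo => /eqP ->.
Qed.

(** Expand f in powers of the uniformizer; the representatives of residues are
    regular on the affine line around P. *)
Lemma approx_regular P f n : local_ring P f -> exists g,
  local_ring P ((f - g) / unif P ^+ n) /\ forall Q, Q != antipode P -> local_ring Q g.
Proof.
elim: n f => [|n ih] f hf.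
  exists 0; rewrite expr0 divr1 subr0; split=> // Q _; exact: local_ring0.
have [r [sr hr]] := residue_poly hf.
have [g [hg regg]] := ih _ hr.
exists (r%:F + unif P * g); split.
  have e := mulf_approx f r%:F g (unifX_neq0 P n) (unif_neq0 P).
  by rewrite exprSr -e.
move=> Q nQ; apply: local_ringD.
  case: P Q nQ sr {hr hg hf ih f} regg => [p|] [q|] //= _ sr _.
  - exact: local_ring_poly.
  - exact: local_ring_poly.
  by move/size1_polyC: sr => ->; exact: local_ring_const.
apply: local_ringM (regg _ nQ).
have [->|nP] := eqVneq Q P; first exact: local_ring_unif.
by have [] := unif_away nP nQ.
Qed.

Lemma local_ring_order P f : f != 0 -> local_ring P f -> exists n : nat,
  local_ring P (f / unif P ^+ n) /\ local_ring P (unif P ^+ n / f).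
Proof.
move=> f0 hf; have hb : exists n, `[< local_ring P (unif P ^+ n / f) >].
  by have [n hn] := local_ring_bounded P f^-1; exists n; apply/asboolP.
case: (ex_minnP hb) => n /asboolP hn min; exists n; split=> //.
case: n hn min => [|n] hn min; first by rewrite expr0 divr1.
have := @local_ring_pole P (unif P ^+ n / f).
rewrite invf_div exprSr invfM mulrA; apply => h.
by have /min := asboolT h; rewrite ltnn.
Qed.

(** Up to a unit at P a nonzero function is a power of the uniformizer, which has
    neither zeros nor poles elsewhere on the affine line around P. *)
Lemma local_generator P f : f != 0 -> exists e, [/\ e != 0, local_ring P (f / e),
  local_ring P (e / f) & forall Q, Q != P -> Q != antipode P ->
    local_ring Q e /\ local_ring Q e^-1].
Proof.
move=> f0; have [j hj] := local_ring_bounded P f.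
have u0 n : unif P ^+ n != 0 := unifX_neq0 P n.
have uQ n Q : Q != P -> Q != antipode P ->
    local_ring Q (unif P ^+ n) /\ local_ring Q (unif P ^- n).
  move=> h1 h2; have [w1 w2] := unif_away h1 h2; rewrite -exprVn.
  by elim: n => [|n [i1 i2]]; rewrite ?expr0 ?exprS; split; try exact: local_ring1;
     exact: local_ringM.
have [n [h1 h2]] := local_ring_order (mulf_neq0 (u0 j) f0) hj.
exists (unif P ^+ n / unif P ^+ j); split.
- exact: mulf_neq0 (u0 n) (invr_neq0 (u0 j)).
- by rewrite mulf_divA.
- by rewrite mulf_divAC.
move=> Q nP nA; have [a1 a2] := uQ n Q nP nA; have [b1 b2] := uQ j Q nP nA.
by rewrite invf_div; split; [exact: local_ringM a1 b2|exact: local_ringM b1 a2].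
Qed.

(** Strong approximation on the affine line around P. Clearing the denominator at P
    reduces it to functions that are regular at P, and the denominator, a power of
    the uniformizer, is a unit at the other points of this line. *)
Lemma approx_away P f z : z != 0 -> exists g,
  local_ring P ((f - g) / z) /\ forall Q, Q != P -> Q != antipode P -> local_ring Q g.
Proof.
move=> z0; have [i hi] := local_ring_bounded P f.
have [j hj] := local_ring_bounded P z^-1.
have u0 n : unif P ^+ n != 0 := unifX_neq0 P n.
have [g [hg regg]] := approx_regular (i + j) hi.
exists (g / unif P ^+ i); split.
  have e := mulf_rescale f g z (u0 i) (u0 j).
  by have := local_ringM hg hj; rewrite exprD e.
move=> Q nP nA; apply: local_ringM; first exact: regg.
have [_ w] := unif_away nP nA; rewrite -exprVn.
by elim: i {hi hg} => [|n ih]; rewrite ?expr0 ?exprS; [exact: local_ring1|exact: local_ringM].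
Qed.

(** An irreducible factor of a reduced denominator would be a pole, and regularity at
    infinity bounds the degree of the numerator. *)
Lemma regular_constant f : (forall P, local_ring P f) -> exists c : F, f = c%:P%:F.
Proof.
move=> h; have [a [b [b0 cab ef]]] := fracP f.
have sb : (size b <= 1)%N.
  rewrite leqNgt; apply/negP => /exists_point_dvd[p pb].
  have [c [d [e pd]]] := h (Some p).
  have d0 : d != 0 by apply: contraNneq pd => ->; rewrite dvdp0.
  have : (a * d)%:F = (c * b)%:F :> K.
    move: e; rewrite ef => /eqP; rewrite eqr_div ?tofrac_eq0 // !tofracM.
    by move/eqP.
  move/eqP; rewrite tofrac_eq => /eqP e'.
  have : (val p %| a * d)%R by rewrite e' dvdp_mull.
  rewrite point_prime (negPf pd) orbF => pa.
  move: cab; rewrite -gcdp_eqp1 => cab.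
  have := dvdp_gcd (val p) a b; rewrite pa pb (eqp_dvdr _ cab) dvdp1.
  by have [sp _] := point_irr p; case: eqP sp => // ->.
move/size1_polyC: sb b0 ef => ->; rewrite polyC_eq0 => b0 ef.
have ef' : f = ((b`_0)^-1 *: a)%:F.
  by rewrite ef -mul_polyC tofracM -[_^-1]div1r -tofrac1 mulrC; congr (_ * _);
     apply: (@mulIf _ (b`_0)%:P%:F); rewrite ?tofrac_eq0 ?polyC_eq0 // divfK
     ?tofrac_eq0 ?polyC_eq0 // -tofracM -polyCM mulVf.
have := h None; rewrite ef' => /local_ring_infty_const/size1_polyC ->.
by exists ((b`_0)^-1 *: a)`_0.
Qed.

(** The finite poles divide the denominator, and over a finite field only finitely
    many polynomials have bounded degree. *)
Lemma finite_poles f : finite_set [set P | ~ local_ring P f].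
Proof.
have [a [b [b0 _ ->]]] := fracP f.
pose h (v : 'rV[F]_(size b)) : pt := insub (rVpoly v).
apply: (@sub_finite_set _ _ (None |` (h @` setT))); last first.
  by rewrite finite_setU; split=> //; apply: finite_image; exact: finite_finset.
move=> [p|] hp; [right|by left].
have pb : (val p %| b)%R by apply: contra_notT hp => pb; exists a, b.
by exists (poly_rV (val p)); rewrite // /h poly_rV_K ?valK // dvdp_leq.
Qed.

(** Euclid's argument. The factor t keeps the polynomial nonconstant when no finite
    point is given. *)
Lemma infinite_points (A : set pt) : finite_set A -> exists P, ~ A P.
Proof.
case/finite_seqP => s ->.
(* Infinity contributes the factor 1. *)
pose c : {poly F} := 1 + 'X * \prod_(P <- s) (if P is Some p then val p else 1).
have m0 : \prod_(P <- s) (if P is Some p then val p else 1) != 0 :> {poly F}.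
  by rewrite prodf_seq_neq0; apply/allP => -[p|] _ /=; rewrite ?oner_eq0 // point_neq0.
have sc : (1 < size c)%N.
  have sx : (1 < size ('X * \prod_(P <- s) (if P is Some p then val p else 1) : {poly F})%R)%N.
    by rewrite mulrC size_mulX // ltnS lt0n size_poly_eq0.
  by rewrite /c addrC size_polyDl // size_poly1.
have [p pc] := exists_point_dvd sc.
exists (Some p); rewrite /= => ps.
have pm : (val p %| 'X * \prod_(P <- s) (if P is Some p then val p else 1))%R.
  by rewrite dvdp_mull // (big_rem _ ps) /= dvdp_mulr.
move: pc; rewrite /c dvdp_addl // dvdp1.
by have [sp _] := point_irr p; case: eqP sp => // ->.
Qed.

End Points.

(** * Matrices of size two and local Eichler orders *)

Section Matrix2.
Variable L : fieldType.
Implicit Types (a b c d x y : L) (A B g h u : 'M[L]_2) (O : set L).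

Definition mx2 a b c d : 'M[L]_2 :=
  \matrix_(i, j) if i == 0 then if j == 0 then a else b else if j == 0 then c else d.

Lemma mx2_00 a b c d : mx2 a b c d 0 0 = a. Proof. by rewrite mxE. Qed.
Lemma mx2_01 a b c d : mx2 a b c d 0 1 = b. Proof. by rewrite mxE. Qed.
Lemma mx2_10 a b c d : mx2 a b c d 1 0 = c. Proof. by rewrite mxE. Qed.
Lemma mx2_11 a b c d : mx2 a b c d 1 1 = d. Proof. by rewrite mxE. Qed.
Definition mx2E := (mx2_00, mx2_01, mx2_10, mx2_11).

Lemma ord2P (i : 'I_2) : i = 0 \/ i = 1.
Proof. by case: i => [[|[|//]] hi]; [left|right]; apply: val_inj. Qed.

Lemma mx2P A B : A 0 0 = B 0 0 -> A 0 1 = B 0 1 -> A 1 0 = B 1 0 ->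
  A 1 1 = B 1 1 -> A = B.
Proof.
by move=> h1 h2 h3 h4; apply/matrixP => i j; case: (ord2P i) => ->; case: (ord2P j) => ->.
Qed.

Lemma mx2_eta A : A = mx2 (A 0 0) (A 0 1) (A 1 0) (A 1 1).
Proof. by apply: mx2P; rewrite mx2E. Qed.

Lemma mulmx2E A B i j : (A *m B) i j = A i 0 * B 0 j + A i 1 * B 1 j.
Proof.
rewrite mxE !big_ord_recl big_ord0 addr0.
by have -> : lift ord0 ord0 = 1 :> 'I_2 by apply: val_inj.
Qed.

Lemma mulmx2 a b c d a' b' c' d' : mx2 a b c d *m mx2 a' b' c' d' =
  mx2 (a * a' + b * c') (a * b' + b * d') (c * a' + d * c') (c * b' + d * d').
Proof. by apply: mx2P; rewrite mulmx2E !mx2E. Qed.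

Lemma mx2_1 : mx2 1 0 0 1 = 1%:M.
Proof. by apply: mx2P; rewrite mx2E mxE. Qed.

Lemma det_mx2 a b c d : \det (mx2 a b c d) = a * d - b * c.
Proof.
rewrite (expand_det_row _ 0) !big_ord_recl big_ord0 addr0 /cofactor !det_mx11.
by rewrite !mxE /= expr0 expr1 mul1r mulN1r mulrN.
Qed.

Lemma unit_mx2 a b c d : (mx2 a b c d \in unitmx) = (a * d - b * c != 0).
Proof. by rewrite unitmxE det_mx2 unitfE. Qed.

Lemma diag_unit r : r != 0 -> mx2 1 0 0 r \in unitmx.
Proof. by move=> r0; rewrite unit_mx2 mul1r mul0r subr0. Qed.

Lemma invmx_unique g h : g *m h = 1%:M -> g \in unitmx /\ invmx g = h.
Proof.
move=> gh; have [gu _] := mulmx1_unit gh; split=> //.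
by rewrite -[RHS](mulKmx gu) gh mulmx1.
Qed.

Lemma invmx2 a b c d : a * d - b * c != 0 -> invmx (mx2 a b c d) =
  mx2 (d / (a * d - b * c)) (- b / (a * d - b * c))
      (- c / (a * d - b * c)) (a / (a * d - b * c)).
Proof.
move=> D0; have [//|_ -> //] := @invmx_unique (mx2 a b c d) (mx2 (d / (a * d - b * c))
  (- b / (a * d - b * c)) (- c / (a * d - b * c)) (a / (a * d - b * c))) _.
by rewrite mulmx2 -mx2_1; congr mx2; field.
Qed.

Lemma invmx_mul g h : g \in unitmx -> h \in unitmx ->
  invmx (g *m h) = invmx h *m invmx g.
Proof.
move=> gu hu; have [//|_ -> //] := @invmx_unique (g *m h) (invmx h *m invmx g) _.
by rewrite mulmxA mulmxK // mulmxV.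
Qed.

Lemma conj_diag r A : r != 0 ->
  invmx (mx2 1 0 0 r) *m A *m mx2 1 0 0 r = mx2 (A 0 0) (A 0 1 * r) (A 1 0 / r) (A 1 1).
Proof.
move=> r0; have D0 : 1 * r - 0 * 0 != 0 by rewrite mul1r mul0r subr0.
rewrite invmx2 // {1}(mx2_eta A) !mulmx2.
by congr mx2; field; rewrite ?r0 ?oner_eq0.
Qed.

(** For invertible g this is g S g^-1; as a preimage it turns membership into a
    computation with matrix entries. *)
Definition twist g (S : set 'M[L]_2) : set 'M[L]_2 :=
  [set A | S (invmx g *m A *m g)].

Lemma conj_setE g S : g \in unitmx -> conj_set g S = twist g S.
Proof.
move=> gu; apply/seteqP; split => [_ [A SA <-]|A SA]; rewrite /twist /=.
  by rewrite -!mulmxA mulVmx // mulmx1 mulmxA mulVmx // mul1mx.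
by exists (invmx g *m A *m g); rewrite // -!mulmxA mulmxV // mulmx1 mulmxA mulmxV // mul1mx.
Qed.

Lemma twist1 S : twist 1%:M S = S.
Proof. by rewrite /twist invmx1; apply/seteqP; split => A /=; rewrite mul1mx mulmx1. Qed.

Lemma twistM g h S : g \in unitmx -> h \in unitmx ->
  twist (g *m h) S = twist g (twist h S).
Proof.
by move=> gu hu; apply/seteqP; split => A; rewrite /twist /= invmx_mul // !mulmxA.
Qed.

Definition mul_closed (S : set 'M[L]_2) := forall A B, S A -> S B -> S (A *m B).

Definition units_of (S : set 'M[L]_2) u := [/\ u \in unitmx, S u & S (invmx u)].

Lemma units_ofM S u v : mul_closed S -> units_of S u -> units_of S v ->
  units_of S (u *m v).
Proof.
move=> SM [uu Su Sui] [vu Sv Svi]; split; first by rewrite unitmx_mul uu vu.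
  exact: SM.
by rewrite invmx_mul //; apply: SM.
Qed.

Lemma units_ofV S u : units_of S u -> units_of S (invmx u).
Proof. by move=> [uu Su Sui]; split; rewrite ?unitmx_inv ?invmxK. Qed.

Lemma twist_unit S u : mul_closed S -> units_of S u -> twist u S = S.
Proof.
move=> SM [uu Su Sui]; apply/seteqP; split => A; rewrite /twist /=; last first.
  by move=> SA; apply: (SM) => //; apply: (SM).
move=> h; have := SM _ _ (SM _ _ Su h) Sui.
by rewrite !mulmxA mulmxV // mul1mx -mulmxA mulmxV // mulmx1.
Qed.

Lemma twist_eq S g h : mul_closed S -> g \in unitmx -> h \in unitmx ->
  units_of S (invmx g *m h) -> twist h S = twist g S.
Proof.
move=> SM gu hu uS; have [uu _ _] := uS.
have {1}-> : h = g *m (invmx g *m h) by rewrite mulmxA mulmxV // mul1mx.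
by rewrite twistM // (twist_unit SM uS).
Qed.

(** What the local ring at a point and its completion have in common, so that orders
    over both of them are treated at once. *)
Record ring_with_uniformizer (O : set L) (pi : L) : Prop := {
  unif_1 : O 1;
  unif_B : forall x y, O x -> O y -> O (x - y);
  unif_M : forall x y, O x -> O y -> O (x * y);
  unif_int : O pi;
  unif_nz : pi != 0
}.

Section LevelRing.
Variables (O : set L) (pi : L).
Hypothesis unifO : ring_with_uniformizer O pi.

(** The standard local Eichler order: it is the intersection of two maximal orders at
    distance n by level_ring_meet, and all of M_2(O) when n = 0. *)
Definition level_ring (n : nat) : set 'M[L]_2 :=
  [set A | [/\ O (A 0 0), O (A 0 1 / pi ^+ n), O (A 1 0) & O (A 1 1)]].

Let O1 : O 1. Proof. by case: unifO. Qed.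
Let OB x y : O x -> O y -> O (x - y). Proof. by case: unifO => ? h *; apply: h. Qed.
Let OM x y : O x -> O y -> O (x * y). Proof. by case: unifO => ? ? h *; apply: h. Qed.
Let Opi : O pi. Proof. by case: unifO. Qed.
Let pi0 : pi != 0. Proof. by case: unifO. Qed.
Let O0 : O 0. Proof. by rewrite -(subrr 1); apply: OB. Qed.
Let ON x : O x -> O (- x). Proof. by rewrite -sub0r; apply: OB. Qed.
Let OD x y : O x -> O y -> O (x + y).
Proof. by move=> hx hy; rewrite -(opprK y); apply: OB => //; apply: ON. Qed.
Let OX n : O (pi ^+ n).
Proof. by elim: n => [|n ih]; rewrite ?expr0 ?exprS //; apply: OM. Qed.
Let piX n : pi ^+ n != 0. Proof. exact: expf_neq0. Qed.

Lemma level_ring1 n : level_ring n 1%:M.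
Proof. by rewrite /level_ring -mx2_1 /= !mx2E mul0r. Qed.

Lemma level_ring_le n m : (n <= m)%N -> level_ring m `<=` level_ring n.
Proof.
move=> nm A [h1 h2 h3 h4]; split=> //.
have -> : A 0 1 / pi ^+ n = A 0 1 / pi ^+ m * pi ^+ (m - n).
  by rewrite -{1}(subnK nm) exprD; field; rewrite !piX.
exact: OM.
Qed.

Lemma level_ring01 n A : level_ring n A -> O (A 0 1).
Proof. by move=> /(level_ring_le (leq0n n)) [_]; rewrite expr0 divr1. Qed.

Lemma level_ringM n : mul_closed (level_ring n).
Proof.
move=> A B hA hB; have A01 := level_ring01 hA; have B01 := level_ring01 hB.
case: hA => A00 A01' A10 A11; case: hB => B00 B01' B10 B11.
split; rewrite mulmx2E.
- by apply: OD; apply: OM.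
- by rewrite mulrDl -mulrA mulrAC; apply: OD; apply: OM.
- by apply: OD; apply: OM.
- by apply: OD; apply: OM.
Qed.

Lemma units_of_level_le n m u : (n <= m)%N -> units_of (level_ring m) u ->
  units_of (level_ring n) u.
Proof. by move=> nm [h1 h2 h3]; split=> //; exact: (level_ring_le nm). Qed.

Lemma level_ring0P A : level_ring 0 A <-> forall i j, O (A i j).
Proof.
rewrite /level_ring /= expr0 divr1; split=> [[h1 h2 h3 h4] i j|h]; last by split.
by case: (ord2P i) => ->; case: (ord2P j) => ->.
Qed.

(** Conjugation by diag(1, pi^-n) multiplies the upper right entry by pi^-n and the
    lower left one by pi^n. *)
Lemma level_ring_meet n : level_ring n =
  level_ring 0 `&` twist (mx2 1 0 0 (pi ^- n)) (level_ring 0).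
Proof.
have r0 : pi ^- n != 0 by rewrite invr_eq0.
apply/seteqP; split => A; rewrite /twist /= conj_diag //.
  move=> h; have h' := level_ring_le (leq0n n) h; split=> //.
  case: h => h1 h2 h3 h4; split; rewrite !mx2E //; first by rewrite expr0 divr1.
  by rewrite invrK; exact: OM.
by move=> [[h1 _ h3 h4]]; rewrite /level_ring /= !mx2E expr0 divr1 => -[_ k _ _].
Qed.

Lemma mx2_set_level0 : mx2_set O O O O = level_ring 0.
Proof. by apply/seteqP; split => A; rewrite /level_ring /mx2_set /= expr0 divr1. Qed.

Lemma scale_setE x y : x != 0 -> scale_set x O y = O (y / x).
Proof.
move=> x0; apply/propext; split=> [[z Oz <-]|h]; first by rewrite mulrC mulKf.
by exists (y / x); rewrite // mulrCA divff // mulr1.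
Qed.

Lemma mx2_set_twist n : mx2_set O (scale_set (pi ^+ n) O) (scale_set (pi ^- n) O) O =
  twist (mx2 1 0 0 (pi ^- n)) (level_ring 0).
Proof.
have r0 : pi ^- n != 0 by rewrite invr_eq0.
apply/funext => A; rewrite /twist /mx2_set /= conj_diag // /level_ring /=.
by rewrite !mx2E expr0 divr1 !scale_setE.
Qed.

End LevelRing.

End Matrix2.

Lemma map_mx2 (L L' : fieldType) (f : L -> L') (a b c d : L) :
  map_mx f (mx2 a b c d) = mx2 (f a) (f b) (f c) (f d).
Proof. by apply: mx2P; rewrite !mx2E mxE mx2E. Qed.

(** * The completion at a point *)

Local Notation level P n := (level_ring (local_ring P) (unif P) n).

Lemma local_unif (F : finFieldType) (P : closed_point F) :
  ring_with_uniformizer (local_ring P) (unif P).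
Proof.
split; [exact: local_ring1|exact: local_ringB|exact: local_ringM|
        exact: local_ring_unif|exact: unif_neq0].
Qed.

Section CompletionTheory.
Variables (F : finFieldType) (P : closed_point F).
Local Notation K := 'K_F.
Local Notation C := (completion P).
Local Notation O := (local_ring P).
Local Notation Oh := (completed_ring P).
Local Notation pi := (unif P).
Local Notation pih := (completed_unif P).
Local Notation iota := (completion_of P).

Lemma cauchy_class0 (s : cauchyT P) : cauchy_class s = 0 <-> null_seq P (val s).
Proof.
have e : cauchy_class s = 0 <-> (s - 0) \in @nullb F P.
  rewrite Quotient.idealrBE /cauchy_class -[X in _ = X <-> _](rmorph0 (\pi_C)%qT).
  by split=> [->|/eqP].
by rewrite e subr0; split=> [/asboolP|h]; last exact/asboolP.
Qed.

Lemma cauchy_classB (s u : cauchyT P) : cauchy_class (s - u) = cauchy_class s - cauchy_class u.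
Proof. by rewrite /cauchy_class rmorphB. Qed.

Lemma cauchy_classM (s u : cauchyT P) : cauchy_class (s * u) = cauchy_class s * cauchy_class u.
Proof. by rewrite /cauchy_class rmorphM. Qed.

Lemma completion_of_zmod_morphism : zmod_morphism iota.
Proof.
move=> f g; rewrite /completion_of -cauchy_classB; congr cauchy_class.
exact: val_inj.
Qed.

Lemma completion_of_monoid_morphism : monoid_morphism iota.
Proof.
split=> [|f g]; last first.
  by rewrite /completion_of -cauchy_classM; congr cauchy_class; exact: val_inj.
have -> : 1 = cauchy_class (1 : cauchyT P) by rewrite /cauchy_class rmorph1.
by rewrite /completion_of; congr cauchy_class; exact: val_inj.
Qed.

HB.instance Definition _ :=
  GRing.isZmodMorphism.Build K C iota completion_of_zmod_morphism.
HB.instance Definition _ :=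
  GRing.isMonoidMorphism.Build K C iota completion_of_monoid_morphism.

Lemma completed_unifX n : pih ^+ n = iota (pi ^+ n).
Proof. by rewrite rmorphXn. Qed.

Lemma completed_unif_neq0 : pih != 0.
Proof. by rewrite fmorph_eq0 unif_neq0. Qed.

Lemma completed_ring1 : Oh 1.
Proof.
exists 1; first by rewrite /cauchy_class rmorph1.
by move=> i; exact: local_ring1.
Qed.

Lemma completed_ringB x y : Oh x -> Oh y -> Oh (x - y).
Proof.
move=> [s -> hs] [u -> hu]; exists (s - u); first by rewrite cauchy_classB.
by move=> i; exact: local_ringB (hs i) (hu i).
Qed.

Lemma completed_ringM x y : Oh x -> Oh y -> Oh (x * y).
Proof.
move=> [s -> hs] [u -> hu]; exists (s * u); first by rewrite cauchy_classM.
by move=> i; exact: local_ringM (hs i) (hu i).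
Qed.

(** Dropping the first N terms changes a Cauchy sequence by a null sequence. *)
Lemma completed_ring_eventually (s : cauchyT P) N :
  (forall i, (N <= i)%N -> O (val s i)) -> Oh (cauchy_class s).
Proof.
move=> h; have /asboolP cs := valP s.
have cu : (fun i => val s (i + N)%N) \in cauchyb P.
  apply/asboolP => n; have [M hM] := cs n; exists M => i j Mi Mj.
  by apply: hM; rewrite (leq_trans _ (leq_addr _ _)).
pose u : cauchyT P := exist (fun s => s \in cauchyb P) _ cu.
exists u; last by move=> i; apply: h; rewrite leq_addl.
apply/eqP; rewrite -subr_eq0 -cauchy_classB; apply/eqP/cauchy_class0 => n.
have [M hM] := cs n; exists M => i Mi; apply: hM => //.
by rewrite (leq_trans Mi (leq_addr _ _)).
Qed.

Lemma completed_ring_of f : Oh (iota f) <-> O f.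
Proof.
split=> [[s e hs]|hf]; last by exists (exist (fun s => s \in cauchyb P) _ (cauchy_cst P f)).
pose c : cauchyT P := exist (fun s => s \in cauchyb P) _ (cauchy_cst P f).
have /cauchy_class0 /(_ 0%N) [N hN] : cauchy_class (c - s) = 0.
  by rewrite cauchy_classB -e subrr.
have := local_ringD (hN N (leqnn N)) (hs N).
by rewrite expr0 divr1 subrK.
Qed.

Lemma completed_unif_int : Oh pih.
Proof. by apply/completed_ring_of; exact: local_ring_unif. Qed.

(** A late term of a Cauchy sequence is close to its limit. *)
Lemma completion_dense (x : C) n : exists f, Oh ((x - iota f) / pih ^+ n).
Proof.
have [s ->] : exists s : cauchyT P, x = cauchy_class s.
  by elim/quotW: x => s; exists s.
have /asboolP /(_ n) [N hN] := valP s; exists (val s N).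
rewrite completed_unifX -fmorphV /completion_of -cauchy_classB -cauchy_classM.
by apply: (@completed_ring_eventually _ N) => i Ni; exact: hN.
Qed.

Lemma completion_bounded (x : C) : exists m, Oh (pih ^+ m * x).
Proof.
have [f] := completion_dense x 0; rewrite expr0 divr1 => hf.
have [m hm] := local_ring_bounded P f; exists m.
have -> : pih ^+ m * x = pih ^+ m * (x - iota f) - (0 - iota (pi ^+ m * f)).
  by rewrite completed_unifX rmorphM sub0r opprK -mulrDr subrK.
apply: completed_ringB.
  apply: completed_ringM hf; rewrite completed_unifX.
  exact/completed_ring_of/local_ring_unifX.
rewrite sub0r -rmorphN; apply/completed_ring_of.
exact: local_ringN.
Qed.

Lemma completed_unif_ring : ring_with_uniformizer Oh pih.
Proof.
split; [exact: completed_ring1|exact: completed_ringB|exact: completed_ringM|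
        exact: completed_unif_int|exact: completed_unif_neq0].
Qed.

End CompletionTheory.

Local Notation completed_level P n := (level_ring (completed_ring P) (completed_unif P) n).

(** * Frames over the completion *)

Section Congruence.
Variables (L : fieldType) (O : set L) (pi : L).
Hypothesis unifO : ring_with_uniformizer O pi.
Implicit Types (A B u v : 'M[L]_2) (n m : nat).

Definition mxdiv n A := forall i j, O (A i j / pi ^+ n).

Let O1 : O 1. Proof. by case: unifO. Qed.
Let OB x y : O x -> O y -> O (x - y). Proof. by case: unifO => ? h *; apply: h. Qed.
Let OM x y : O x -> O y -> O (x * y). Proof. by case: unifO => ? ? h *; apply: h. Qed.
Let Opi : O pi. Proof. by case: unifO. Qed.
Let pi0 : pi != 0. Proof. by case: unifO. Qed.
Let O0 : O 0. Proof. by rewrite -(subrr 1); apply: OB. Qed.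
Let ON x : O x -> O (- x). Proof. by rewrite -sub0r; apply: OB. Qed.
Let OD x y : O x -> O y -> O (x + y).
Proof. by move=> hx hy; rewrite -(opprK y); apply: OB => //; apply: ON. Qed.
Let OX n : O (pi ^+ n).
Proof. by elim: n => [|n ih]; rewrite ?expr0 ?exprS //; apply: OM. Qed.
Let piX n : pi ^+ n != 0. Proof. exact: expf_neq0. Qed.

Lemma mxdiv0P A : mxdiv 0 A <-> forall i j, O (A i j).
Proof. by split=> h i j; have := h i j; rewrite expr0 divr1. Qed.

Lemma mxdivD n A B : mxdiv n A -> mxdiv n B -> mxdiv n (A + B).
Proof. by move=> hA hB i j; rewrite mxE mulrDl; apply: OD. Qed.

Lemma mxdivN n A : mxdiv n A -> mxdiv n (- A).
Proof. by move=> hA i j; rewrite mxE mulNr; apply: ON. Qed.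

Lemma mxdiv_le n m A : (n <= m)%N -> mxdiv m A -> mxdiv n A.
Proof.
move=> nm hA i j.
have -> : A i j / pi ^+ n = A i j / pi ^+ m * pi ^+ (m - n).
  by rewrite -{1}(subnK nm) exprD; field; rewrite !piX.
exact: OM.
Qed.

Lemma mxdivM n m A B : mxdiv n A -> mxdiv m B -> mxdiv (n + m) (A *m B).
Proof.
have e x y : x * y / pi ^+ (n + m) = (x / pi ^+ n) * (y / pi ^+ m).
  by rewrite exprD; field; rewrite !piX.
by move=> hA hB i j; rewrite mulmx2E mulrDl !e; apply: OD; apply: OM.
Qed.

Lemma level_of_cong n d u : (d <= n)%N -> mxdiv n (u - 1%:M) -> level_ring O pi d u.
Proof.
move=> dn h; have h0 := mxdiv_le (leq0n n) h; have hd := mxdiv_le dn h.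
move: h0 => /mxdiv0P h0.
have e i j : u i j = (u - 1%:M) i j + (1%:M : 'M[L]_2) i j by rewrite !mxE subrK.
split; rewrite e.
- by apply: OD => //; rewrite mxE.
- by rewrite [X in _ + X]mxE addr0; apply: hd.
- by rewrite [X in _ + X]mxE addr0.
- by apply: OD => //; rewrite mxE.
Qed.

Lemma mxdiv_mul1 n A B : mxdiv n (A - 1%:M) -> mxdiv n (B - 1%:M) ->
  mxdiv n (A *m B - 1%:M).
Proof.
move=> hA hB; have -> : A *m B - 1%:M = (A - 1%:M) *m (B - 1%:M) + (A - 1%:M) + (B - 1%:M).
  by rewrite mulmxBr mulmxBl mulmx1 mul1mx subrK addrA subrK.
apply: mxdivD => //; apply: mxdivD => //.
exact: mxdiv_le (leq_addr n n) (mxdivM hA hB).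
Qed.

Lemma mxdiv_bounded (bd : forall x, exists m, O (pi ^+ m * x)) A :
  exists m, mxdiv 0 (pi ^+ m *: A).
Proof.
have [a ha] := bd (A 0 0); have [b hb] := bd (A 0 1).
have [c hc] := bd (A 1 0); have [d hd] := bd (A 1 1).
have up x n m : (n <= m)%N -> O (pi ^+ n * x) -> O (pi ^+ m * x).
  by move=> nm h; rewrite -(subnK nm) exprD -mulrA; apply: OM.
exists (a + b + (c + d))%N; apply/mxdiv0P => i j; rewrite mxE.
case: (ord2P i) => ->; case: (ord2P j) => ->.
- by apply: up ha; rewrite -!addnA leq_addr.
- by apply: up hb; rewrite addnAC -addnA addnCA addnA addnC -!addnA leq_addr.
- by apply: up hc; rewrite addnCA leq_addr.
- by apply: up hd; rewrite addnA leq_addl.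
Qed.

Lemma mxdiv_scaleM n m A B : mxdiv 0 (pi ^+ m *: A) -> mxdiv (n + m) B ->
  mxdiv n (A *m B) /\ mxdiv n (B *m A).
Proof.
move=> hA hB; have e : mxdiv n (pi ^- m *: B).
  move=> i j; have := hB i j; rewrite mxE exprD.
  by have -> : B i j / (pi ^+ n * pi ^+ m) = pi ^- m * B i j / pi ^+ n by
    field; rewrite !piX.
have eA : A = pi ^- m *: (pi ^+ m *: A) by rewrite scalerA mulVf ?scale1r.
split; rewrite eA; [rewrite -scalemxAl scalemxAr|rewrite -scalemxAr scalemxAl].
  by have := mxdivM hA e; rewrite add0n.
by have := mxdivM e hA; rewrite addn0.
Qed.

End Congruence.

Lemma det_congr (L : fieldType) (p a b c d : L) :
  (1 + p * a) * (1 + p * d) - (p * b) * (p * c) = 1 + p * (a + d + p * (a * d - b * c)).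
Proof. by ring. Qed.

(** The determinant lies in 1 + pi O, which consists of units, so that the inverse is
    integral; then u^-1 - 1 = - u^-1 (u - 1). *)
Lemma cong_unit (F : finFieldType) (P : closed_point F) n (u : 'M['K_F]_2) :
  mxdiv (local_ring P) (unif P) n.+1 (u - 1%:M) ->
  u \in unitmx /\ mxdiv (local_ring P) (unif P) n.+1 (invmx u - 1%:M).
Proof.
move=> h; have uP := local_unif P; have u0 := unif_neq0 P.
have h1 := mxdiv_le uP (ltn0Sn n) h.
have hl := level_of_cong uP (leq0n _) h.
have [y ey hy] : exists2 y : 'M['K_F]_2, u = 1%:M + unif P *: y &
    forall i j, local_ring P (y i j).
  exists ((unif P)^-1 *: (u - 1%:M)).
    by rewrite scalerA divff // scale1r addrC subrK.
  by move=> i j; have := h1 i j; rewrite expr1 !mxE mulrC.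
have e : u = mx2 (1 + unif P * y 0 0) (unif P * y 0 1) (unif P * y 1 0) (1 + unif P * y 1 1).
  by apply: mx2P; rewrite mx2E ey !mxE ?add0r.
have [D [OD OVD eD]] : exists D, [/\ local_ring P D, local_ring P (1 + unif P * D)^-1 &
    (1 + unif P * y 0 0) * (1 + unif P * y 1 1) - (unif P * y 0 1) * (unif P * y 1 0) =
    1 + unif P * D].
  exists (y 0 0 + y 1 1 + unif P * (y 0 0 * y 1 1 - y 0 1 * y 1 0)).
  have h2 : local_ring P (y 0 0 + y 1 1 + unif P * (y 0 0 * y 1 1 - y 0 1 * y 1 0)).
    apply: local_ringD; first exact: local_ringD.
    apply: local_ringM; first exact: local_ring_unif.
    by apply: local_ringB; apply: local_ringM.
  by split=> //; [exact: local_ring_1D|exact: det_congr].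
have D0 : 1 + unif P * D != 0.
  apply/eqP => D0; apply: (@local_ring_unifV _ P).
  have -> : (unif P)^-1 = - D.
    by apply: (mulfI u0); rewrite divff // mulrN; apply/eqP; rewrite -addr_eq0 D0.
  exact: local_ringN.
have D0' : (1 + unif P * y 0 0) * (1 + unif P * y 1 1) -
    (unif P * y 0 1) * (unif P * y 1 0) != 0 by rewrite eD.
have uu : u \in unitmx by rewrite e unit_mx2.
split=> //.
have vi i j : local_ring P (invmx u i j).
  move/level_ring0P: hl => hl.
  rewrite e (invmx2 D0') eD.
  have := hl 0 0; have := hl 0 1; have := hl 1 0; have := hl 1 1.
  rewrite {1 2 3 4}e !mx2E => k1 k2 k3 k4.
  by case: (ord2P i) => ->; case: (ord2P j) => ->; rewrite mx2E;
    apply: local_ringM OVD => //; apply: local_ringN.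
have -> : invmx u - 1%:M = invmx u *m - (u - 1%:M).
  by rewrite mulmxN mulmxBr mulVmx // mulmx1 opprB.
have := mxdivM uP (n := 0) (m := n.+1); rewrite add0n; apply.
  exact/mxdiv0P.
exact: mxdivN.
Qed.

Lemma invmx_factor (L : fieldType) (x k l : 'M[L]_2) : x \in unitmx -> k \in unitmx ->
  l \in unitmx -> invmx (invmx x *m k) = invmx (l *m k) *m (l *m x).
Proof.
move=> xu ku lu; rewrite !invmx_mul ?unitmx_inv // invmxK.
by rewrite mulmxA mulmxKV.
Qed.

Lemma units_of_conj (L : fieldType) (S : set 'M[L]_2) (x k d : 'M[L]_2) :
  x \in unitmx -> k \in unitmx -> d \in unitmx ->
  twist d S (invmx x *m k) -> twist d S (invmx (invmx x *m k)) ->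
  units_of S (invmx (x *m d) *m (k *m d)).
Proof.
move=> xu ku du v2 v3; split; first by rewrite !(unitmx_mul, unitmx_inv) xu ku du.
  by move: v2; rewrite /twist /= invmx_mul // !mulmxA.
move: v3; rewrite /twist /=.
have -> : invmx (x *m d) *m (k *m d) = invmx d *m (invmx x *m k) *m d.
  by rewrite invmx_mul // !mulmxA.
by rewrite !invmx_mul ?(unitmx_mul, unitmx_inv, xu, ku, du) // !invmxK !mulmxA.
Qed.

Section Frames.
Variables (F : finFieldType) (P : closed_point F).
Local Notation K := 'K_F.
Local Notation C := (completion P).
Local Notation Oh := (completed_ring P).
Local Notation pih := (completed_unif P).
Local Notation iota := (completion_of P).
Implicit Types (A g h k : 'M[K]_2) (x : 'M[C]_2) (n d : nat).

Lemma mx_dense x n : exists A, mxdiv Oh pih n (x - map_mx iota A).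
Proof.
have [a ha] := completion_dense (x 0 0) n; have [b hb] := completion_dense (x 0 1) n.
have [c hc] := completion_dense (x 1 0) n; have [d hd] := completion_dense (x 1 1) n.
exists (mx2 a b c d) => i j; rewrite !mxE.
by case: (ord2P i) => ->; case: (ord2P j) => -> /=; [exact: ha|exact: hb|exact: hc|exact: hd].
Qed.

Lemma mxdiv_map n A : mxdiv Oh pih n (map_mx iota A) <-> mxdiv (local_ring P) (unif P) n A.
Proof.
split=> h i j; have := h i j; rewrite !mxE.
  by rewrite completed_unifX -fmorphV -rmorphM => /completed_ring_of.
by rewrite completed_unifX -fmorphV -rmorphM => ?; apply/completed_ring_of.
Qed.

Lemma level0_map A : completed_level P 0 (map_mx iota A) <-> level P 0 A.
Proof.
rewrite !level_ring0P; split=> h i j; have := h i j; rewrite mxE;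
  [by move/completed_ring_of|by move=> ?; apply/completed_ring_of].
Qed.

Lemma twist_map g A : twist (map_mx iota g) (completed_level P 0) (map_mx iota A) <->
  twist g (level P 0) A.
Proof. by rewrite /twist /= -map_invmx -!map_mxM level0_map. Qed.

(** Let k be close to x and l close to x^-1. Then l k is a matrix over K that is
    congruent to 1, hence invertible by cong_unit, and the inverse of x^-1 k is
    (l k)^-1 (l x), a product of matrices congruent to 1. *)
Lemma frame_dense x d : x \in unitmx -> exists2 k, k \in unitmx &
  units_of (completed_level P d) (invmx x *m map_mx iota k).
Proof.
move=> xu; have U := completed_unif_ring P.
have [a ha] := mxdiv_bounded U (@completion_bounded _ P) x.
have [b hb] := mxdiv_bounded U (@completion_bounded _ P) (invmx x).
have [k hk] := mx_dense x (d.+1 + b); have [l hl] := mx_dense (invmx x) (d.+1 + a).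
have h1 : mxdiv Oh pih d.+1 (invmx x *m map_mx iota k - 1%:M).
  have -> : invmx x *m map_mx iota k - 1%:M = - (invmx x *m (x - map_mx iota k)).
    by rewrite mulmxBr mulVmx // opprB.
  by apply: (mxdivN U); have [] := mxdiv_scaleM U hb hk.
have h2 : mxdiv Oh pih d.+1 (map_mx iota l *m x - 1%:M).
  have -> : map_mx iota l *m x - 1%:M = - ((invmx x - map_mx iota l) *m x).
    by rewrite mulmxBl mulVmx // opprB.
  by apply: (mxdivN U); have [] := mxdiv_scaleM U ha hl.
have /cong_unit[lku hlk] : mxdiv (local_ring P) (unif P) d.+1 (l *m k - 1%:M).
  apply/mxdiv_map; rewrite map_mxB map_mx1 map_mxM.
  have -> : map_mx iota l *m map_mx iota k = (map_mx iota l *m x) *m (invmx x *m map_mx iota k).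
    by rewrite -!mulmxA mulKVmx.
  exact: mxdiv_mul1.
have [lu ku] : l \in unitmx /\ k \in unitmx by apply/andP; rewrite -unitmx_mul.
have {lku} mlu : map_mx iota l \in unitmx by rewrite map_unitmx; exact: lu.
have mku : map_mx iota k \in unitmx by rewrite map_unitmx; exact: ku.
exists k; first exact: ku.
split; first by rewrite unitmx_mul unitmx_inv xu mku.
  exact: (level_of_cong U (leqnSn d) h1).
apply: (level_of_cong U (leqnSn d)).
rewrite (invmx_factor xu mku mlu) -map_mxM -map_invmx.
apply: (mxdiv_mul1 U); last exact: h2.
by have := proj2 (mxdiv_map _ _) hlk; rewrite map_mxB map_mx1.
Qed.

(** A matrix k over K that is close to x defines the same two orders over the
    completion, and an order over K is the trace on M_2(K) of its completion. *)
Lemma common_frame g h x d : x \in unitmx ->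
  twist (map_mx iota g) (completed_level P 0) = twist x (completed_level P 0) ->
  twist (map_mx iota h) (completed_level P 0) =
    twist (x *m mx2 1 0 0 (pih ^- d)) (completed_level P 0) ->
  exists k, [/\ k \in unitmx, twist g (level P 0) = twist k (level P 0) &
    twist h (level P 0) = twist (k *m mx2 1 0 0 (unif P ^- d)) (level P 0)].
Proof.
move=> xu eg eh; have U := completed_unif_ring P.
have [k ku uk] := frame_dense d xu; exists k.
have LM n := level_ringM U (n := n).
have d0 : pih ^- d != 0 := invr_neq0 (expf_neq0 d (completed_unif_neq0 P)).
have [v1 v2 v3] := uk.
have du := diag_unit d0.
have ed : map_mx iota (mx2 1 0 0 (unif P ^- d)) = mx2 1 0 0 (pih ^- d).
  by rewrite map_mx2 rmorph1 !rmorph0 fmorphV completed_unifX.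
have eg' : twist (map_mx iota k) (completed_level P 0) = twist x (completed_level P 0).
  apply: twist_eq; [exact: LM|exact: xu|by rewrite map_unitmx; exact: ku|].
  by split; [exact: v1|apply: (level_ring_le U (leq0n d))|apply: (level_ring_le U (leq0n d))].
have eh' : twist (map_mx iota (k *m mx2 1 0 0 (unif P ^- d))) (completed_level P 0) =
    twist (x *m mx2 1 0 0 (pih ^- d)) (completed_level P 0).
  have mku : map_mx iota k \in unitmx by rewrite map_unitmx; exact: ku.
  rewrite map_mxM ed; apply: twist_eq.
  - exact: LM.
  - by rewrite unitmx_mul xu du.
  - by rewrite unitmx_mul mku du.
  apply: (units_of_conj xu mku du).
    by move: v2; rewrite (level_ring_meet U) => -[_ ?].
  by move: v3; rewrite (level_ring_meet U) => -[_ ?].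
split; first exact: ku.
  apply/funext => A; apply/propext; rewrite -!twist_map eg eg'; exact: iff_refl.
apply/funext => A; apply/propext; rewrite -!twist_map eh eh'; exact: iff_refl.
Qed.

End Frames.

(** * Sheaves with prescribed stalks *)

Section Stalkwise.
Variable F : finFieldType.
Local Notation K := 'K_F.
Local Notation pt := (closed_point F).

Lemma open_cofinite (B : set pt) P : finite_set B -> open_set (P |` ~` B).
Proof.
move=> fB; split; first by exists P; left.
apply: sub_finite_set fB => Q; rewrite /= => h; apply: contrapT => nB; apply: h.
by right.
Qed.

Lemma open_setIP (U W : set pt) P : open_set U -> open_set W -> U P -> W P ->
  open_set (U `&` W).
Proof.
move=> [_ fU] [_ fW] UP WP; split; first by exists P.
by rewrite setCI finite_setU.
Qed.

Section Frame.
Variable V : lmodType K.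

(** The subsheaf of the constant sheaf V with stalk S P at P. *)
Definition stalkwise (S : pt -> set V) : set pt -> set V :=
  fun U => [set v | forall P, U P -> S P v].

(* b P is a basis of V with coordinates co P. It spans the stalk S P over the local
   ring at P, and for almost all Q it also spans S Q over the local ring at Q. *)
Variables (I : finType) (S : pt -> set V) (b : pt -> I -> V) (co : pt -> V -> I -> K).
Hypotheses (bco : forall P v, v = \sum_i co P v i *: b P i)
  (cob : forall P a i, co P (\sum_i a i *: b P i) i = a i)
  (Sco : forall P v, S P v <-> forall i, local_ring P (co P v i))
  (Sfin : forall P, finite_set
    [set Q | ~ forall v, S Q v <-> forall i, local_ring Q (co P v i)]).

Let co_lin P a v w i : co P (a *: v + w) i = a * co P v i + co P w i.
Proof.
rewrite -(cob P (fun i => a * co P v i + co P w i)); congr (co P _ i).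
rewrite {1}(bco P v) {1}(bco P w) scaler_sumr -big_split /=.
by apply: eq_bigr => j _; rewrite scalerA scalerDl.
Qed.

Let co0 P i : co P 0 i = 0.
Proof. by have := co_lin P (-1) 0 0 i; rewrite scaler0 addr0 mulN1r addNr. Qed.

Lemma stalkwise_module : is_sheaf_of_modules (stalkwise S).
Proof.
split.
- by move=> U W _ _ UW v h P /UW; exact: h.
- by move=> C W _ _ -> v h P [U CU UP]; exact: (h U CU).
- by move=> U _ P _; apply/Sco => i; rewrite co0; exact: local_ring0.
- move=> U v w _ hv hw P UP; apply/Sco => i; rewrite -[v]scale1r co_lin mul1r.
  by apply: local_ringD; [move: i; apply/Sco; exact: hv|move: i; apply/Sco; exact: hw].
move=> U f v _ hf hv P UP; apply/Sco => i; rewrite -[_ *: v]addr0 co_lin co0 addr0.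
by apply: local_ringM; [exact: hf|move: i; apply/Sco; exact: hv].
Qed.

(** The basis at P consists of sections, and generates them freely, over the open set
    of the points whose stalks it spans. *)
Lemma stalkwise_locally_free : locally_free_of_rank #|I| (stalkwise S).
Proof.
move=> P; have fB := Sfin P; set B := [set Q | ~ _] in fB.
exists (P |` ~` B); split; [exact: open_cofinite|by left|].
exists (fun k => b P (enum_val k)) => W oW WU.
have good Q : W Q -> forall v, S Q v <-> forall i, local_ring Q (co P v i).
  by move=> /WU [->|/contrapT h]; [exact: Sco|exact: h].
have reidx (a : 'I_#|I| -> K) :
    \sum_k a k *: b P (enum_val k) = \sum_i a (enum_rank i) *: b P i.
  rewrite (reindex (@enum_val I predT)) /=; last first.
    by exists enum_rank => i _; [exact: enum_valK|exact: enum_rankK].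
  by apply: eq_bigr => k _; rewrite enum_valK.
split=> [k Q WQ|v hv].
  apply/(good Q WQ) => i.
  rewrite [b P _](_ : _ = \sum_j (j == enum_val k)%:R *: b P j); last first.
    rewrite (bigD1 (enum_val k)) //= eqxx scale1r big1 ?addr0 // => j /negPf ->.
    by rewrite scale0r.
  by rewrite cob; case: (_ == _); [exact: local_ring1|exact: local_ring0].
exists [ffun k => co P v (enum_val k)]; split.
  split=> [k Q WQ|].
    by rewrite ffunE; have /(good Q WQ) h := hv Q WQ; exact: h.
  rewrite {1}(bco P v) reidx; apply: eq_bigr => i _.
  by rewrite ffunE enum_rankK.
move=> a [_ ev]; apply/ffunP => k; rewrite ffunE ev reidx cob.
by rewrite enum_valK.
Qed.

End Frame.

Lemma line_bundle_invertible (c : pt -> K) : (forall P, c P != 0) ->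
  finite_set [set P | c P != 1] ->
  is_invertible_bundle (@stalkwise K^o (fun P => [set f | local_ring P (f / c P)])).
Proof.
move=> c0 cf; pose S P : set K^o := [set f | local_ring P (f / c P)].
pose b P (i : 'I_1) : K^o := c P; pose co P (v : K^o) (i : 'I_1) := v / c P.
have bco P v : v = \sum_i co P v i *: b P i.
  by rewrite big_ord_recl big_ord0 addr0; apply/esym; exact: (divfK (c0 P) v).
have cob P a i : co P (\sum_i a i *: b P i) i = a i.
  have -> : i = ord0 by apply/val_inj; case: (i) => -[].
  by rewrite big_ord_recl big_ord0 addr0; exact: (mulfK (c0 P) (a ord0)).
have Sco P v : S P v <-> forall i, local_ring P (co P v i).
  by split=> [h i|h]; [exact: h|exact: (h 0)].
have Sfin P : finite_set [set Q | ~ forall v, S Q v <-> forall i, local_ring Q (co P v i)].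
  apply: (@sub_finite_set _ _ ([set P | c P != 1] `|`
     ([set Q | ~ local_ring Q (c P)] `|` [set Q | ~ local_ring Q (c P)^-1]))); last first.
    by rewrite !finite_setU; split=> //; split; exact: finite_poles.
  move=> Q; rewrite /setU /=; apply: contra_notP => /not_orP[/negP/negPn/eqP cQ].
  move=> /not_orP[/contrapT h1 /contrapT h2] v; rewrite /S /co /= cQ divr1.
  split=> [h i|/(_ 0) h]; first exact: local_ringM.
  by rewrite -(divfK (c0 P) v); exact: local_ringM.
split; first exact: (stalkwise_module bco cob Sco).
by rewrite -[1%N](card_ord 1); exact: (stalkwise_locally_free bco cob Sco Sfin).
Qed.

End Stalkwise.

Section Orders.
Variable F : finFieldType.
Local Notation K := 'K_F.
Local Notation pt := (closed_point F).
Implicit Types (g : pt -> 'M[K]_2) (A : 'M[K]_2) (P Q : pt).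

(** The sheaf of endomorphisms of the vector bundle with stalk g_P O_P^2 at P. *)
Definition end_order g : set pt -> set 'M[K]_2 :=
  stalkwise (fun P => twist (g P) (level P 0)).

Lemma finite_nonintegral A : finite_set [set Q | ~ level Q 0 A].
Proof.
apply: (@sub_finite_set _ _
  (([set Q | ~ local_ring Q (A 0 0)] `|` [set Q | ~ local_ring Q (A 0 1)]) `|`
   ([set Q | ~ local_ring Q (A 1 0)] `|` [set Q | ~ local_ring Q (A 1 1)]))); last first.
  by rewrite !finite_setU; split; split; exact: finite_poles.
move=> Q; rewrite /setU /=; apply: contra_notP => /not_orP[/not_orP[/contrapT h1 /contrapT h2]].
move=> /not_orP[/contrapT h3 /contrapT h4].
by apply/level_ring0P => i j; case: (ord2P i) => ->; case: (ord2P j) => ->.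
Qed.

Lemma finite_nonunits A : A \in unitmx -> finite_set [set Q | ~ units_of (level Q 0) A].
Proof.
move=> Au; apply: (@sub_finite_set _ _ ([set Q | ~ level Q 0 A] `|`
  [set Q | ~ level Q 0 (invmx A)])); last first.
  by rewrite finite_setU; split; exact: finite_nonintegral.
move=> Q; rewrite /setU /=; apply: contra_notP => /not_orP[/contrapT h1 /contrapT h2].
by split; [exact: Au|exact: h1|exact: h2].
Qed.

Section EndOrder.
Variable g : pt -> 'M[K]_2.
Hypotheses (gu : forall P, g P \in unitmx) (gf : finite_set [set P | g P != 1%:M]).

Lemma levelM P n : mul_closed (level P n).
Proof. exact: (level_ringM (local_unif P)). Qed.

(** The matrix units, conjugated by g_P, span the stalk at P. They also span the stalk
    M_2(O_Q) at almost every Q, because g_P lies in GL_2(O_Q). *)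
Lemma end_order_lattice : is_lattice (end_order g).
Proof.
pose S P := twist (g P) (level P 0).
pose b P (i : 'I_2 * 'I_2) : 'M[K]_2 := g P *m delta_mx i.1 i.2 *m invmx (g P).
pose co P A (i : 'I_2 * 'I_2) := (invmx (g P) *m A *m g P) i.1 i.2.
have sumE P (a : 'I_2 * 'I_2 -> K) :
    \sum_i a i *: b P i = g P *m (\matrix_(i, j) a (i, j)) *m invmx (g P).
  rewrite [X in g P *m X]matrix_sum_delta mulmx_sumr mulmx_suml.
  transitivity (\sum_i \sum_j a (i, j) *: b P (i, j)).
    by rewrite pair_bigA; apply: eq_bigr => -[].
  apply: eq_bigr => i _; rewrite mulmx_sumr mulmx_suml; apply: eq_bigr => j _.
  by rewrite mxE -scalemxAr -scalemxAl.
have bco P A : A = \sum_i co P A i *: b P i.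
  rewrite sumE (_ : \matrix_(i, j) _ = invmx (g P) *m A *m g P); last first.
    by apply/matrixP => i j; rewrite mxE.
  by rewrite !mulmxA (mulmxV (gu P)) mul1mx (mulmxK (gu P)).
have cob P a i : co P (\sum_i a i *: b P i) i = a i.
  rewrite /co sumE -!mulmxA (mulVmx (gu P)) mulmx1 (mulKmx (gu P)) mxE.
  by case: i.
have Sco P A : S P A <-> forall i, local_ring P (co P A i).
  split=> [/level_ring0P h i|h]; first exact: h.
  by apply/level_ring0P => i j; exact: (h (i, j)).
have Sfin P : finite_set [set Q | ~ forall v, S Q v <-> forall i, local_ring Q (co P v i)].
  apply: (@sub_finite_set _ _ ([set P | g P != 1%:M] `|`
    [set Q | ~ units_of (level Q 0) (g P)])); last first.
    by rewrite finite_setU; split=> //; exact: finite_nonunits.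
  move=> Q; rewrite /setU /=; apply: contra_notP => /not_orP[/negP/negPn/eqP gQ].
  move=> /contrapT uQ A; rewrite /S gQ twist1 -(twist_unit (@levelM Q 0) uQ).
  split=> [/level_ring0P h i|h]; first exact: h.
  by apply/level_ring0P => i j; exact: (h (i, j)).
split; first exact: (stalkwise_module bco cob Sco).
by eexists; exact: (stalkwise_locally_free bco cob Sco Sfin).
Qed.

Lemma finite_end_order A : finite_set [set P | ~ twist (g P) (level P 0) A].
Proof.
apply: (@sub_finite_set _ _ ([set P | g P != 1%:M] `|` [set Q | ~ level Q 0 A])).
  move=> Q; rewrite /setU /=; apply: contra_notP => /not_orP[/negP/negPn/eqP gQ].
  by move=> /contrapT; rewrite gQ twist1.
by rewrite finite_setU; split=> //; exact: finite_nonintegral.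
Qed.

Lemma end_order_is_order : is_order (end_order g).
Proof.
split; first exact: end_order_lattice.
(* This open set is nonempty because the curve has infinitely many points. *)
- apply/seteqP; split=> // A _; exists (~` [set P | ~ twist (g P) (level P 0) A]).
    have fA := finite_end_order A; split; last by rewrite setCK.
    by have [P hP] := infinite_points fA; exists P.
  by move=> P /contrapT.
- move=> U _ P _; rewrite /twist /= mulmx1 (mulVmx (gu P)); exact: (level_ring1 (local_unif P) 0).
move=> U A B _ hA hB P UP; rewrite /twist /=.
have -> : invmx (g P) *m (A *m B) *m g P =
    (invmx (g P) *m A *m g P) *m (invmx (g P) *m B *m g P).
  by rewrite !mulmxA (mulmxK (gu P)).
by apply: levelM; [exact: hA|exact: hB].
Qed.

End EndOrder.
End Orders.

(** * Orders over a local ring *)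

Section FieldIdentities.
Variable L : fieldType.
Implicit Types (x y p q r : L) (n m : nat).

Lemma mulf_power_pole n x p : x != 0 -> p != 0 ->
  p ^+ n * x ^+ n.+1 * (x^-1 / p) ^+ n.+1 = p^-1.
Proof.
move=> x0 p0; rewrite -mulrA -exprMn mulrA mulfV // div1r exprVn exprS invfM.
by rewrite mulrCA mulfV ?mulr1 // expf_neq0.
Qed.

Lemma mulf_pole_split n m p : p != 0 -> p ^+ n * p ^- (n.+1 + m) * p ^+ m = p^-1.
Proof.
move=> p0; rewrite exprD exprS; set x := p ^+ n; set y := p ^+ m.
have x0 : x != 0 by exact: expf_neq0.
have y0 : y != 0 by exact: expf_neq0.
by field; rewrite x0 y0 p0.
Qed.

Lemma mulf_pole_next n x p : x != 0 -> p != 0 -> (x * p ^+ n)^-1 / p * x = p ^- n.+1.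
Proof.
move=> x0 p0; rewrite exprS; set y := p ^+ n.
have y0 : y != 0 by exact: expf_neq0.
by field; rewrite x0 y0 p0.
Qed.

Lemma hermite_det p q r : p != 0 -> r != 0 -> p * r - 0 * q != 0.
Proof. by move=> p0 r0; rewrite mul0r subr0 mulf_neq0. Qed.

Lemma hermite_conj p q r (C : 'M[L]_2) : p != 0 -> r != 0 ->
  invmx (mx2 p 0 q r) *m C *m mx2 p 0 q r =
  let x := C 0 0 * p + C 0 1 * q in let y := C 1 0 * p + C 1 1 * q in
  mx2 (x / p) (C 0 1 * r / p)
    ((y - q * (x / p)) / r) ((C 1 1 * r - q * (C 0 1 * r / p)) / r).
Proof.
move=> p0 r0; rewrite invmx2 ?hermite_det // {1}(mx2_eta C) !mulmx2.
by congr mx2; field; rewrite ?p0 ?r0 ?mulf_neq0.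
Qed.

Lemma scale_conj x y z (g B : 'M[L]_2) : g \in unitmx ->
  (x * y * z) *: B = (x *: invmx g) *m (y *: (g *m B *m invmx g)) *m (z *: g).
Proof.
move=> gu; rewrite -!(scalemxAl, scalemxAr) !scalerA.
have -> : invmx g *m (g *m B *m invmx g) *m g = B by rewrite !mulmxA mulmxKV // mulVmx // mul1mx.
by congr (_ *: _); ring.
Qed.

Lemma infty_shift n x y p : p != 0 ->
  (x * p ^- n - y) / p^-1 = (x - y * p ^+ n) * p / p ^+ n.
Proof.
move=> p0; rewrite invrK; set q := p ^+ n; have q0 : q != 0 by exact: expf_neq0.
by field; rewrite ?q0 ?p0.
Qed.

Lemma residue_entry x y p r : r != 0 -> (x / r - y) / p * r = (x - y * r) / p.
Proof. by move=> r0; rewrite mulrAC; congr (_ / _); field. Qed.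

End FieldIdentities.

Section LocalOrders.
Variables (F : finFieldType) (P : closed_point F).
Local Notation K := 'K_F.
Local Notation O := (local_ring P).
Local Notation pi := (unif P).
Implicit Types (S : set 'M[K]_2) (A B : 'M[K]_2) (x y : K).

Definition bounded_mx S := exists N : nat, forall A, S A -> mxdiv O pi 0 (pi ^+ N *: A).

(** Otherwise x^-1 = pi y with y integral, and the product of pi^N x^(N+1) and
    y^(N+1) is the pole pi^-1. *)
Lemma power_bounded_integral x N : (forall n, O (pi ^+ N * x ^+ n)) -> O x.
Proof.
move=> h; apply: contrapT => nx; have hy := local_ring_pole nx.
have x0 : x != 0 by apply: contra_not_neq nx => ->; exact: local_ring0.
apply: (@local_ring_unifV _ P).
have hyn : O ((x^-1 / pi) ^+ N.+1).
  by elim: N.+1 => [|n ih]; rewrite ?expr0 ?exprS; [exact: local_ring1|exact: local_ringM].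
have := local_ringM (h N.+1) hyn.
by rewrite (mulf_power_pole N x0 (unif_neq0 P)).
Qed.

Lemma bounded_mulV S g : g \in unitmx -> bounded_mx S ->
  bounded_mx [set B | S (g *m B *m invmx g)].
Proof.
move=> gu [N hN]; have U := local_unif P.
have [a ha] := mxdiv_bounded U (@local_ring_bounded _ P) g.
have [b hb] := mxdiv_bounded U (@local_ring_bounded _ P) (invmx g).
exists (b + N + a)%N => B /hN hB.
have -> : pi ^+ (b + N + a) *: B = (pi ^+ b *: invmx g) *m
    (pi ^+ N *: (g *m B *m invmx g)) *m (pi ^+ a *: g).
  by rewrite !exprD; exact: scale_conj.
by have := mxdivM U (mxdivM U hb hB) ha.
Qed.

(** Multiplication by matrix units moves any entry x of an element to the upper left
    corner. Hence S contains, up to conjugation, the powers of x in this corner; as S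
    is bounded, x is integral. *)
Lemma local_maximality S g : g \in unitmx -> mul_closed S -> bounded_mx S ->
  twist g (level P 0) `<=` S -> S `<=` twist g (level P 0).
Proof.
move=> gu SM Sb sub; set T := [set B | S (g *m B *m invmx g)].
have [N hN] := bounded_mulV gu Sb.
have TM : mul_closed T.
  move=> A B hA hB; rewrite /T /=.
  have -> : g *m (A *m B) *m invmx g = (g *m A *m invmx g) *m (g *m B *m invmx g).
    by rewrite !mulmxA (mulmxKV gu).
  exact: SM.
have TO B : level P 0 B -> T B.
  move=> hB; apply: sub; rewrite /twist /=.
  by rewrite !mulmxA (mulVmx gu) mul1mx (mulmxKV gu).
have TE B i j : T B -> T (mx2 (B i j) 0 0 0).
  move=> hB.
  have -> : mx2 (B i j) 0 0 0 = (mx2 (i == 0)%:R (i == 1)%:R 0 0) *m B *m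
      (mx2 (j == 0)%:R 0 (j == 1)%:R 0).
    rewrite {2}(mx2_eta B) !mulmx2; congr mx2.
    - by case: (ord2P i) => ->; case: (ord2P j) => ->;
        rewrite /= !(mul0r, mul1r, mulr0, mulr1, addr0, add0r).
    - by rewrite !mulr0 addr0.
    - by rewrite !mul0r addr0 !mul0r addr0.
    - by rewrite !mulr0 addr0.
  have lb (b : bool) : O b%:R.
    by case: b; [exact: local_ring1|exact: local_ring0].
  apply: (TM); [apply: (TM); last exact: hB|]; apply: TO; apply/level_ring0P => k l;
    case: (ord2P k) => ->; case: (ord2P l) => ->; rewrite mx2E;
    try exact: lb; exact: local_ring0.
move=> A SA; apply/level_ring0P => i j; set B := invmx g *m A *m g.
have TB : T B by rewrite /T /B /= !mulmxA (mulmxV gu) mul1mx (mulmxK gu).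
apply: (@power_bounded_integral _ N) => n.
have Tn : T (mx2 (B i j ^+ n) 0 0 (n == 0)%:R).
  elim: n => [|n ih].
    by rewrite expr0 mx2_1; apply: TO; exact: (level_ring1 (local_unif P) 0).
  have := TM _ _ (TE B i j TB) ih.
  by rewrite mulmx2 -exprS !(mulr0, mul0r, addr0).
by have /mxdiv0P /(_ 0 0) := hN _ Tn; rewrite mxE mx2E.
Qed.

(** The generator is pi^-n with n maximal: an element x of I with x pi^n not integral
    would put pi^-(n+1) into I. *)
Lemma fractional_ideal_generator (I : set K) : I 1 ->
  (forall a x, O a -> I x -> I (a * x)) -> (exists N, forall x, I x -> O (pi ^+ N * x)) ->
  exists p, [/\ p != 0, I p & forall x, I x -> O (x / p)].
Proof.
move=> I1 IM [N hN].
have ex : exists n, `[< I (pi ^- n) >] by exists 0%N; apply/asboolP; rewrite expr0 invr1.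
have bd n : `[< I (pi ^- n) >] -> (n <= N)%N.
  move/asboolP/hN => h; rewrite leqNgt; apply/negP => Nn; apply: (@local_ring_unifV _ P).
  have h2 : O (pi ^+ (n - N.+1)) by exact: local_ring_unifX.
  have := local_ringM h h2; have e : n = (N.+1 + (n - N.+1))%N by rewrite subnKC.
  by rewrite {1}e (mulf_pole_split _ _ (unif_neq0 P)).
case: (ex_maxnP ex bd) => n /asboolP In max; exists (pi ^- n); split=> //.
  by rewrite invr_eq0; exact: unifX_neq0.
move=> x Ix; rewrite invrK; apply: contrapT => h.
have hp := local_ring_pole h.
have x0 : x != 0 by apply: contra_not_neq h => ->; rewrite mul0r; exact: local_ring0.
have : (n.+1 <= n)%N.
  apply: max; apply/asboolP; have := IM _ _ hp Ix.
  by rewrite (mulf_pole_next n x0 (unif_neq0 P)).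
by rewrite ltnn.
Qed.

(** S acts on the lattice S O_P^2. This lattice has a Hermite basis (p, q), (0, r),
    where p generates the ideal of all first coordinates, and r the ideal of second
    coordinates of vectors with first coordinate 0. In this basis the elements of S
    have integral entries. *)
Lemma local_order_in_maximal S : S 0 -> S 1%:M -> mul_closed S ->
  (forall A B, S A -> S B -> S (A + B)) -> (forall a A, O a -> S A -> S (a *: A)) ->
  bounded_mx S -> exists2 g, g \in unitmx & S `<=` twist g (level P 0).
Proof.
move=> S0 S1 SM SD SZ [N hN].
(* The vectors of S O_P^2 are the sums of a first column and a second column of
   elements of S. *)
pose M x y := exists A B, [/\ S A, S B, x = A 0 0 + B 0 1 & y = A 1 0 + B 1 1].
have MD x y x' y' : M x y -> M x' y' -> M (x + x') (y + y').
  move=> [A [B [hA hB -> ->]]] [A' [B' [hA' hB' -> ->]]].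
  by exists (A + A'), (B + B'); rewrite !mxE; split; [exact: SD|exact: SD| |]; rewrite addrACA.
have MZ a x y : O a -> M x y -> M (a * x) (a * y).
  move=> ha [A [B [hA hB -> ->]]].
  by exists (a *: A), (a *: B); rewrite !mxE; split; [exact: SZ|exact: SZ| |]; rewrite mulrDr.
have MS C x y : S C -> M x y -> M (C 0 0 * x + C 0 1 * y) (C 1 0 * x + C 1 1 * y).
  move=> hC [A [B [hA hB -> ->]]].
  exists (C *m A), (C *m B); rewrite !mulmx2E !mulrDr.
  by split; [exact: SM|exact: SM| |]; rewrite addrACA.
have M10 : M 1 0 by exists 1%:M, 0; rewrite !mxE !addr0.
have M01 : M 0 1 by exists 0, 1%:M; rewrite !mxE !add0r.
have Mb x y : M x y -> O (pi ^+ N * x) /\ O (pi ^+ N * y).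
  move=> [A [B [/hN/mxdiv0P hA /hN/mxdiv0P hB -> ->]]]; rewrite !mulrDr.
  have := hA 0 0; have := hA 1 0; have := hB 0 1; have := hB 1 1; rewrite !mxE.
  by move=> h1 h2 h3 h4; split; apply: local_ringD.
have [p [p0 [q Mpq] hp]] : exists p, [/\ p != 0, exists q, M p q &
    forall x, (exists y, M x y) -> O (x / p)].
  apply: (@fractional_ideal_generator [set x | exists y, M x y]) => /=.
  - by exists 0.
  - by move=> a x ha [y hxy]; exists (a * y); exact: MZ.
  - by exists N => x [y /Mb[]].
have [r [r0 M0r hr]] : exists r, [/\ r != 0, M 0 r & forall y, M 0 y -> O (y / r)].
  apply: (@fractional_ideal_generator [set y | M 0 y]) => //=.
  - by move=> a y ha h0y; have := MZ _ _ _ ha h0y; rewrite mulr0.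
  - by exists N => y /Mb[].
have hM x y : M x y -> O (x / p) /\ O ((y - q * (x / p)) / r).
  move=> hxy; have hx := hp x (ex_intro _ y hxy); split=> //; apply: hr.
  have := MD _ _ _ _ hxy (MZ _ _ _ (local_ringN hx) Mpq).
  by rewrite mulNr (divfK p0) subrr mulNr [_ * q]mulrC.
have D0 := hermite_det q p0 r0.
exists (mx2 p 0 q r); first by rewrite unit_mx2.
move=> C SC; have [k1 k2] := hM _ _ (MS _ _ _ SC Mpq).
have [k3 k4] := hM _ _ (MS _ _ _ SC M0r).
apply/level_ring0P => i j; rewrite (hermite_conj q C p0 r0).
by case: (ord2P i) => ->; case: (ord2P j) => ->; rewrite mx2E;
  [exact: k1|move: k3; rewrite mulr0 add0r|exact: k2|move: k4; rewrite !mulr0 !add0r].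
Qed.

End LocalOrders.

(** * Maximal orders *)

Section MaximalOrders.
Variable F : finFieldType.
Local Notation K := 'K_F.
Local Notation pt := (closed_point F).
Implicit Types (g : pt -> 'M[K]_2) (A B : 'M[K]_2) (P Q : pt) (E : set pt -> set 'M[K]_2).

Definition stalk E P : set 'M[K]_2 := [set A | exists U, [/\ open_set U, U P & E U A]].

Section Stalks.
Variable E : set pt -> set 'M[K]_2.
Hypothesis oE : is_order E.

Let restr U W : open_set U -> open_set W -> U `<=` W -> E W `<=` E U.
Proof. by case: oE => -[[h _ _ _ _] _] _ _ _ oU oW UW; exact: h. Qed.

Lemma stalk_sections U P A : open_set U -> U P -> E U A -> stalk E P A.
Proof. by move=> oU UP EA; exists U. Qed.

Let meet P A B : stalk E P A -> stalk E P B ->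
  exists U, [/\ open_set U, U P, E U A & E U B].
Proof.
move=> [U [oU UP EA]] [W [oW WP EB]]; have oUW := open_setIP oU oW UP WP.
exists (U `&` W); split=> //.
  by apply: (restr oUW oU) EA => Q [].
by apply: (restr oUW oW) EB => Q [].
Qed.

Lemma stalk_0 P : stalk E P 0.
Proof.
have oT : open_set (P |` ~` (set0 : set pt)) by apply: open_cofinite.
exists (P |` ~` set0); split; [exact: oT|by left|].
by case: oE => -[[_ _ h _ _] _] _ _ _; exact: h.
Qed.

Lemma stalk_1 P : stalk E P 1%:M.
Proof.
have oT : open_set (P |` ~` (set0 : set pt)) by apply: open_cofinite.
exists (P |` ~` set0); split; [exact: oT|by left|].
by case: oE => _ _ h _; exact: h.
Qed.

Lemma stalk_D P A B : stalk E P A -> stalk E P B -> stalk E P (A + B).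
Proof.
move=> hA hB; have [U [oU UP EA EB]] := meet hA hB; exists U; split=> //.
by case: oE => -[[_ _ _ h _] _] _ _ _; exact: h.
Qed.

Lemma stalk_M P : mul_closed (stalk E P).
Proof.
move=> A B hA hB; have [U [oU UP EA EB]] := meet hA hB; exists U; split=> //.
by case: oE => _ _ _ h; exact: h.
Qed.

Lemma stalk_Z P f A : local_ring P f -> stalk E P A -> stalk E P (f *: A).
Proof.
move=> hf [U [oU UP EA]]; have fp := finite_poles f.
have oW := open_cofinite P fp; have WP : (P |` ~` [set Q | ~ local_ring Q f]) P by left.
have oUW := open_setIP oU oW UP WP; exists (U `&` (P |` ~` [set Q | ~ local_ring Q f])).
split=> //; case: oE => -[[_ _ _ _ h] _] _ _ _; apply: h => //.
  by move=> Q [_ [->//|/contrapT]].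
by apply: (restr oUW oU) EA => Q [].
Qed.

(** Near P the sections have a finite basis, whose denominators at P bound all the
    others. *)
Lemma stalk_bounded P : bounded_mx P (stalk E P).
Proof.
case: (oE) => -[_ [r /(_ P) [U [oU UP [b hb]]]]] _ _ _; have Un := local_unif P.
have [m hm] := choice (fun i => mxdiv_bounded Un (@local_ring_bounded _ P) (b i)).
(* The sum of the exponents m i bounds each of them. *)
exists (\sum_i m i)%N => A [W [oW WP EA]].
have oUW := open_setIP oU oW UP WP.
have [hbi ha] := hb _ oUW (fun Q h => proj1 h).
have EA' : E (U `&` W) A by apply: (restr oUW oW) EA => Q [].
have [a [[ra ->] _]] := ha _ EA'.
apply/mxdiv0P => k l; rewrite mxE summxE mulr_sumr.
apply: local_ring_sum => i _; rewrite mxE.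
have e : (\sum_i m i = (\sum_i m i - m i) + m i)%N.
  by rewrite subnK // (bigD1 i) //= leq_addr.
have /mxdiv0P /(_ k l) := hm i; rewrite mxE => hmi.
rewrite e exprD mulrCA -mulrA; apply: local_ringM.
  by apply: ra; split.
by apply: local_ringM; [exact: local_ring_unifX|exact: hmi].
Qed.

End Stalks.

Section EndOrderMaximal.
Variable g : pt -> 'M[K]_2.
Hypotheses (gu : forall P, g P \in unitmx) (gf : finite_set [set P | g P != 1%:M]).

Lemma stalk_end_order P A : twist (g P) (level P 0) A ->
  exists U, [/\ open_set U, U P & end_order g U A].
Proof.
move=> hA; have fA := finite_end_order gf A.
exists (P |` ~` [set P | ~ twist (g P) (level P 0) A]); split.
- exact: open_cofinite.
- by left.
by move=> Q [->|/contrapT].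
Qed.

(** The stalks of a larger order are larger local orders, excluded by
    local_maximality. *)
Lemma end_order_maximal : is_maximal_order (end_order g).
Proof.
split; first exact: end_order_is_order.
move=> E oE sub U oU; apply/seteqP; split; first exact: sub.
move=> A EA P UP; apply: (local_maximality (gu P) (stalk_M oE (P := P))).
- exact: stalk_bounded.
- move=> B /stalk_end_order[W [oW WP hB]].
  by exists W; split=> //; exact: sub.
by exists U.
Qed.

End EndOrderMaximal.

(** Every stalk lies in a conjugate of M_2(O_P), and it is M_2(O_P) itself at almost
    every P, where the matrix units are sections. These conjugates are the stalks of
    an order containing E. *)
Lemma maximal_order_end E : is_maximal_order E -> exists g,
  [/\ forall P, g P \in unitmx, finite_set [set P | g P != 1%:M] & eq_sheaf E (end_order g)].
Proof.
move=> [oE maxE].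
have /choice[g hg] : forall P, exists g : 'M[K]_2, [/\ g \in unitmx,
    stalk E P `<=` twist g (level P 0) & level P 0 `<=` stalk E P -> g = 1%:M].
  move=> P; have [h|nh] := pselect (level P 0 `<=` stalk E P).
    exists 1%:M; split=> //; first exact: unitmx1.
    apply: local_maximality; [exact: unitmx1|exact: stalk_M|exact: stalk_bounded|].
    by rewrite twist1.
  have [g gu hg] := local_order_in_maximal (stalk_0 oE P) (stalk_1 oE P)
    (stalk_M oE (P := P)) (@stalk_D _ oE P) (@stalk_Z _ oE P) (stalk_bounded oE P).
  by exists g; split.
have gu P : g P \in unitmx by have [] := hg P.
have gf : finite_set [set P | g P != 1%:M].
  have fib i j : exists2 U, open_set U & E U (delta_mx i j).
    by have : generic_fiber E (delta_mx i j) by case: oE => _ -> _ _.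
  have [U00 o00 h00] := fib 0 0; have [U01 o01 h01] := fib 0 1.
  have [U10 o10 h10] := fib 1 0; have [U11 o11 h11] := fib 1 1.
  apply: (@sub_finite_set _ _ ((~` U00 `|` ~` U01) `|` (~` U10 `|` ~` U11))); last first.
    by rewrite !finite_setU; case: o00 o01 o10 o11 => [_ ?] [_ ?] [_ ?] [_ ?].
  move=> P; rewrite /setU /=.
  apply: contraPP => /not_orP[/not_orP[/contrapT u00 /contrapT u01]].
  move=> /not_orP[/contrapT u10 /contrapT u11]; apply/negP/negPn/eqP.
  have [_ _] := hg P; apply => A /level_ring0P hA.
  rewrite (matrix_sum_delta A) !big_ord_recl !big_ord0 !addr0.
  have e1 : lift ord0 ord0 = 1 :> 'I_2 by apply: val_inj.
  rewrite !e1; apply: (stalk_D oE); apply: (stalk_D oE); apply: (stalk_Z oE); try exact: hA.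
  - exact: (stalk_sections o00 u00 h00).
  - exact: (stalk_sections o01 u01 h01).
  - exact: (stalk_sections o10 u10 h10).
  - exact: (stalk_sections o11 u11 h11).
exists g; split=> //; apply: maxE; first exact: end_order_is_order.
move=> U oU A EA P UP; have [_ h _] := hg P.
by apply: h; exists U.
Qed.

End MaximalOrders.

(** * Completed orders and adapted frames *)

Section CompletedOrders.
Variable F : finFieldType.
Local Notation K := 'K_F.
Local Notation pt := (closed_point F).
Implicit Types (g k : pt -> 'M[K]_2) (A B : 'M[K]_2) (P Q : pt) (E : set pt -> set 'M[K]_2).

Lemma closure_atE P (S : set 'M[K]_2) (A : 'M[completion P]_2) :
  closure_at S A <-> forall n, exists2 B, S B &
    mxdiv (completed_ring P) (completed_unif P) n (A - map_mx (completion_of P) B).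
Proof.
have p0 n : completed_unif P ^+ n != 0 := expf_neq0 n (completed_unif_neq0 P).
split=> h n; have [B SB hB] := h n; exists B => //= i j; have := hB i j; rewrite !mxE.
  by rewrite (scale_setE _ _ (p0 n)).
by rewrite (scale_setE _ _ (p0 n)).
Qed.

(** Functions that are regular on an affine line around P approximate the entries of
    any matrix over the completed ring, so that sections over an affine open set on
    which the frame g_P is valid are dense. *)
Lemma order_completion_end g P : (forall P, g P \in unitmx) ->
  finite_set [set P | g P != 1%:M] ->
  @order_completion F P (end_order g) =
    twist (map_mx (completion_of P) (g P)) (completed_level P 0).
Proof.
move=> gu gf; have U := completed_unif_ring P.
have mgu : map_mx (completion_of P) (g P) \in unitmx by rewrite map_unitmx; exact: gu.
have [a ha] := mxdiv_bounded U (@completion_bounded _ P) (map_mx (completion_of P) (g P)).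
have [b hb] := mxdiv_bounded U (@completion_bounded _ P) (invmx (map_mx (completion_of P) (g P))).
apply/seteqP; split=> [A [W [aW WP /closure_atE /(_ (a + b)%N) [B EB hAB]]]|A hA].
  apply/level_ring0P/mxdiv0P.
  have -> : invmx (map_mx (completion_of P) (g P)) *m A *m map_mx (completion_of P) (g P) =
    invmx (map_mx (completion_of P) (g P)) *m (A - map_mx (completion_of P) B) *m
      map_mx (completion_of P) (g P) +
    map_mx (completion_of P) (invmx (g P) *m B *m g P).
    rewrite !map_mxM map_invmx mulmxBr mulmxBl subrK //.
  apply: (mxdivD U).
    rewrite addnC in hAB; have [_ h1] := mxdiv_scaleM U ha hAB.
    by rewrite -mulmxA; have [w _] := mxdiv_scaleM U (n := 0) hb h1; exact: w.
  apply/mxdiv_map/mxdiv0P/level_ring0P; exact: EB.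
(* Away from these points the stalk is M_2(O_Q) and is stable under conjugation by
   g_P; removing the antipode makes the open set affine. *)
pose bad := [set Q | g Q != 1%:M] `|` [set Q | ~ units_of (level Q 0) (g P)] `|` [set antipode P].
have fbad : finite_set bad.
  rewrite /bad !finite_setU; split; last exact: finite_set1.
  by split; [exact: gf|exact: finite_nonunits].
exists (P |` ~` bad); split.
- split; first exact: open_cofinite.
  move=> e; have : (P |` ~` bad) (antipode P) by rewrite e.
  move=> [h|h]; first by have := antipode_neq P; rewrite h eqxx.
  by apply: h; right.
- by left.
apply/closure_atE => n.
set C := invmx (map_mx (completion_of P) (g P)) *m A *m map_mx (completion_of P) (g P) in hA.
have [C0 hC0] := mx_dense C (n + a + b).
have C0int : forall i j, local_ring P (C0 i j).
  apply/mxdiv0P/mxdiv_map.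
  have -> : map_mx (completion_of P) C0 = C - (C - map_mx (completion_of P) C0) by rewrite subKr.
  apply: (mxdivD U); first by apply/mxdiv0P/level_ring0P; exact: hA.
  by apply: (mxdivN U); apply: (mxdiv_le U (leq0n _) hC0).
have [c hc] := choice (fun ij => approx_regular (n + a + b) (C0int ij.1 ij.2)).
pose C1 : 'M[K]_2 := \matrix_(i, j) c (i, j).
have hC1 : mxdiv (completed_ring P) (completed_unif P) (n + a + b)
    (C - map_mx (completion_of P) C1).
  have -> : C - map_mx (completion_of P) C1 =
     (C - map_mx (completion_of P) C0) + map_mx (completion_of P) (C0 - C1).
    by rewrite map_mxB addrA subrK.
  apply: (mxdivD U hC0); apply/mxdiv_map => i j; rewrite !mxE.
  by have [h _] := hc (i, j); exact: h.
have C1int Q : Q != antipode P -> level Q 0 C1.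
  by move=> nQ; apply/level_ring0P => i j; rewrite mxE; have [_ h] := hc (i, j); exact: h.
exists (g P *m C1 *m invmx (g P)).
  move=> Q [->|nbad]; rewrite /twist /=.
    rewrite !mulmxA (mulVmx (gu P)) mul1mx (mulmxKV (gu P)).
    by apply: C1int; rewrite eq_sym antipode_neq.
  move/not_orP: nbad => [/not_orP[/negP/negPn/eqP gQ /contrapT [_ u1 u2]] nQ].
  rewrite gQ invmx1 mul1mx mulmx1.
  apply: (level_ringM (local_unif Q)) u2.
  by apply: (level_ringM (local_unif Q)) => //; apply: C1int; apply/eqP.
have -> : A - map_mx (completion_of P) (g P *m C1 *m invmx (g P)) =
    map_mx (completion_of P) (g P) *m (C - map_mx (completion_of P) C1) *m
    invmx (map_mx (completion_of P) (g P)).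
  rewrite !map_mxM map_invmx mulmxBr mulmxBl /C; congr (_ - _).
  by rewrite !mulmxA (mulmxV mgu) mul1mx (mulmxK mgu).
rewrite -mulmxA.
have [_ h1] := mxdiv_scaleM U (n := n + a) hb hC1.
by have [w _] := mxdiv_scaleM U (n := n) ha h1; exact: w.
Qed.

Lemma closure_at_sub P (S S' : set 'M[K]_2) : S `<=` S' ->
  @closure_at F P S `<=` @closure_at F P S'.
Proof. by move=> SS A h n; have [B /SS hB hB'] := h n; exists B. Qed.

Lemma order_completion_eq P D E : eq_sheaf D E ->
  @order_completion F P D = @order_completion F P E.
Proof.
move=> e; apply/seteqP; split=> A [U [aU UP hA]]; exists U; split=> //;
  apply: closure_at_sub hA; rewrite e //; by case: aU.
Qed.

(** One frame presents both maximal orders at P, by common_frame. Where D vanishes the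
    two orders coincide at P, and the given frame is kept in order that almost all
    frames are trivial. *)
Lemma Eichler_frame (D : pt -> nat) E : is_effective_divisor D ->
  is_Eichler_order_of_level D E -> exists k, [/\ forall P, k P \in unitmx,
    finite_set [set P | k P != 1%:M] &
    eq_sheaf E (stalkwise (fun P => twist (k P) (level P (D P))))].
Proof.
move=> fD [D1 [D2 [/maximal_order_end[g [gu gf eg]] /maximal_order_end[h [hu hf eh]] eE dist]]].
have /choice[k hk] : forall P, exists k : 'M[K]_2, [/\ k \in unitmx,
    twist (g P) (level P 0) `&` twist (h P) (level P 0) = twist k (level P (D P)) &
    D P = 0%N -> k = g P].
  move=> P; have [x xu [e1 e2]] := dist P.
  have U := completed_unif_ring P.
  rewrite (order_completion_eq _ eg) (order_completion_end P gu gf) in e1.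
  rewrite (order_completion_eq _ eh) (order_completion_end P hu hf) in e2.
  rewrite (mx2_set_level0 _ (completed_unif P)) (conj_setE _ xu) in e1.
  have p0 := expf_neq0 (D P) (completed_unif_neq0 P).
  have du := diag_unit (invr_neq0 p0).
  rewrite (mx2_set_twist U) (conj_setE _ xu) -(twistM _ xu du) in e2.
  have [k [ku k1 k2]] := common_frame xu e1 e2.
  have du' := diag_unit (invr_neq0 (unifX_neq0 P (D P))).
  have kE : twist (g P) (level P 0) `&` twist (h P) (level P 0) = twist k (level P (D P)).
    by rewrite k1 k2 (twistM _ ku du') (level_ring_meet (local_unif P) (D P)).
  have [D0|D0] := eqVneq (D P) 0%N; last first.
    exists k; split; [exact: ku|exact: kE|].
    by move=> D0'; rewrite D0' eqxx in D0.
  exists (g P); split; [exact: gu| |reflexivity].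
  by rewrite kE D0 k1.
exists k; split.
- by move=> P; have [] := hk P.
- apply: (@sub_finite_set _ _ ([set P | g P != 1%:M] `|` [set P | D P != 0%N])).
    move=> P; rewrite /setU /=; apply: contraPP => /not_orP[/negP/negPn/eqP gP].
    move=> /negP/negPn/eqP DP; have [_ _ /(_ DP) ->] := hk P.
    by rewrite gP eqxx.
  by rewrite finite_setU.
move=> U oU; rewrite eE // eg // eh //; apply/seteqP; split=> A.
  by move=> [h1 h2] P UP; have [_ <- _] := hk P; split; [exact: h1|exact: h2].
by move=> hA; split=> P UP; have := hA P UP; have [_ <- _] := hk P => -[].
Qed.

End CompletedOrders.

(** * Reduction of frames over the projective line *)

Section UnitsOfLevel.
Variables (L : fieldType) (O : set L) (pi : L).
Hypothesis unifO : ring_with_uniformizer O pi.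
Implicit Types (a b c d x y z r s : L) (n : nat) (u k : 'M[L]_2).

Let O1 : O 1. Proof. by case: unifO. Qed.
Let OB x y : O x -> O y -> O (x - y). Proof. by case: unifO => ? h *; apply: h. Qed.
Let OM x y : O x -> O y -> O (x * y). Proof. by case: unifO => ? ? h *; apply: h. Qed.
Let O0 : O 0. Proof. by rewrite -(subrr 1); apply: OB. Qed.
Let ON x : O x -> O (- x). Proof. by rewrite -sub0r; apply: OB. Qed.

Lemma units_of_level_mx2 n a b c d : O a -> O (b / pi ^+ n) -> O c -> O d ->
  a * d - b * c != 0 -> O (a * d - b * c)^-1 ->
  units_of (level_ring O pi n) (mx2 a b c d).
Proof.
move=> ha hb hc hd D0 hD; split; first by rewrite unit_mx2.
  by split; rewrite mx2E.
rewrite invmx2 //; split; rewrite mx2E; try by apply: OM => //; apply: ON.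
by rewrite mulrAC; apply: OM => //; rewrite mulNr; apply: ON.
Qed.

(** The upper right entry of the inverse is the one of u divided by - det u, and the
    determinant is a unit. *)
Lemma units_of_level_raise n u : units_of (level_ring O pi 0) u ->
  O (u 0 1 / pi ^+ n) -> units_of (level_ring O pi n) u.
Proof.
move=> [uu [h00 _ h10 h11] [k00 k01 k10 k11]] hu; rewrite expr0 divr1 in k01.
have e : (invmx u 0 0 * invmx u 1 1 - invmx u 0 1 * invmx u 1 0) = (\det u)^-1.
  by rewrite -det_inv [in RHS](mx2_eta (invmx u)) det_mx2.
have eD : \det u = u 0 0 * u 1 1 - u 0 1 * u 1 0 by rewrite {1}(mx2_eta u) det_mx2.
rewrite (mx2_eta u); apply: units_of_level_mx2; rewrite -?eD //.
  by rewrite -unitfE -unitmxE.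
by rewrite -e; apply: OB; apply: OM.
Qed.

Lemma units_of_level_lower n a c d : a != 0 -> d != 0 -> O a -> O a^-1 -> O c -> O d ->
  O d^-1 -> units_of (level_ring O pi n) (mx2 a 0 c d).
Proof.
move=> a0 d0 ha ha' hc hd hd'; apply: units_of_level_mx2; rewrite ?mul0r ?subr0 //.
  exact: mulf_neq0.
by rewrite invfM; apply: OM.
Qed.

Lemma units_of_level_upper n x : O (x / pi ^+ n) ->
  units_of (level_ring O pi n) (mx2 1 x 0 1).
Proof.
by move=> hx; apply: units_of_level_mx2; rewrite ?(mul1r, mulr0, subr0, invr1, oner_eq0).
Qed.

Lemma units_of_level0_reflection x : O x -> units_of (level_ring O pi 0) (mx2 1 x 0 (-1)).
Proof.
move=> hx; have e : 1 * -1 - x * 0 = -1 by rewrite mulr0 subr0 mul1r.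
have h1 : O (-1) by exact: ON.
by apply: units_of_level_mx2; rewrite ?e ?expr0 ?divr1 ?invrN ?invr1 ?oppr_eq0 ?oner_neq0.
Qed.

Lemma units_of_level_unip n y : O y -> units_of (level_ring O pi n) (mx2 1 0 y 1).
Proof.
by move=> hy; apply: units_of_level_lower; rewrite ?invr1 ?oner_neq0.
Qed.

Lemma units_of_level_diag n r : r != 0 -> O r -> O r^-1 ->
  units_of (level_ring O pi n) (mx2 1 0 0 r).
Proof. by move=> r0 h h'; apply: units_of_level_lower; rewrite ?invr1 ?oner_neq0. Qed.

Definition swap_mx : 'M[L]_2 := mx2 0 1 1 0.

Lemma swap_mxK : swap_mx *m swap_mx = 1%:M.
Proof. by rewrite mulmx2 -mx2_1 !(mul0r, mul1r, add0r, addr0). Qed.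

Lemma swap_unit : swap_mx \in unitmx.
Proof. by have [] := invmx_unique swap_mxK. Qed.

Lemma swap_inv : invmx swap_mx = swap_mx.
Proof. by have [] := invmx_unique swap_mxK. Qed.

Lemma swap_conj a b c d :
  swap_mx *m mx2 a b c d *m swap_mx = mx2 d c b a.
Proof. by rewrite !mulmx2; congr mx2; ring. Qed.

Lemma units_of_swap : units_of (level_ring O pi 0) swap_mx.
Proof.
by apply: units_of_level_mx2; rewrite ?(expr0, divr1, mul0r, mul1r, sub0r, invrN, invr1) //
  ?oppr_eq0 ?oner_eq0 //; exact: ON.
Qed.

(** Divide by the entry of the first row that has the smaller valuation. *)
Lemma column_reduction k : (forall x, ~ O x -> O x^-1) -> k \in unitmx ->
  exists u, units_of (level_ring O pi 0) u /\ (k *m u) 0 1 = 0.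
Proof.
move=> val ku; have [hb|hb] := pselect (O (k 0 1 / k 0 0)).
  have [k00|k00] := eqVneq (k 0 0) 0.
    exists swap_mx; split; first exact: units_of_swap.
    by rewrite mulmx2E !mx2E k00 mul0r mulr0 addr0.
  exists (mx2 1 (- (k 0 1 / k 0 0)) 0 1); split.
    by apply: units_of_level_upper; rewrite expr0 divr1; exact: ON.
  by rewrite mulmx2E !mx2E mulr1 mulrN mulrC divfK // addNr.
have ha := val _ hb; rewrite invf_div in ha.
have b0 : k 0 1 != 0 by apply: contra_not_neq hb => ->; rewrite mul0r.
exists (mx2 0 1 1 (- (k 0 0 / k 0 1))); split.
  by apply: units_of_level_mx2; rewrite ?(expr0, divr1, mul0r, mul1r, sub0r, invrN, invr1) //
  ?oppr_eq0 ?oner_eq0 //; exact: ON.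
by rewrite mulmx2E !mx2E mulr1 mulrN [_ * (_ / _)]mulrC divfK // subrr.
Qed.

End UnitsOfLevel.

Section Triangular.
Variable L : fieldType.
Implicit Types (x y z r s t : L).

Lemma lower_conj x y z x' y' z' : x' != 0 -> z' != 0 ->
  invmx (mx2 x' 0 y' z') *m mx2 x 0 y z =
  mx2 (x / x') 0 ((y - y' * x / x') / z') (z / z').
Proof.
move=> x0 z0; rewrite invmx2; last by rewrite mul0r subr0 mulf_neq0.
by rewrite mulmx2; congr mx2; field; rewrite ?x0 ?z0.
Qed.

Lemma scale_mx2 r (a b c d : L) : r *: mx2 a b c d = mx2 (r * a) (r * b) (r * c) (r * d).
Proof. by apply: mx2P; rewrite mx2E mxE mx2E. Qed.

(** Exchanging the rows of (1, 0; y, z) and clearing the first row by column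
    operations replaces y by 1/y and z by z/y^2, up to a scalar. *)
Lemma swap_step y z : y != 0 -> z != 0 ->
  swap_mx L *m mx2 1 0 y z =
  y *: (mx2 1 0 y^-1 (z / (y * y)) *m mx2 1 (z / y) 0 (-1)).
Proof.
move=> y0 z0; by rewrite !mulmx2 scale_mx2; congr mx2; field; rewrite ?y0.
Qed.

(** The valuation of z/y^2 is smaller than that of z when y vanishes at the point:
    this makes the reduction terminate. *)
Lemma reduce_bound p y z n : p != 0 -> z != 0 -> y != 0 ->
  p ^+ n / (z / (p * y * (p * y))) = p ^+ n.+1 / z * (p * (y * y)).
Proof. by move=> p0 z0 y0; rewrite exprS; set q := p ^+ n; field; rewrite p0 z0 y0. Qed.

Lemma lower_entry x y x' y' z' : x != 0 -> x' != 0 ->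
  (y - y' * x / x') / z' = (y * x' / x - y') / z' * (x / x').
Proof.
move=> x0 x0'; rewrite [RHS]mulrAC; congr (_ / _).
by field; rewrite x0 x0'.
Qed.

Lemma mulf_remainder (q b r x : L) : b != 0 -> ((q * b + r) / b - q) * x = r * x / b.
Proof. by move=> b0; field. Qed.

Lemma unit_lower y : mx2 1 0 y 1 \in unitmx.
Proof. by rewrite unit_mx2 mul1r mul0r subr0 oner_neq0. Qed.

Lemma lower_factor s y z : mx2 1 0 y z = mx2 1 0 s 1 *m mx2 1 0 (y - s) z.
Proof. by rewrite mulmx2; congr mx2; ring. Qed.

Lemma diag_factor y z : z != 0 -> mx2 1 0 y z = mx2 1 0 0 z *m mx2 1 0 (y / z) 1.
Proof. by move=> z0; rewrite mulmx2; congr mx2; field; rewrite ?z0. Qed.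

Lemma unswap_step y c (l m e g d u v : 'M[L]_2) : swap_mx L *m m = y *: (e *m v) ->
  e = c *: (g *m d *m u) ->
  l *m m = (y * c) *: (l *m (swap_mx L *m g) *m d *m (u *m v)).
Proof.
move=> h he; have -> : m = swap_mx L *m (swap_mx L *m m) by rewrite mulmxA swap_mxK mul1mx.
by rewrite h he -!(scalemxAl, scalemxAr) scalerA !mulmxA.
Qed.

Lemma diag_split r t : t != 0 -> mx2 1 0 0 r = mx2 1 0 0 t *m mx2 1 0 0 (r / t).
Proof. by move=> t0; rewrite mulmx2; congr mx2; field; rewrite ?t0. Qed.

Lemma diag_swap r : r != 0 ->
  mx2 1 0 0 r = r *: (swap_mx L *m mx2 1 0 0 r^-1 *m swap_mx L).
Proof. by move=> r0; rewrite !mulmx2 scale_mx2; congr mx2; field; rewrite ?r0. Qed.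

Lemma lower_scale x y z : x != 0 -> mx2 x 0 y z = x *: mx2 1 0 (y / x) (z / x).
Proof. by move=> x0; rewrite scale_mx2; congr mx2; field; rewrite ?x0. Qed.

Lemma scale_assoc x y z (a b d e f g h : 'M[L]_2) :
  a *m (x *: (y *: (b *m (z *: (d *m e *m f)) *m g)) *m h) =
  (x * y * z) *: (a *m (b *m d) *m e *m (f *m g *m h)).
Proof. by rewrite -!(scalemxAl, scalemxAr) !scalerA !mulmxA. Qed.

Lemma upper_inv x : invmx (mx2 1 x 0 1) = mx2 1 (- x) 0 1 :> 'M[L]_2.
Proof.
have [//|_ -> //] := @invmx_unique _ (mx2 1 x 0 1) (mx2 1 (- x) 0 1) _.
by rewrite mulmx2 -mx2_1; congr mx2; ring.
Qed.

Lemma upper_unit x : mx2 1 x 0 1 \in unitmx.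
Proof. by rewrite unit_mx2 mulr0 subr0 mul1r oner_neq0. Qed.

Lemma upper_split x t (u : 'M[L]_2) :
  mx2 1 (- t) 0 1 *m u = mx2 1 (x - t) 0 1 *m (mx2 1 (- x) 0 1 *m u).
Proof. by rewrite mulmxA mulmx2; congr (mx2 _ _ _ _ *m u); ring. Qed.

Lemma swap_upper t (u : 'M[L]_2) :
  swap_mx L *m (mx2 1 (- t) 0 1 *m u) = mx2 1 0 (- t) 1 *m (swap_mx L *m u).
Proof. by rewrite !mulmxA !mulmx2; congr (mx2 _ _ _ _ *m u); ring. Qed.

(** The matrix sends the two coordinate axes to the lines (y : 1) and (x : 1). *)
Lemma two_lines_inv x y : y - x != 0 -> invmx (mx2 y x 1 1) =
  mx2 (y - x)^-1 (- x / (y - x)) (- (y - x)^-1) (y / (y - x)).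
Proof.
move=> d0; have e : y * 1 - x * 1 = y - x by ring.
by rewrite invmx2 e //; congr mx2; field.
Qed.

Lemma two_lines_first x y (u : 'M[L]_2) : y - x != 0 ->
  invmx (mx2 y x 1 1) *m u =
  mx2 (y - x)^-1 0 (- (y - x)^-1) 1 *m (mx2 1 (- x) 0 1 *m u).
Proof.
move=> d0; rewrite two_lines_inv // mulmxA mulmx2.
by congr (mx2 _ _ _ _ *m u); field.
Qed.

Lemma two_lines_second x y (u : 'M[L]_2) : y - x != 0 ->
  swap_mx L *m (invmx (mx2 y x 1 1) *m u) =
  mx2 (- (y - x)^-1) 0 (y - x)^-1 1 *m (mx2 1 (- y) 0 1 *m u).
Proof.
move=> d0; rewrite two_lines_inv // !mulmxA !mulmx2.
by congr (mx2 _ _ _ _ *m u); field.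
Qed.

End Triangular.

Section GlobalReduction.
Variable F : finFieldType.
Local Notation K := 'K_F.
Local Notation pt := (closed_point F).
Local Notation infty := (None : pt).
Implicit Types (A B u k g : 'M[K]_2) (P Q R : pt) (x y z f c r : K).

Lemma column_reduction_at R k : k \in unitmx -> exists x y z,
  [/\ x != 0, z != 0 & exists2 u, units_of (level R 0) u & k = mx2 x 0 y z *m u].
Proof.
move=> ku; have [u [uu e]] := column_reduction (local_unif R) (@local_ring_val _ R) ku.
exists ((k *m u) 0 0), ((k *m u) 1 0), ((k *m u) 1 1).
have [u1 _ _] := uu.
have : k *m u \in unitmx by rewrite unitmx_mul ku u1.
rewrite {1}(mx2_eta (k *m u)) unit_mx2 e mul0r subr0 mulf_eq0 negb_or => /andP[h1 h2].
split; [exact: h1|exact: h2|].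
exists (invmx u); first exact: units_ofV.
by rewrite -[X in mx2 _ X _ _]e -mx2_eta (mulmxK u1).
Qed.

(** After column operations k is lower triangular. Its diagonal may be replaced by
    powers of the uniformizer, and its lower left entry by a function that is regular
    at the other finite points, using strong approximation. *)
Lemma finite_point_frame R k : R != infty -> k \in unitmx -> exists g,
  [/\ g \in unitmx, units_of (level R 0) (invmx g *m k) &
    forall Q, Q != R -> Q != infty -> units_of (level Q 0) g].
Proof.
move=> Rf ku; have [x [y [z [x0 z0 [u uu ek]]]]] := column_reduction_at R ku.
have aR : antipode R = infty by case: R Rf {uu}.
have [x' [x'0 hx1 hx2 hx3]] := local_generator R x0.
have [z' [z'0 hz1 hz2 hz3]] := local_generator R z0.
have [y' [hy1 hy2]] := approx_away R (y * x' / x) z'0.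
have g0 := hermite_det y' x'0 z'0.
exists (mx2 x' 0 y' z'); split; first by rewrite unit_mx2.
  rewrite ek mulmxA (lower_conj x y z y' x'0 z'0).
  apply: units_ofM uu; first exact: levelM.
  apply: (units_of_level_lower (local_unif R)).
  - exact: mulf_neq0 x0 (invr_neq0 x'0).
  - exact: mulf_neq0 z0 (invr_neq0 z'0).
  - exact: hx1.
  - by rewrite invf_div; exact: hx2.
  - by rewrite (lower_entry y y' z' x0 x'0); exact: local_ringM.
  - exact: hz1.
  - by rewrite invf_div; exact: hz2.
move=> Q QR Qf; rewrite -aR in Qf.
have [a1 a2] := hx3 Q QR Qf; have [b1 b2] := hz3 Q QR Qf.
by apply: (units_of_level_lower (local_unif Q));
  [exact: x'0|exact: z'0|exact: a1|exact: a2|exact: hy2|exact: b1|exact: b2].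
Qed.


(** Membership in GL_2(F[t]), tested at each finite point. *)
Definition finite_unit g := forall Q, Q != infty -> units_of (level Q 0) g.

(** Vector bundles on the affine line are free: the points with a nontrivial frame
    are treated one after the other, since the frame found for one of them is a unit at
    the other finite points. *)
Lemma finite_points_frame (k : pt -> 'M[K]_2) : (forall R, k R \in unitmx) ->
  finite_set [set R | k R != 1%:M] -> exists2 g, g \in unitmx &
  forall R, R != infty -> units_of (level R 0) (invmx g *m k R).
Proof.
move=> ku kf.
have /finite_seqP[s es] : finite_set [set R | ~ units_of (level R 0) (k R)].
  apply: sub_finite_set kf => R /=; apply: contra_notN => /eqP ->.
  by split; rewrite ?invmx1; [exact: unitmx1|exact: (level_ring1 (local_unif R))|
    exact: (level_ring1 (local_unif R))].
have {es} : forall R, R != infty -> R \notin s -> units_of (level R 0) (k R).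
  move=> R _ Rs; apply: contrapT => h.
  have Rs' : [set` s] R by rewrite -es; exact: h.
  by move: Rs'; rewrite /= (negPf Rs).
elim: s k ku {kf} => [|P s ih] k ku hs.
  exists 1%:M; first exact: unitmx1.
  by move=> R Rf; rewrite invmx1 mul1mx; exact: hs.
have [P0|Pf] := eqVneq P infty.
  apply: ih => [|R Rf Rs]; first exact: ku.
  by apply: (hs R Rf); rewrite inE negb_or Rs andbT P0.
have [g [gu hP hg]] := finite_point_frame Pf (ku P).
have gku R : invmx g *m k R \in unitmx by rewrite unitmx_mul unitmx_inv gu; exact: ku.
have [|h hu hh] := ih (fun R => invmx g *m k R) gku.
  move=> R Rf Rs; have [->|RP] := eqVneq R P; first exact: hP.
  apply: (units_ofM (@levelM _ R 0)); first exact: (units_ofV (hg R RP Rf)).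
  by apply: (hs R Rf); rewrite inE negb_or Rs andbT.
exists (g *m h); first by rewrite unitmx_mul gu; exact: hu.
by move=> R Rf; rewrite (invmx_mul gu hu) -mulmxA; exact: hh.
Qed.

Lemma finite_unitM g h : finite_unit g -> finite_unit h -> finite_unit (g *m h).
Proof. by move=> hg hh Q Qf; apply: units_ofM; [exact: levelM|exact: hg|exact: hh]. Qed.

Lemma finite_unit_lower (s : {poly F}) : finite_unit (mx2 1 0 s%:F 1).
Proof.
case=> // p _; apply: (units_of_level_unip (local_unif (Some p)) 0).
exact: local_ring_poly.
Qed.

Lemma finite_unit_swap : finite_unit (swap_mx K).
Proof. by move=> Q _; exact: units_of_swap (local_unif Q). Qed.

Lemma polynomial_part f : exists s : {poly F}, local_ring infty ((f - s%:F) / unif infty).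
Proof.
have [a [b [b0 _ ->]]] := fracP f; exists (a %/ b)%R.
have b0' : b%:F != 0 :> K by rewrite tofrac_eq0.
exists ((a %% b)%R * 'X), b; split.
  by rewrite /unif invrK {1}(divp_eq a b) tofracD !tofracM (mulf_remainder _ _ _ b0').
rewrite b0 /=; have [->|r0] := eqVneq (a %% b)%R 0; first by rewrite mul0r size_poly0.
by rewrite size_mulX // ltn_modp.
Qed.

(** The reduction stops when z divides y - s: a column operation then makes the frame
    diagonal. *)
Lemma reduced_frame (s : {poly F}) y z : z != 0 -> local_ring infty ((y - s%:F) / z) ->
  exists g r, [/\ g \in unitmx, finite_unit g, r != 0 & exists2 c : K, c != 0 &
    exists2 u, units_of (level infty 0) u & mx2 1 0 y z = c *: (g *m mx2 1 0 0 r *m u)].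
Proof.
move=> z0 hy; exists (mx2 1 0 s%:F 1), z; split.
- exact: unit_lower.
- exact: finite_unit_lower.
- exact: z0.
exists 1; first exact: oner_neq0.
exists (mx2 1 0 ((y - s%:F) / z) 1).
  exact: (units_of_level_unip (local_unif infty) 0 hy).
by rewrite scale1r -mulmxA -(diag_factor _ z0) -lower_factor.
Qed.

(** Reduction of a binary lattice over F[t] for the valuation at infinity, after
    Gauss: subtract the polynomial part of y, exchange the rows by swap_step, repeat.
    The number n bounds the valuation of z and decreases. *)
Lemma reduction_at_infinity n y z : z != 0 -> local_ring infty (unif infty ^+ n / z) ->
  exists g r, [/\ g \in unitmx, finite_unit g, r != 0 & exists2 c : K, c != 0 &
    exists2 u, units_of (level infty 0) u & mx2 1 0 y z = c *: (g *m mx2 1 0 0 r *m u)].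
Proof.
have Ui := local_unif infty; have p0 := unif_neq0 infty.
elim: n y z => [|n ih] y z z0 hz; have [s hs] := polynomial_part y.
  have hy := local_ringM hs (local_ring_unif infty); rewrite (divfK p0) in hy.
  rewrite expr0 div1r in hz.
  exact: (reduced_frame z0 (local_ringM hy hz)).
have [hyz|hyz] := pselect (local_ring infty ((y - s%:F) / z)).
  exact: (reduced_frame z0 hyz).
have y0 : y - s%:F != 0.
  by apply: contra_not_neq hyz => ->; rewrite mul0r; exact: local_ring0.
have hzy := local_ring_val hyz; rewrite invf_div in hzy.
set y1 := y - s%:F in hs y0 hzy *.
have z1 : z / (y1 * y1) != 0 := mulf_neq0 z0 (invr_neq0 (mulf_neq0 y0 y0)).
have [|g [r [gu gf r0 [c c0 [u uu e]]]]] := ih y1^-1 (z / (y1 * y1)) z1.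
  have hw0 : y1 / unif infty != 0 := mulf_neq0 y0 (invr_neq0 p0).
  have ey : unif infty * (y1 / unif infty) = y1 by rewrite mulrC (divfK p0).
  rewrite -ey (reduce_bound n p0 z0 hw0).
  apply: local_ringM hz _; apply: local_ringM (local_ring_unif infty) _.
  exact: local_ringM.
have st := swap_step y0 z0.
have st2 := unswap_step (mx2 1 0 s%:F 1) st e.
exists (mx2 1 0 s%:F 1 *m (swap_mx K *m g)), r; split.
- by rewrite unitmx_mul unit_lower unitmx_mul swap_unit; exact: gu.
- apply: finite_unitM; first exact: finite_unit_lower.
  by apply: finite_unitM gf; exact: finite_unit_swap.
- exact: r0.
exists (y1 * c); first exact: (mulf_neq0 y0 c0).
exists (u *m mx2 1 (z / y1) 0 (-1)).
  apply: (units_ofM (@levelM _ infty 0) uu).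
  exact: (units_of_level0_reflection Ui hzy).
by rewrite (lower_factor s%:F y z); exact: st2.
Qed.

End GlobalReduction.

(** * Vector bundles of rank two *)

Section GlobalFrame.
Variable F : finFieldType.
Local Notation K := 'K_F.
Local Notation pt := (closed_point F).
Local Notation infty := (None : pt).
Implicit Types (A B u g : 'M[K]_2) (P Q R : pt) (x y z f r c : K) (n : nat) (s : {poly F}).

(** The frame of O + O(n), trivial on the affine line. *)
Definition twisting_frame n R : 'M[K]_2 :=
  if R is None then mx2 1 0 0 (unif infty ^+ n) else 1%:M.

Lemma twisting_frame_unit n R : twisting_frame n R \in unitmx.
Proof.
by case: R => [p|]; [exact: unitmx1|exact: diag_unit (unifX_neq0 infty n)].
Qed.

(** Up to a unit r is a power of the uniformizer; when r has a pole at infinity, the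
    two summands are exchanged. *)
Lemma diag_normal_form r : r != 0 -> exists g n c, [/\ g \in unitmx, finite_unit g, c != 0 &
  exists2 u, units_of (level infty 0) u &
    mx2 1 0 0 r = c *: (g *m mx2 1 0 0 (unif infty ^+ n) *m u)].
Proof.
have integral_case t : t != 0 -> local_ring infty t -> exists n,
    exists2 u, units_of (level infty 0) u &
    mx2 1 0 0 t = mx2 1 0 0 (unif infty ^+ n) *m u.
  move=> t0 ht; have [n [h1 h2]] := local_ring_order t0 ht.
  have pn := unifX_neq0 infty n; have e0 := mulf_neq0 t0 (invr_neq0 pn).
  exists n, (mx2 1 0 0 (t / unif infty ^+ n)); last exact: (diag_split t pn).
  apply: (units_of_level_diag (local_unif infty) 0 e0 h1).
  by rewrite invf_div; exact: h2.
move=> r0; have [hr|hr] := pselect (local_ring infty r).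
  have [n [u uu e]] := integral_case r r0 hr.
  exists 1%:M, n, 1; split; [exact: unitmx1| |exact: oner_neq0|].
    by move=> Q _; split; rewrite ?invmx1; [exact: unitmx1| |];
      exact: (level_ring1 (local_unif Q) 0).
  by exists u; [exact: uu|rewrite e scale1r mul1mx].
have hr' := local_ring_val hr.
have [n [u uu e]] := integral_case _ (invr_neq0 r0) hr'.
exists (swap_mx K), n, r; split; [exact: swap_unit|exact: finite_unit_swap|exact: r0|].
exists (u *m swap_mx K).
  exact: (units_ofM (@levelM _ infty 0) uu (units_of_swap (local_unif infty))).
by rewrite (diag_swap r0) e !mulmxA.
Qed.

(** Grothendieck's theorem for rank two: trivialize the bundle on the affine line, then
    reduce its frame at infinity. The scalars c are a twist by a line bundle and do
    not affect endomorphisms. *)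
Lemma global_frame (k : pt -> 'M[K]_2) : (forall R, k R \in unitmx) ->
  finite_set [set R | k R != 1%:M] -> exists g n (c : pt -> K) (u : pt -> 'M[K]_2),
  g \in unitmx /\ forall R, [/\ c R != 0, units_of (level R 0) (u R) &
    k R = c R *: (g *m twisting_frame n R *m u R)].
Proof.
move=> ku kf; have [g1 gu1 h1] := finite_points_frame ku kf.
have k1u : invmx g1 *m k infty \in unitmx by rewrite unitmx_mul unitmx_inv gu1; exact: ku.
have [x [y [z [x0 z0 [v1 vu1 e1]]]]] := column_reduction_at infty k1u.
have z1 : z / x != 0 := mulf_neq0 z0 (invr_neq0 x0).
have [n0 hn0] := local_ring_bounded infty (z / x)^-1.
have [g2 [r [gu2 gf2 r0 [c2 c20 [v2 vu2 e2]]]]] := reduction_at_infinity (y / x) z1 hn0.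
have [g3 [n [c3 [gu3 gf3 c30 [v3 vu3 e3]]]]] := diag_normal_form r0.
have LM := @levelM _ infty 0.
have g23 : finite_unit (g2 *m g3) by exact: finite_unitM.
have gu23 : g2 *m g3 \in unitmx by rewrite unitmx_mul gu2; exact: gu3.
pose c R := if R is None then x * c2 * c3 else 1.
pose u R := if R is None then v3 *m v2 *m v1 else invmx (g2 *m g3) *m (invmx g1 *m k R).
exists (g1 *m (g2 *m g3)), n, c, u; split; first by rewrite unitmx_mul gu1; exact: gu23.
case=> [p|]; split.
- exact: oner_neq0.
- have pf : Some p != infty by [].
  exact: (units_ofM (@levelM _ (Some p) 0) (units_ofV (g23 _ pf)) (h1 _ pf)).
- by rewrite /c /u /= scale1r mulmx1 -mulmxA (mulKVmx gu23) (mulKVmx gu1).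
- exact: mulf_neq0 (mulf_neq0 x0 c20) c30.
- exact: units_ofM LM (units_ofM LM vu3 vu2) vu1.
rewrite -(mulKVmx gu1 (k infty)) e1 (lower_scale y z x0) e2 e3 /c /u /=.
exact: scale_assoc.
Qed.

End GlobalFrame.

(** * Rational points and lines *)

Section RationalPoints.
Variable F : finFieldType.
Local Notation K := 'K_F.
Local Notation pt := (closed_point F).
Local Notation infty := (None : pt).
Implicit Types (A B u g : 'M[K]_2) (P Q R : pt) (f t : K) (n : nat) (s : {poly F}) (x y c : F).

Lemma rational_pointP P : point_degree P = 1%N -> P = infty \/ exists c, P = point_at c.
Proof.
case: P => [p|] /=; last by left.
move=> dp; right; exists (- (val p)`_0); congr Some; apply: val_inj => /=.
have sp : size (val p) = 2%N by move: dp; case: (size (val p)) => [|[|[|]]].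
have mp : val p \is monic by case/andP: (valP p).
apply/polyP => i; rewrite polyCN opprK coefD coefX coefC.
case: i => [|[|i]] /=; rewrite ?addr0 ?add0r //.
  by move/monicP: mp; rewrite lead_coefE sp.
by rewrite nth_default // sp.
Qed.

(** A section s of O(n), that is, a polynomial of degree at most n, in the local
    frame at R. *)
Definition local_section n s R : K :=
  if R is None then s%:F * unif infty ^+ n else s%:F.

Lemma local_section_int n s R : (size s <= n.+1)%N -> local_ring R (local_section n s R).
Proof.
case: R => [p|] hs /=; first exact: local_ring_poly.
by rewrite exprVn; exact: local_ring_infty.
Qed.

Lemma twisting_frame_upper n s R :
  invmx (twisting_frame n R) *m (invmx (mx2 1 s%:F 0 1) *m twisting_frame n R) =
  mx2 1 (- local_section n s R) 0 1.
Proof.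
rewrite upper_inv mulmxA; case: R => [p|] /=.
  by rewrite invmx1 mul1mx mulmx1.
by rewrite (conj_diag _ (unifX_neq0 infty n)) !mx2E mul0r mulNr.
Qed.

Lemma residue_point_at s c :
  local_ring (point_at c) ((s%:F - s.[c]%:P%:F) / unif (point_at c)).
Proof.
have /factor_theorem[q e] : root (s - s.[c]%:P) c.
  by rewrite /root hornerD hornerN hornerC subrr.
rewrite -tofracB e tofracM /= mulfK; last exact: unif_neq0 (point_at c).
exact: local_ring_poly.
Qed.

Lemma residue_infty n s : (size s <= n.+1)%N ->
  local_ring infty ((s%:F * unif infty ^+ n - (s`_n)%:P%:F) / unif infty).
Proof.
move=> hs; have x0 : 'X%:F != 0 :> K by rewrite tofrac_eq0 polyX_eq0.
have -> : (s%:F * unif infty ^+ n - (s`_n)%:P%:F) / unif infty =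
    ((s - (s`_n)%:P * 'X^n) * 'X)%:F / 'X%:F ^+ n.
  by rewrite tofracM tofracB tofracM tofracXn /= exprVn (infty_shift _ _ _ x0).
apply: local_ring_infty.
set a := s - _; have [->|a0] := eqVneq a 0; first by rewrite mul0r size_poly0.
rewrite size_mulX // ltnS; apply/leq_sizeP => j; rewrite leq_eqVlt => /predU1P[<-|nj].
  by rewrite /a coefB coefCM coefXn eqxx mulr1 subrr.
rewrite /a coefB coefCM coefXn (gtn_eqF nj) mulr0 subr0 nth_default //.
exact: leq_trans hs nj.
Qed.

(** The value at infinity of a section of O(n) is its coefficient of t^n. Thus a
    monomial plus a constant serves infinity and a finite point, and a polynomial of
    degree one serves two finite points. *)
Lemma interpolation n P Q x y : point_degree P = 1%N -> point_degree Q = 1%N -> P != Q ->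
  (0 < n)%N \/ x = y -> exists s, [/\ (size s <= n.+1)%N,
    local_ring P ((local_section n s P - x%:P%:F) / unif P) &
    local_ring Q ((local_section n s Q - y%:P%:F) / unif Q)].
Proof.
have point_value s c x' : s.[c] = x' ->
    local_ring (point_at c) ((local_section n s (point_at c) - x'%:P%:F) / unif (point_at c)).
  by move=> <-; exact: residue_point_at.
have infty_value s x' : (size s <= n.+1)%N -> s`_n = x' ->
    local_ring infty ((local_section n s infty - x'%:P%:F) / unif infty).
  by move=> hs <-; exact: residue_infty.
case: n point_value infty_value => [|n] pv iv dP dQ PQ hn.
  have {hn} -> : y = x by case: hn.
  exists x%:P; have sx : (size x%:P <= 1)%N by rewrite size_polyC; case: (_ == _).
  split; first exact: sx.
    case: (rational_pointP dP) => [->|[c ->]]; first by apply: iv => //; rewrite coefC.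
    by apply: pv; rewrite hornerC.
  case: (rational_pointP dQ) => [->|[c ->]]; first by apply: iv => //; rewrite coefC.
  by apply: pv; rewrite hornerC.
have leading (x' y' : F) (s := x'%:P * 'X^(n.+1) + y'%:P : {poly F}) :
    (size s <= n.+2)%N /\ s`_n.+1 = x'.
  split; last by rewrite /s coefD coefCM coefXn eqxx mulr1 coefC addr0.
  rewrite (leq_trans (size_polyD _ _)) // geq_max.
  rewrite (leq_trans (size_polyMleq _ _)) ?size_polyXn ?size_polyC; last first.
    by case: (_ == _).
  by case: (_ == _).
case: (rational_pointP dP) PQ => [->|[c ->]] PQ; case: (rational_pointP dQ) PQ => [->|[d ->]] PQ.
- by rewrite eqxx in PQ.
- have [sl cl] := leading x (y - x * d ^+ n.+1).
  exists (x%:P * 'X^(n.+1) + (y - x * d ^+ n.+1)%:P); split; [exact: sl|exact: iv|].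
  by apply: pv; rewrite hornerD hornerM !hornerC hornerXn addrC subrK.
- have [sl cl] := leading y (x - y * c ^+ n.+1).
  exists (y%:P * 'X^(n.+1) + (x - y * c ^+ n.+1)%:P); split; [exact: sl| |exact: iv].
  by apply: pv; rewrite hornerD hornerM !hornerC hornerXn addrC subrK.
have dc : d - c != 0.
  by rewrite subr_eq0; apply: contra_neq PQ => ->.
exists (x%:P + ((y - x) / (d - c))%:P * ('X - c%:P)); split.
- rewrite (leq_trans (size_polyD _ _)) // geq_max size_polyC.
  rewrite (leq_trans (size_polyMleq _ _)) ?size_XsubC ?size_polyC.
    by case: (_ == _).
  by case: (_ == _).
- by apply: pv; rewrite hornerD hornerM !hornerC hornerXsubC subrr mulr0 addr0.
by apply: pv; rewrite hornerD hornerM !hornerC hornerXsubC divfK // addrC subrK.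
Qed.

Definition swap_if (e : bool) : 'M[K]_2 := if e then swap_mx K else 1%:M.

(** The coset is determined by the second column modulo P, which spans the line (1 : 0)
    or a line (x : 1). *)
Lemma Iwahori_coset R u : point_degree R = 1%N -> units_of (level R 0) u ->
  units_of (level R 1) (swap_mx K *m u) \/
  exists x, units_of (level R 1) (mx2 1 (- x%:P%:F) 0 1 *m u).
Proof.
move=> dR uu; have U := local_unif R; have [_ /level_ring0P hu _] := uu.
have LM := @levelM _ R 0.
have near_infty : local_ring R (u 1 1 / unif R) ->
    units_of (level R 1) (swap_mx K *m u).
  move=> h; apply: (units_of_level_raise U); first exact: (units_ofM LM (units_of_swap U) uu).
  by rewrite mulmx2E !mx2E mul0r mul1r add0r expr1.
have [u0|u0] := eqVneq (u 1 1) 0.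
  by left; apply: near_infty; rewrite u0 mul0r; exact: local_ring0.
have [h|h] := local_ring_unit_or (hu 1 1); last by left; exact: near_infty.
right; have [r [sr hr]] := residue_poly (local_ringM (hu 0 1) h).
have [x er] : exists x, r = x%:P by exists r`_0; apply: size1_polyC; rewrite -dR.
exists x; rewrite er in hr; apply: (units_of_level_raise U).
  apply: (units_ofM LM _ uu); apply: (units_of_level_upper U).
  by rewrite expr0 divr1; apply: local_ringN; exact: local_ring_const.
rewrite mulmx2E !mx2E mul1r expr1 mulNr.
have := local_ringM hr (hu 1 1).
by rewrite (residue_entry (u 0 1) x%:P%:F (unif R) u0).
Qed.

(** An upper unipotent matrix fixes the line (1 : 0) and translates the others, here
    from x to 0. *)
Lemma move_line R (e : bool) x t u : local_ring R t -> local_ring R ((t - x%:P%:F) / unif R) ->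
  (if e then units_of (level R 1) (swap_mx K *m u)
   else units_of (level R 1) (mx2 1 (- x%:P%:F) 0 1 *m u)) ->
  units_of (level R 1) (swap_if e *m (mx2 1 (- t) 0 1 *m u)).
Proof.
move=> ht hx; have U := local_unif R; have LM := @levelM _ R 1.
case: e => h /=; rewrite /swap_if.
  rewrite swap_upper; apply: (units_ofM LM _ h).
  exact: (units_of_level_unip U 1 (local_ringN ht)).
rewrite mul1mx (upper_split x%:P%:F); apply: (units_ofM LM _ h).
apply: (units_of_level_upper U); rewrite expr1.
by have := local_ringN hx; rewrite -mulNr opprB.
Qed.

End RationalPoints.

(** * Lines at two rational points *)

Section Splitting.
Variable F : finFieldType.
Local Notation K := 'K_F.
Local Notation pt := (closed_point F).
Local Notation infty := (None : pt).
Implicit Types (A B u g : 'M[K]_2) (P Q R : pt) (f t : K) (n : nat) (s : {poly F}) (x y c : F).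

Lemma line_at R u : point_degree R = 1%N -> units_of (level R 0) u ->
  exists e : bool, exists x, if e then units_of (level R 1) (swap_mx K *m u)
   else units_of (level R 1) (mx2 1 (- x%:P%:F) 0 1 *m u).
Proof.
move=> dR uu; case: (Iwahori_coset dR uu) => [h|[x h]]; first by exists true, 0.
by exists false, x.
Qed.

Lemma polyC_inv c : c != 0 -> c%:P%:F^-1 = c^-1%:P%:F :> K.
Proof.
move=> c0; have cF : c%:P%:F != 0 :> K by rewrite tofrac_eq0 polyC_eq0.
by apply: (mulfI cF); rewrite mulfV // -tofracM -polyCM mulfV.
Qed.

(** If n > 0, a unipotent automorphism of O + O(n) moves the lines at P and Q to the
    axes, by interpolation. If n = 0, the fibres of the bundle at P and Q are the same
    plane F^2; a constant unipotent matrix suffices unless the lines are distinct and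
    both different from (1 : 0), in which case they are a basis of the plane. *)
Lemma adjust_lines n (u : pt -> 'M[K]_2) P Q :
  point_degree P = 1%N -> point_degree Q = 1%N -> P != Q ->
  (forall R, units_of (level R 0) (u R)) ->
  exists g (e : pt -> bool), g \in unitmx /\ forall R,
    units_of (level R ((R == P) || (R == Q)))
      (swap_if F (e R) *m (invmx (twisting_frame n R) *m
        (invmx g *m (twisting_frame n R *m u R)))).
Proof.
move=> dP dQ PQ hu.
have [eP [x lP]] := line_at dP (hu P); have [eQ [y lQ]] := line_at dQ (hu Q).
have [[n0 eP0 eQ0 xy]|compat] : [/\ n = 0%N, eP = false, eQ = false & y - x != 0] \/
    exists x' y', [/\ (0 < n)%N \/ x' = y',
      if eP then units_of (level P 1) (swap_mx K *m u P)
      else units_of (level P 1) (mx2 1 (- x'%:P%:F) 0 1 *m u P) &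
      if eQ then units_of (level Q 1) (swap_mx K *m u Q)
      else units_of (level Q 1) (mx2 1 (- y'%:P%:F) 0 1 *m u Q)].
- case: (posnP n) => n0; last first.
    by right; exists x, y; split; [left|exact: lP|exact: lQ].
  case: eP lP => lP.
    by right; exists y, y; split; [right|exact: lP|exact: lQ].
  case: eQ lQ => lQ.
    by right; exists x, x; split; [right|exact: lP|exact: lQ].
  have [xy|xy] := eqVneq x y.
    by rewrite -xy in lQ; right; exists x, x; split; [right|exact: lP|exact: lQ].
  by left; split; [exact: n0|reflexivity|reflexivity|rewrite subr_eq0 eq_sym].
- rewrite eP0 in lP; rewrite eQ0 in lQ; rewrite n0.
  have d0 : y%:P%:F - x%:P%:F != 0 :> K.
    by rewrite -tofracB -polyCB tofrac_eq0 polyC_eq0.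
  have di : (y%:P%:F - x%:P%:F)^-1 = (y - x)^-1%:P%:F :> K.
    by rewrite -tofracB -polyCB polyC_inv.
  have d1 : (y%:P%:F - x%:P%:F)^-1^-1 = (y - x)%:P%:F :> K.
    by rewrite invrK polyCB tofracB.
  have t1 R : twisting_frame 0 R = 1%:M.
    by case: R => [p|] //=; rewrite mx2_1.
  exists (mx2 y%:P%:F x%:P%:F 1 1), (fun R => R == Q); split.
    by rewrite unit_mx2 !mulr1.
  move=> R; rewrite t1 invmx1 !mul1mx.
  have U := local_unif R; have cst (c : F) : local_ring R c%:P%:F by exact: local_ring_const.
  have di0 := invr_neq0 d0.
  have cd : local_ring R (y%:P%:F - x%:P%:F)^-1 by rewrite di; exact: cst.
  have cd1 : local_ring R (y%:P%:F - x%:P%:F)^-1^-1 by rewrite d1; exact: cst.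
  have l1 := local_ring1 R; have l1' : local_ring R 1^-1 by rewrite invr1; exact: l1.
  have [RQ|RQ] := eqVneq R Q.
    rewrite orbT /= /swap_if (two_lines_second (u R) d0).
    apply: (units_ofM (@levelM _ R 1)); last by rewrite RQ; exact: lQ.
    apply: (units_of_level_lower U).
    - by rewrite oppr_eq0; exact: di0.
    - exact: oner_neq0.
    - exact: local_ringN cd.
    - by rewrite invrN; exact: local_ringN cd1.
    - exact: cd.
    - exact: l1.
    - exact: l1'.
  rewrite orbF /swap_if mul1mx; have [RP|RP] := eqVneq R P.
    rewrite /= (two_lines_first (u R) d0).
    apply: (units_ofM (@levelM _ R 1)); last by rewrite RP; exact: lP.
    apply: (units_of_level_lower U).
    - exact: di0.
    - exact: oner_neq0.
    - exact: cd.
    - exact: cd1.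
    - exact: local_ringN cd.
    - exact: l1.
    - exact: l1'.
  apply: (units_ofM (@levelM _ R 0) _ (hu R)); apply: units_ofV.
  have dE : y%:P%:F * 1 - x%:P%:F * 1 = y%:P%:F - x%:P%:F :> K by rewrite !mulr1.
  apply: (units_of_level_mx2 U).
  - exact: cst.
  - by rewrite expr0 divr1; exact: cst.
  - exact: l1.
  - exact: l1.
  - by rewrite dE; exact: d0.
  - by rewrite dE; exact: cd.
have [x' [y' [nxy lP' lQ']]] := compat.
have [s [ss sP sQ]] := interpolation dP dQ PQ nxy.
exists (mx2 1 s%:F 0 1), (fun R => if R == P then eP else if R == Q then eQ else false).
split; first exact: upper_unit.
move=> R.
have -> : invmx (twisting_frame n R) *m (invmx (mx2 1 s%:F 0 1) *m
    (twisting_frame n R *m u R)) = mx2 1 (- local_section n s R) 0 1 *m u R.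
  by rewrite !mulmxA -(mulmxA (invmx _) (invmx _)) twisting_frame_upper.
have hs := local_section_int R ss.
have [RP|RP] := eqVneq R P; first by rewrite RP in hs *; exact: move_line hs sP lP'.
have [RQ|RQ] := eqVneq R Q; first by rewrite RQ in hs *; exact: move_line hs sQ lQ'.
rewrite /swap_if mul1mx; apply: (units_ofM (@levelM _ R 0) _ (hu R)).
apply: (units_of_level_upper (local_unif R)); rewrite expr0 divr1.
exact: local_ringN.
Qed.

Definition twist_ratio n R : K := if R is None then unif infty ^+ n else 1.

Lemma twisting_frameE n R : twisting_frame n R = mx2 1 0 0 (twist_ratio n R).
Proof. by case: R => [p|] //=; rewrite mx2_1. Qed.

Lemma twist_ratio_neq0 n R : twist_ratio n R != 0.
Proof. by case: R => [p|]; [exact: oner_neq0|exact: (unifX_neq0 infty n)]. Qed.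

(** In a monomial frame the order is given by conditions on the single entries,
    (O, c1 O; c2 O, O) with the c1 and c2 that appear here. *)
Lemma monomial_level n d R (e : bool) B :
  let r := twist_ratio n R in
  let p := unif R ^+ d in
  twist (mx2 1 0 0 r *m swap_if F e) (level R d) B <->
  [/\ local_ring R (B 0 0), local_ring R (B 0 1 / (if e then r^-1 else p / r)),
      local_ring R (B 1 0 / (if e then p * r else r)) & local_ring R (B 1 1)].
Proof.
move=> r p; have r0 : r != 0 := twist_ratio_neq0 n R.
have p0 : p != 0 := unifX_neq0 R d.
case: e; rewrite /swap_if.
  rewrite (twistM _ (diag_unit r0) (swap_unit K)) /twist /= (conj_diag _ r0) swap_inv.
  rewrite swap_conj /level_ring /= !mx2E invrK [p * r]mulrC -mulf_divAC.
  by split=> -[h1 h2 h3 h4]; split.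
rewrite mulmx1 /twist /= (conj_diag _ r0) /level_ring /= !mx2E.
have -> : B 0 1 / (p / r) = B 0 1 * r / p by rewrite mulf_divA [r * _]mulrC.
by split=> -[h1 h2 h3 h4]; split.
Qed.

End Splitting.

(** * Split Eichler orders *)

Section FrameChange.
Variable L : fieldType.
Implicit Types (c : L) (g h d u w k : 'M[L]_2) (S : set 'M[L]_2).

Lemma twist_scale c h S : c != 0 -> h \in unitmx -> twist (c *: h) S = twist h S.
Proof.
move=> c0 hu.
have e : invmx (c *: h) = c^-1 *: invmx h.
  have [//|_ -> //] := @invmx_unique _ (c *: h) (c^-1 *: invmx h) _.
  by rewrite -scalemxAl -scalemxAr scalerA mulfV // scale1r mulmxV.
apply/funext => A; rewrite /twist /= e.
by rewrite -scalemxAr -!scalemxAl scalerA mulfV // scale1r.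
Qed.

(** Scalars centralize and units of S normalize S. *)
Lemma frame_change c g h d u w k S : mul_closed S -> c != 0 -> g \in unitmx ->
  h \in unitmx -> d \in unitmx -> w \in unitmx -> w *m w = 1%:M ->
  k = c *: (g *m d *m u) -> units_of S (w *m (invmx d *m (invmx h *m (d *m u)))) ->
  twist k S = twist (g *m h) (twist (d *m w) S).
Proof.
move=> SM c0 gu hu du wu ww -> uv; set v := w *m _ in uv.
have [vu _ _] := uv.
have e : g *m d *m u = g *m h *m (d *m w) *m v.
  by rewrite /v !mulmxA -(mulmxA _ w w) ww mulmx1 mulmxK // mulmxK.
clearbody v; rewrite e twist_scale ?unitmx_mul ?gu ?hu ?du ?wu ?vu //.
by rewrite !twistM ?unitmx_mul ?gu ?hu ?du ?wu ?vu // (twist_unit SM uv).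
Qed.

End FrameChange.

Section SplitOrders.
Variable F : finFieldType.
Local Notation K := 'K_F.
Local Notation pt := (closed_point F).
Local Notation infty := (None : pt).
Implicit Types (P Q R : pt) (D : pt -> nat).

Lemma point_degree_antipode P : point_degree (antipode P) = 1%N.
Proof. by case: P => [p|] //=; rewrite size_XsubC. Qed.

(** Only an upper bound of D matters for the splitting, so that the support can be
    enlarged to two points. *)
Lemma two_rational_points D : is_sum_of_at_most_two_rational_points D ->
  exists P Q, [/\ P != Q, point_degree P = 1%N, point_degree Q = 1%N &
    forall R, (D R <= ((R == P) || (R == Q)))%N].
Proof.
move=> [s [us ss ds eD]].
case: s us ss ds eD => [|P [|Q [|//]]] us _ ds eD.
- exists infty, (antipode infty); split=> //; first by rewrite point_degree_antipode.
  by move=> R; rewrite eD big_nil.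
- exists P, (antipode P); split.
  + by rewrite eq_sym antipode_neq.
  + by move: ds => /= /andP[/eqP].
  + exact: point_degree_antipode.
  by move=> R; rewrite eD big_seq1; case: (R == P).
exists P, Q; move: us ds; rewrite /= inE andbT => PQ /and3P[/eqP dP /eqP dQ _].
split=> // R; rewrite eD big_cons big_seq1.
have [->|] := eqVneq R P; first by rewrite (negPf PQ).
by case: (R == Q).
Qed.

Lemma swap_if_unit (e : bool) : swap_if F e \in unitmx /\ swap_if F e *m swap_if F e = 1%:M.
Proof.
by case: e; split; [exact: swap_unit|exact: swap_mxK|exact: unitmx1|exact: mul1mx].
Qed.

(** A single frame over K, with a monomial matrix at each point, presents the bundle
    and its lines; monomial_level then describes the order entry by entry. *)
Theorem split_of_two_points D E : is_effective_divisor D ->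
  is_sum_of_at_most_two_rational_points D -> is_Eichler_order_of_level D E -> is_split E.
Proof.
move=> fD /two_rational_points[P [Q [PQ dP dQ hD]]] /(Eichler_frame fD)[k [ku kf eE]].
have [g [n [c [u [gu hg]]]]] := global_frame ku kf.
have hu R : units_of (level R 0) (u R) by have [] := hg R.
have [h [e [hu' he]]] := adjust_lines n dP dQ PQ hu.
have ghu : g *m h \in unitmx by rewrite unitmx_mul gu; exact: hu'.
pose r R := twist_ratio n R; pose p R := unif R ^+ D R.
pose c1 R := if e R then (r R)^-1 else p R / r R.
pose c2 R := if e R then p R * r R else r R.
have r0 R : r R != 0 := twist_ratio_neq0 n R.
have p0 R : p R != 0 := unifX_neq0 R (D R).
have c10 R : c1 R != 0.
  by rewrite /c1; case: (e R); [exact: invr_neq0 (r0 R)|exact: mulf_neq0 (p0 R) (invr_neq0 (r0 R))].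
have c20 R : c2 R != 0.
  by rewrite /c2; case: (e R); [exact: mulf_neq0 (p0 R) (r0 R)|exact: r0].
have trivial_frame R : ~ (infty |` [set R | D R != 0%N]) R -> r R = 1 /\ p R = 1.
  move=> /not_orP[Rf /negP/negPn/eqP DR]; split; last by rewrite /p DR expr0.
  by case: R Rf {DR} => [q|] // [].
have ffin : finite_set (infty |` [set R | D R != 0%N]).
  by rewrite finite_setU; split; [exact: finite_set1|exact: fD].
have f1 : finite_set [set R | c1 R != 1].
  apply: sub_finite_set ffin => R /=; apply: contraPP => /trivial_frame[rR pR].
  by rewrite /c1 rR pR divr1 invr1 if_same eqxx.
have f2 : finite_set [set R | c2 R != 1].
  apply: sub_finite_set ffin => R /=; apply: contraPP => /trivial_frame[rR pR].
  by rewrite /c2 rR pR mulr1 if_same eqxx.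
exists (g *m h), (@stalkwise F K^o (fun P => [set f | local_ring P (f / c1 P)])),
  (@stalkwise F K^o (fun P => [set f | local_ring P (f / c2 P)])); split.
- exact: ghu.
- exact (line_bundle_invertible c10 f1).
- exact (line_bundle_invertible c20 f2).
have local R : twist (k R) (level R (D R)) =
    twist (g *m h) (twist (mx2 1 0 0 (r R) *m swap_if F (e R)) (level R (D R))).
  have [cR _ ek] := hg R; have [wu ww] := swap_if_unit (e R).
  rewrite -twisting_frameE.
  apply: (frame_change (@levelM _ R (D R)) cR gu hu' (twisting_frame_unit n R) wu ww ek).
  exact: (units_of_level_le (local_unif R) (hD R) (he R)).
move=> U oU; rewrite (eE U oU) (conj_setE _ ghu); apply/seteqP; split=> A hA.
  split=> R UR; have := hA R UR; rewrite local => /monomial_level[h1 h2 h3 h4].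
  - exact: h1.
  - exact: h2.
  - exact: h3.
  - exact: h4.
case: hA => h1 h2 h3 h4 R UR; rewrite local; apply/monomial_level.
by split; [exact: h1|exact: h2|exact: h3|exact: h4].
Qed.

End SplitOrders.

(** * Idempotents and Eichler orders defined by lines *)

Section IdempotentAlgebra.
Variable L : fieldType.
Implicit Types (a b c d u x : L) (e g : 'M[L]_2).

Lemma idempotent_entries a b c d : a * a + b * c = a -> a * b + b * d = b ->
  c * a + d * c = c -> c * b + d * d = d ->
  [\/ a + d = 1, mx2 a b c d = mx2 0 0 0 0 | mx2 a b c d = mx2 1 0 0 1].
Proof.
move=> h00 h01 h10 h11; have [|t] := eqVneq (a + d - 1) 0.
  by move/eqP; rewrite subr_eq0 => /eqP; constructor 1.
have tb : b * (a + d - 1) = 0.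
  have -> : b * (a + d - 1) = (a * b + b * d) - b by ring.
  by rewrite h01 subrr.
have tc : c * (a + d - 1) = 0.
  have -> : c * (a + d - 1) = (c * a + d * c) - c by ring.
  by rewrite h10 subrr.
have b0 : b = 0 by move/eqP: tb; rewrite mulf_eq0 (negPf t) orbF => /eqP.
have c0 : c = 0 by move/eqP: tc; rewrite mulf_eq0 (negPf t) orbF => /eqP.
have idem x : x * x = x -> x = 0 \/ x = 1.
  move=> hx; have /eqP : x * (x - 1) = 0 by rewrite mulrBr hx mulr1 subrr.
  by rewrite mulf_eq0 subr_eq0 => /orP[] /eqP; [left|right].
have [a0|a1] : a = 0 \/ a = 1 by apply: idem; rewrite -[RHS]h00 b0 mul0r addr0.
  have [d0|d1] : d = 0 \/ d = 1 by apply: idem; rewrite -[RHS]h11 b0 mulr0 add0r.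
    by constructor 2; rewrite a0 b0 c0 d0.
  by constructor 1; rewrite a0 d1 add0r.
have [d0|d1] : d = 0 \/ d = 1 by apply: idem; rewrite -[RHS]h11 b0 mulr0 add0r.
  by constructor 1; rewrite a1 d0 addr0.
by constructor 3; rewrite a1 b0 c0 d1.
Qed.

Lemma idempotent_det a b c d : a + d = 1 -> a * a + b * c = a -> b * c = a * d.
Proof.
move=> tr h; have -> : d = 1 - a by rewrite -tr addrC addKr.
have -> : b * c = a - a * a by rewrite -{1}h addrC addKr.
by ring.
Qed.

Lemma idempotent_trace_det e : e *m e = e -> e != 0 -> e != 1%:M ->
  e 0 0 + e 1 1 = 1 /\ e 0 1 * e 1 0 = e 0 0 * e 1 1.
Proof.
move=> ee e0 e1; have E i j : e i 0 * e 0 j + e i 1 * e 1 j = e i j.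
  by rewrite -mulmx2E ee.
case: (idempotent_entries (E 0 0) (E 0 1) (E 1 0) (E 1 1)) => [tr||].
- by split; [exact: tr|exact: (idempotent_det tr (E 0 0))].
- rewrite -mx2_eta => z; case/negP: e0; apply/eqP; rewrite z.
  by apply: mx2P; rewrite mx2E mxE.
by rewrite -mx2_eta mx2_1 => z; case/negP: e1; apply/eqP.
Qed.

Lemma conj_upper u e :
  (invmx (mx2 1 u 0 1) *m e *m mx2 1 u 0 1) 0 1 =
  (e 0 0 - u * e 1 0) * u + (e 0 1 - u * e 1 1).
Proof. rewrite upper_inv {1}(mx2_eta e) !mulmx2 !mx2E.
by move: (e 0 0) (e 0 1) (e 1 0) (e 1 1) => a b c d; ring. Qed.

(** An idempotent of rank one fixes the line (u : 1) if and only if it is its kernel or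
    its image, which accounts for the two factors. They differ by 1. *)
Lemma idempotent_eigenline u a b c d : a + d = 1 -> b * c = a * d ->
  c * ((a - u * c) * u + (b - u * d)) = - ((c * u - a) * (c * u - a + 1)).
Proof.
move=> tr dt; have ed : d = 1 - a by rewrite -tr addrC addKr.
rewrite ed in dt *.
have -> : c * ((a - u * c) * u + (b - u * (1 - a))) =
  c * a * u - u * u * c * c + b * c - c * u * (1 - a) by ring.
by rewrite dt; ring.
Qed.

Lemma eigen_entry a b d u : (a - u * 0) * u + (b - u * d) = (a - d) * u + b.
Proof. by ring. Qed.

Lemma infty_square a b x : x != 0 ->
  (a * x^-1 + b) / x^-1 ^+ 2 = (b * x + a) * x.
Proof. by move=> x0; rewrite exprVn invrK expr2; field. Qed.

Lemma rank_one_idempotent g : g \in unitmx -> let e := g *m mx2 1 0 0 0 *m invmx g in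
  [/\ e *m e = e, e != 0 & e != 1%:M].
Proof.
move=> gu e.
have conj : invmx g *m e *m g = mx2 1 0 0 0 by rewrite /e !mulmxA mulVmx // mul1mx mulmxKV.
split.
- rewrite /e !mulmxA mulmxKV // -(mulmxA g).
  by rewrite mulmx2 !(mulr0, mul0r, mulr1, addr0).
- apply: contra_eq_neq conj => ->; rewrite mulmx0 mul0mx; apply/eqP => /matrixP/(_ 0 0)/eqP.
  by rewrite !mxE /= eq_sym oner_eq0.
apply: contra_eq_neq conj => ->; rewrite mulmx1 mulVmx //; apply/eqP => /matrixP/(_ 1 1)/eqP.
by rewrite !mxE /= oner_eq0.
Qed.

End IdempotentAlgebra.

Section NonSplit.
Variable F : finFieldType.
Local Notation K := 'K_F.
Local Notation pt := (closed_point F).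
Local Notation infty := (None : pt).
Implicit Types (P Q R : pt) (D : pt -> nat) (f t : K) (n : nat).

(** The second column of k_P spans a line modulo P^D(P). The second maximal order
    consists of the endomorphisms of the subsheaf of the trivial bundle formed by the
    sections whose values modulo P^D(P) lie in these lines. *)
Lemma Eichler_of_lines D (k : pt -> 'M[K]_2) : is_effective_divisor D ->
  (forall P, units_of (level P 0) (k P)) -> finite_set [set P | k P != 1%:M] ->
  is_Eichler_order_of_level D (stalkwise (fun P => twist (k P) (level P (D P)))).
Proof.
move=> fD hk kf; have ku P : k P \in unitmx by have [] := hk P.
pose d P : 'M[K]_2 := mx2 1 0 0 (unif P ^- D P).
have d0 P : unif P ^- D P != 0 := invr_neq0 (unifX_neq0 P (D P)).
have du P : d P \in unitmx := diag_unit (d0 P).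
have hu P : k P *m d P \in unitmx by rewrite unitmx_mul ku; exact: du.
have hf : finite_set [set P | k P *m d P != 1%:M].
  apply: (@sub_finite_set _ _ ([set P | k P != 1%:M] `|` [set P | D P != 0%N])).
    move=> P; rewrite /setU /=; apply: contraPP => /not_orP[/negP/negPn/eqP kP].
    by move=> /negP/negPn/eqP DP; rewrite kP /d DP expr0 invr1 mx2_1 mulmx1 eqxx.
  by rewrite finite_setU; split; [exact: kf|exact: fD].
have f1 : finite_set [set P : pt | (1%:M : 'M[K]_2) != 1%:M].
  by apply: (@sub_finite_set _ _ set0) => // P /=; rewrite eqxx.
exists (end_order (fun=> 1%:M)), (end_order (fun P => k P *m d P)); split.
- exact (end_order_maximal (fun=> unitmx1 K 2) f1).
- exact (end_order_maximal hu hf).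
- move=> U oU; have loc P : twist (k P) (level P (D P)) =
      twist 1%:M (level P 0) `&` twist (k P *m d P) (level P 0).
    rewrite (twistM _ (ku P) (du P)) twist1 (level_ring_meet (local_unif P)).
    by rewrite -[X in _ = X `&` _](twist_unit (@levelM _ P 0) (hk P)).
  apply/seteqP; split=> A.
    by move=> h; split=> P UP; have := h P UP; rewrite loc => -[h1 h2];
      [exact: h1|exact: h2].
  by move=> [h1 h2] P UP; rewrite loc; split; [exact: h1|exact: h2].
move=> P; have U := completed_unif_ring P; have [_ k1 k2] := hk P.
have mku : map_mx (completion_of P) (k P) \in unitmx by rewrite map_unitmx; exact: ku.
have mk : units_of (completed_level P 0) (map_mx (completion_of P) (k P)).
  by split; [exact: mku|exact/level0_map|rewrite -map_invmx; exact/level0_map].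
have p0 := invr_neq0 (expf_neq0 (D P) (completed_unif_neq0 P)).
exists (map_mx (completion_of P) (k P)); first exact: mku.
split.
  rewrite (order_completion_end P (fun=> unitmx1 K 2) f1) map_mx1 twist1.
  rewrite (mx2_set_level0 _ (completed_unif P)) (conj_setE _ mku).
  by rewrite (twist_unit (level_ringM U (n := 0)) mk).
rewrite (order_completion_end P hu hf) (mx2_set_twist U) (conj_setE _ mku).
rewrite map_mxM map_mx2 rmorph1 !rmorph0 fmorphV completed_unifX in p0 *.
exact (twistM _ mku (diag_unit p0)).
Qed.

(** A split order contains the projection to the first summand. *)
Lemma split_idempotent (S : pt -> set 'M[K]_2) : is_split (stalkwise S) ->
  exists e : 'M[K]_2, [/\ e *m e = e, e != 0, e != 1%:M & forall P, S P e].
Proof.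
move=> [g [L1 [L2 [gu [m1 _] [m2 _] e]]]].
have oT : open_set (setT : set pt) by split; [exists infty|rewrite setCT].
have [h1 h2 h3] := rank_one_idempotent gu.
exists (g *m mx2 1 0 0 0 *m invmx g); split=> // P.
have hT : stalkwise S setT (g *m mx2 1 0 0 0 *m invmx g).
  rewrite (e _ oT); exists (mx2 1 0 0 0) => //; split; rewrite mx2E.
  - by move=> Q _; exact: local_ring1.
  - exact: (sections_0 m1 oT).
  - exact: (sections_0 m2 oT).
  - by move=> Q _; exact: local_ring0.
exact: hT.
Qed.

Lemma constant_vanishing P (c : F) n : local_ring P (c%:P%:F / unif P ^+ n.+1) -> c = 0.
Proof.
move=> h; apply/eqP; apply: contrapT => /negP c0; apply: (@local_ring_unifV _ P).
have h1 : local_ring P (c%:P%:F / unif P).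
  by have := local_ring_le (ltn0Sn n) h; rewrite expr1.
have := local_ringM (local_ring_const P c^-1) h1.
by rewrite mulrA -tofracM -polyCM mulVf // mul1r.
Qed.

(** At most one of x and x + 1 vanishes at P. *)
Lemma coprime_vanishing P x n : local_ring P x ->
  local_ring P (x * (x + 1) / unif P ^+ n) ->
  local_ring P (x / unif P ^+ n) \/ local_ring P ((x + 1) / unif P ^+ n).
Proof.
move=> hx hxx; have hx1 := local_ringD hx (local_ring1 P).
have [h|h] := local_ring_unit_or hx.
  have [->|x0] := eqVneq x 0; first by left; rewrite mul0r; exact: local_ring0.
  by right; have := local_ringM h hxx; rewrite !mulrA mulVf // mul1r.
have h1 : local_ring P (x + 1)^-1.
  have := local_ring_1D h; rewrite mulrC (divfK (unif_neq0 P)) addrC.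
  by [].
have [e|x0] := eqVneq (x + 1) 0; first by right; rewrite e mul0r; exact: local_ring0.
by left; have := local_ringM h1 hxx; rewrite [x * _]mulrC !mulrA mulVf // mul1r.
Qed.

End NonSplit.

(** * Eichler orders that do not split *)

Section NonSplitLevels.
Variable F : finFieldType.
Local Notation K := 'K_F.
Local Notation pt := (closed_point F).
Local Notation infty := (None : pt).
Implicit Types (P Q R : pt) (D : pt -> nat) (n : nat).

Definition coordinate P : K := if P is Some _ then 'X%:F else 'X%:F^-1.

Lemma coordinate_int P : local_ring P (coordinate P).
Proof. by case: P => [p|]; [exact: local_ring_poly|exact: local_ring_unif infty]. Qed.

(** A nonzero polynomial of degree at most one does not vanish on a subscheme of degree
    two. *)
Lemma coordinate_nonconstant P n (a b : F) : (2 <= point_degree P * n)%N ->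
  local_ring P ((a%:P%:F * coordinate P + b%:P%:F) / unif P ^+ n) -> a = 0 /\ b = 0.
Proof.
have coefs c d : c%:P * 'X + d%:P = 0 :> {poly F} -> c = 0 /\ d = 0.
  move=> e; split.
    by have := congr1 (fun p : {poly F} => p`_1) e; rewrite coefD coefMX !coefC /= addr0.
  by have := congr1 (fun p : {poly F} => p`_0) e; rewrite coefD coefMX !coefC /= add0r.
have sz (c d : F) : (size (c%:P * 'X + d%:P)%R <= 2)%N.
  by rewrite size_MXaddC; case: ifP => // _; rewrite ltnS size_polyC; case: (_ == _).
case: P => [p|] /=.
  move=> hn h; apply: coefs.
  have {h} hdvd : (val p ^+ n %| a%:P * 'X + b%:P)%R.
    by apply: local_ring_dvdX; rewrite tofracD tofracM; exact: h.
  apply/eqP; apply: contraTT hdvd => c0; apply/negP => /dvdp_leq => /(_ c0).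
  rewrite leqNgt; case/negP; apply: leq_ltn_trans (sz a b) _.
  have := size_exp (val p) n; move: hn; rewrite -/(unif _).
  by case: (size (val p ^+ n)) => [|m] /= hn e; rewrite -e in hn.
rewrite mul1n => hn h.
have x0 : 'X%:F != 0 :> K by rewrite tofrac_eq0 polyX_eq0.
have h2 := local_ring_le hn h.
have e : (a%:P%:F * 'X%:F^-1 + b%:P%:F) / ('X%:F^-1) ^+ 2 =
    ((b%:P * 'X + a%:P) * 'X)%:F :> K.
  by rewrite tofracM tofracD tofracM (infty_square _ _ x0).
rewrite e in h2; have := local_ring_infty_const h2.
have [z|z] := eqVneq (b%:P * 'X + a%:P) 0.
  by have [-> ->] := coefs _ _ z.
by rewrite size_mulX // ltnS leqn0 size_poly_eq0 (negPf z).
Qed.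

Definition nonsplit_level D := exists E, is_Eichler_order_of_level D E /\ ~ is_split E.

(** The line (t : 1) modulo P^D(P), or (1/t : 1) at infinity, differs from all constant
    lines, whereas a global idempotent has constant entries and fixes only its kernel
    and its image. *)
Lemma nonsplit_nonconstant_line D P : is_effective_divisor D ->
  (2 <= point_degree P * D P)%N -> nonsplit_level D.
Proof.
move=> fD hP; pose k R : 'M[K]_2 := if R == P then mx2 1 (coordinate P) 0 1 else 1%:M.
have hk R : units_of (level R 0) (k R).
  rewrite /k; have [->|_] := eqVneq R P.
    apply: (units_of_level_upper (local_unif P)); rewrite expr0 divr1.
    exact: coordinate_int.
  by split; rewrite ?invmx1; [exact: unitmx1| |]; exact: (level_ring1 (local_unif R) 0).
have kf : finite_set [set R | k R != 1%:M].
  apply: (@sub_finite_set _ _ [set P]); last exact: finite_set1.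
  move=> R /=; rewrite /k; have [-> _|_] := eqVneq R P; first by [].
  by rewrite eqxx.
eexists; split; first exact: (Eichler_of_lines fD hk kf).
move=> /split_idempotent[e [ee e0 e1 he]].
have [tr dt] := idempotent_trace_det ee e0 e1.
have hint R i j : local_ring R (e i j).
  have h0 : twist (k R) (level R 0) e.
    by apply: (level_ring_le (local_unif R) (leq0n (D R))); exact: he.
  by rewrite (twist_unit (@levelM _ R 0) (hk R)) in h0; move/level_ring0P: h0; apply.
have [a ea] := regular_constant (fun R => hint R 0 0).
have [b eb] := regular_constant (fun R => hint R 0 1).
have [c ec] := regular_constant (fun R => hint R 1 0).
have [d ed] := regular_constant (fun R => hint R 1 1).
have := he P; rewrite /k eqxx => -[_ hq _ _].
rewrite conj_upper in hq.
have Ec := idempotent_eigenline (coordinate P) tr dt.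
have hc := local_ringM (hint P 1 0) hq.
rewrite mulrA Ec mulNr in hc; have {}hc := local_ringN hc; rewrite opprK in hc.
have hx : local_ring P (e 1 0 * coordinate P - e 0 0).
  by apply: local_ringB (hint P 0 0); exact: local_ringM (hint P 1 0) (coordinate_int P).
have tr1 : a + d = 1.
  move: tr; rewrite ea ed -tofracD -polyCD -[1]tofrac1 => /eqP.
  by rewrite tofrac_eq -polyC1 => /eqP/polyC_inj.
have entry (q : F) : q = 1 \/ q = -1 -> c = 0 -> a - d = q -> False.
  move=> hq1 c0 ad; move: hq; rewrite ec c0 tofrac0.
  have -> : (e 0 0 - coordinate P * 0%:P%:F) * coordinate P + (e 0 1 - coordinate P * e 1 1) =
     q%:P%:F * coordinate P + b%:P%:F.
    by rewrite -ad ea eb ed polyCB tofracB polyC0 tofrac0; exact: eigen_entry.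
  move/(coordinate_nonconstant hP) => [q0 _].
  by case: hq1 => hq1; move/eqP: q0; rewrite hq1 ?oppr_eq0 oner_eq0.
case: (coprime_vanishing hx hc) => {hx hc} h.
  have [c0 a0] : c = 0 /\ - a = 0.
    apply: (coordinate_nonconstant hP).
    by rewrite polyCN tofracN -ec -ea; exact: h.
  move/eqP: a0; rewrite oppr_eq0 => /eqP a0.
  apply: (entry (-1)) c0 _; first by right.
  by rewrite -tr1 a0 !add0r.
have [c0 a0] : c = 0 /\ 1 - a = 0.
  apply: (coordinate_nonconstant hP).
  rewrite polyCB tofracB -ec -ea polyC1 tofrac1.
  by move: h; rewrite -addrA [- _ + 1]addrC.
apply: (entry 1) c0 _; first by left.
have a1 : a = 1 by move/eqP: a0; rewrite subr_eq0 => /eqP.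
have d0 : d = 0 by apply: (addrI a); rewrite addr0 tr1 a1.
by rewrite a1 d0 subr0.
Qed.



(** Of three distinct lines of F^2 one is neither the kernel nor the image of a given
    idempotent. The lines at P, Q and R are (0 : 1), (1 : 1) and (1 : 0). *)
Lemma nonsplit_three_points D P Q R : is_effective_divisor D -> uniq [:: P; Q; R] ->
  (0 < D P)%N -> (0 < D Q)%N -> (0 < D R)%N -> nonsplit_level D.
Proof.
move=> fD; rewrite /= !inE negb_or andbT => /andP[/andP[PQ PR] QR] DP DQ DR.
pose k (S : pt) : 'M[K]_2 := if S == Q then mx2 1 1 0 1 else if S == R then swap_mx K else 1%:M.
have hk S : units_of (level S 0) (k S).
  have U := local_unif S; rewrite /k; case: (S == Q); last case: (S == R).
  - apply: (units_of_level_upper U); rewrite expr0 divr1; exact: local_ring1.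
  - exact: (units_of_swap U).
  by split; rewrite ?invmx1; [exact: unitmx1| |]; exact: (level_ring1 U 0).
have kf : finite_set [set S | k S != 1%:M].
  apply: (@sub_finite_set _ _ ([set Q] `|` [set R])).
    move=> S /=; rewrite /k; have [-> _|_] := eqVneq S Q; first by left.
    have [-> _|_] := eqVneq S R; first by right.
    by rewrite eqxx.
  by rewrite finite_setU; split; exact: finite_set1.
eexists; split; first exact: (Eichler_of_lines fD hk kf).
move=> /split_idempotent[e [ee e0 e1 he]].
have [tr dt] := idempotent_trace_det ee e0 e1.
have hint S i j : local_ring S (e i j).
  have h0 : twist (k S) (level S 0) e.
    by apply: (level_ring_le (local_unif S) (leq0n (D S))); exact: he.
  by rewrite (twist_unit (@levelM _ S 0) (hk S)) in h0; move/level_ring0P: h0; apply.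
have he1 S : (0 < D S)%N -> local_ring S ((invmx (k S) *m e *m k S) 0 1 / unif S ^+ 1).
  move=> DS; have := level_ring_le (local_unif S) DS (he S).
  by case.
have vanish (S : pt) (t : K) : (forall S', local_ring S' t) ->
    local_ring S (t / unif S ^+ 1) -> t = 0.
  move=> ht hS; have [c ec] := regular_constant ht; rewrite ec in hS *.
  by rewrite (constant_vanishing hS) polyC0 tofrac0.
have b0 : e 0 1 = 0.
  apply: (vanish P (e 0 1)) => [S|]; first exact: hint.
  have := he1 P DP; rewrite /k (negPf PQ) (negPf PR) invmx1 mul1mx mulmx1.
  by [].
have c0 : e 1 0 = 0.
  apply: (vanish R (e 1 0)) => [S|]; first exact: hint.
  have := he1 R DR; rewrite /k eq_sym (negPf QR) eqxx swap_inv {1}(mx2_eta e) swap_conj mx2E.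
  by [].
have ad : e 0 0 - e 1 1 = 0.
  apply: (vanish Q (e 0 0 - e 1 1)) => [S|]; first by apply: local_ringB; exact: hint.
  have := he1 Q DQ; rewrite /k eqxx conj_upper b0 c0.
  by rewrite mulr0 subr0 mulr1 mul1r sub0r.
have ead : e 0 0 = e 1 1 by apply/eqP; rewrite -subr_eq0 ad.
move: dt; rewrite b0 mul0r ead => /esym/eqP; rewrite mulf_eq0 orbb => /eqP d0.
by move: tr; rewrite ead d0 addr0 => /eqP; rewrite eq_sym oner_eq0.
Qed.

Lemma point_degree_gt0 P : (0 < point_degree P)%N.
Proof. by case: P => [p|] //=; have [sp _] := point_irr p; case: (size (val p)) sp => [|[]]. Qed.

(** If degree times multiplicity is at most one at every point, then D is the sum of
    its support, which consists of rational points. *)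
Lemma nonsplit_unless_two_points D : is_effective_divisor D ->
  ~ is_sum_of_at_most_two_rational_points D -> nonsplit_level D.
Proof.
move=> fD nD; have [[P hP]|small] := pselect (exists P, (2 <= point_degree P * D P)%N).
  exact: (nonsplit_nonconstant_line fD hP).
have [s us es] : exists2 s : seq pt, uniq s & [set P | D P != 0%N] = [set` s].
  have /finite_seqP[s es] := fD; exists (undup s); first exact: undup_uniq.
  by rewrite es; apply/seteqP; split=> P /=; rewrite mem_undup.
have inS P : (P \in s) = (D P != 0%N).
  by apply/idP/idP => h; [have : [set` s] P by []; rewrite -es|
     have : [set P | D P != 0%N] P by []; rewrite es].
have simple P : P \in s -> point_degree P = 1%N /\ D P = 1%N.
  rewrite inS -lt0n => DP; have dP := point_degree_gt0 P.
  have : ~ (2 <= point_degree P * D P)%N by move=> h; apply: small; exists P.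
  move/negP; rewrite -leqNgt => le.
  by move: (point_degree P) (D P) dP DP le => [|[|a]] [|[|b]].
have [s2|] := leqP (size s) 2.
  case: nD; exists s; split=> //.
    by apply/allP => P /simple[-> _].
  move=> P; have [Ps|Ps] := boolP (P \in s).
    have [_ ->] := simple P Ps.
    rewrite (bigD1_seq P) //= eqxx big1 // => Q QP.
    by rewrite eq_sym (negPf QP).
  move: (Ps); rewrite inS negbK => /eqP ->.
  rewrite big1_seq // => Q /andP[_ Qs].
  by case: eqP => // e; rewrite e Qs in Ps.
case: s us inS {es simple} => [|P [|Q [|R s]]] // us inS _.
apply: (@nonsplit_three_points D P Q R fD).
- by move: us; rewrite /= !inE !negb_or -!andbA => /and5P[-> -> _ -> _].
- by rewrite lt0n -inS inE eqxx.
- by rewrite lt0n -inS !inE eqxx orbT.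
- by rewrite lt0n -inS !inE eqxx !orbT.
Qed.

End NonSplitLevels.

Theorem theorem1p2 (F : finFieldType) (D : closed_point F -> nat)
    (hD : is_effective_divisor D) :
  (forall E, is_Eichler_order_of_level D E -> is_split E) <->
  is_sum_of_at_most_two_rational_points D.
Proof.
split=> [h|hs E]; last exact: split_of_two_points.
apply: contrapT => /(nonsplit_unless_two_points hD)[E [oE nE]].
by apply: nE; exact: h.
Qed.
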